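(* Let $\Gamma\subset\mathbb{C}$ be a Jordan curve with arc-length parametrization $\gamma\in C^2$, and let $\beta\ge1$. Let $\mu_0$ be a probability measure on $\Gamma$ and suppose that the initial empirical measures satisfy $\mu_0^{(N)}\to\mu_0$ in the weak sense, as $N\to+\infty$. Then the family $\{(\mu_t^{(N)})_{t\ge0}\}_{N\ge1}$ is tight, and any subsequential limit $\mu=(\mu_t)_{t\ge0}$ satisfies $$d\mu_t(f)=\frac{\beta}{4}\int_\Gamma\int_\Gamma\left(\partial_sf(z)\,\mathrm{Re}\frac{\tau(z)}{z-w}-\partial_sf(w)\,\mathrm{Re}\frac{\tau(w)}{z-w}\right)\mu_t(dz)\,\mu_t(dw)\,dt$$ for all test functions $f$ that are smooth in a neighborhood of $\Gamma$.
   Context: $\Gamma$ has length $l$; $\gamma:\mathbb{R}\to\Gamma$ is its $l$-periodic counterclockwise arc-length parametrization; $\tau:\Gamma\to\partial\mathbb{D}$ is the unit tangent map oriented counterclockwise ($\tau(\gamma(s))=\gamma'(s)$). For each $N\ge 1$, Dyson Brownian motion on $\Gamma$ with inverse temperature $\beta$ is $\boldsymbol{Z}=(Z_1,\dots,Z_N)$, $Z_i(t)=\gamma(X_i(t))$, where $X$ is the unique strong solution of $$dX_i(t)=dB_i(t)+\frac{\beta}{2}\sum_{j\ne i}\mathrm{Re}\left\{\frac{\gamma'(X_i(t))}{\gamma(X_i(t))-\gamma(X_j(t))}\right\}dt,\quad 1\le i\le N,$$ staying in $\{x\in\mathbb{R}^N:x_1<\dots<x_N<x_1+l\}$, with $B$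 an $N$-dimensional standard Brownian motion. The initial condition $\boldsymbol{Z}(0)$ may be random. The empirical measure is $\mu_t^{(N)}=\frac1N\sum_{i=1}^N\delta_{Z_i(t/N)}$, a random probability measure on $\Gamma$ (note the time scaling $t/N$). $\mu_t(f)=\int_\Gamma f\,d\mu_t$. Test functions $f$ are real-valued. The tangential derivative is $\partial_sf(z)=\lim_{h\to0,\,h\in\mathbb{R}}\frac{f(z+\tau(z)h)-f(z)}{h}$, $z\in\Gamma$. The integrand in the double integral is extended continuously to the diagonal $z=w$. Tightness is in law, as random elements of $C([0,T],\mathcal{P}(\Gamma))$ for every $T>0$, where $\mathcal{P}(\Gamma)$ is the space of probability measures on $\Gamma$ with the weak topology and the path space carries the topology of uniform convergence on $[0,T]$. The differential equation is understood in integrated form: $\mu_t(f)=\mu_0(f)+\int_0^t(\cdots)\,dr$ for $t\ge0$. *)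

(* Defs.v *)
From HB Require Import structures.
From mathcomp Require Import all_boot all_order all_algebra.
From mathcomp Require Import complex.
From mathcomp Require Import all_classical all_reals all_analysis.

Set Implicit Arguments.
Unset Strict Implicit.
Unset Printing Implicit Defensive.

Import Order.TTheory GRing.Theory Num.Theory.
Import numFieldNormedType.Exports.

Local Open Scope classical_set_scope.
Local Open Scope ring_scope.
Local Open Scope complex_scope.

(* The usual topology of the complex plane, from the modulus. *)
HB.instance Definition _ (R : realType) := NormedModule.copy R[i] R[i]^o.

(** * Borel probability measures with the weak topology *)

Definition borel (X : ptopologicalType) := g_sigma_algebraType (@open X).

Definition prob (R : realType) (X : ptopologicalType) : Type :=
  probability (borel X) R.

Definition bounded_continuous (R : realType) (X : ptopologicalType) : Type :=
  {f : X -> R | continuous f /\ exists M : R, forall x, `|f x| <= M}.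

Definition pairing (R : realType) (X : ptopologicalType) (m : prob R X)
    (f : X -> R) : R :=
  \int[m : probability (borel X) R]_(x in [set: borel X]) f x.

Definition prob_coords (R : realType) (X : ptopologicalType) (m : prob R X) :
    {ptws bounded_continuous R X -> R} :=
  fun f => pairing m (projT1 f).

HB.instance Definition _ (R : realType) (X : ptopologicalType) :=
  Choice.copy (prob R X) (probability (borel X) R).
(* The weak topology: the coarsest one (with its uniformity) for which all the
   maps m |-> \int f dm, f bounded continuous, are continuous. *)
HB.instance Definition _ (R : realType) (X : ptopologicalType) :=
  Uniform.copy (prob R X) (initial_topology (@prob_coords R X)).

Section empirical_measure.
Context {R : realType} {X : ptopologicalType} (n : nat) (x : 'I_n.+1 -> X).

Definition empirical_meas : set (borel X) -> \bar R :=
  mscale (n.+1%:R^-1)%:nng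
    (msum (fun k => dirac (x (inord k) : borel X)) n.+1).

HB.instance Definition _ := Measure.on empirical_meas.

Let empirical_measT : empirical_meas setT = 1%E.
Proof.
rewrite /empirical_meas /mscale /= /msum /=.
under eq_bigr do rewrite diracT.
by rewrite sumEFin sumr_const card_ord -EFinM mulVf// pnatr_eq0.
Qed.

HB.instance Definition _ :=
  Measure_isProbability.Build _ _ R empirical_meas empirical_measT.

Definition empirical : prob R X := empirical_meas.

End empirical_measure.

(** * Paths of probability measures *)

(* The function space R -> prob R X with uniform convergence on [0, T]; what
   happens outside [0, T] is invisible for this topology. *)
Definition paths (R : realType) (X : ptopologicalType) (T : R) : Type :=
  {uniform` `[0, T]%classic -> prob R X}.

HB.instance Definition _ (R : realType) (X : ptopologicalType) (T : R) :=
  Uniform.on (paths X T).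

(* C([0, T], prob R X), as a subspace of [paths X T]. *)
Definition continuous_paths (R : realType) (X : ptopologicalType) (T : R) :
    set (paths X T) :=
  [set p | {within `[0, T], continuous (p : R -> prob R X)}].

Definition random_path (R : realType) (X : ptopologicalType)
    (d : measure_display) (Om : measurableType d) (M : Om -> R -> prob R X) :=
  forall T : R, 0 < T ->
    (forall w, continuous_paths (M w : paths X T)) /\
    (forall U : set (paths X T), open U ->
      measurable [set w | U (M w : paths X T)]).

(* Elements of [prob R X] are set functions on all subsets, so those agreeing
   on Borel sets are topologically indistinguishable; requiring the compact set
   to be closed makes it saturated under this relation, hence Borel. *)
Definition tight (R : realType) (X : ptopologicalType)
    (d : nat -> measure_display) (Om : forall n, measurableType (d n))
    (P : forall n, probability (Om n) R)
    (M : forall n, Om n -> R -> prob R X) :=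
  forall T : R, 0 < T -> forall eps : R, 0 < eps ->
  exists K : set (paths X T),
    [/\ K `<=` @continuous_paths R X T, compact K, closed K &
        forall n, ((1 - eps)%:E <= P n [set w | K (M n w : paths X T)])%E].

Definition cvg_in_law (R : realType) (E : topologicalType) (D : set E)
    (d : nat -> measure_display) (Om : forall n, measurableType (d n))
    (P : forall n, probability (Om n) R) (Y : forall n, Om n -> E)
    (d' : measure_display) (Om' : measurableType d') (P' : probability Om' R)
    (Y' : Om' -> E) :=
  forall Phi : E -> R, {within D, continuous Phi} ->
    (exists M : R, forall x, D x -> `|Phi x| <= M) ->
    (\int[P n]_w (Phi (Y n w))%:E)%E @[n --> \oo] -->
    (\int[P']_w (Phi (Y' w))%:E)%E.

Definition subsequential_limit (R : realType) (X : ptopologicalType)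
    (d : nat -> measure_display) (Om : forall n, measurableType (d n))
    (P : forall n, probability (Om n) R) (M : forall n, Om n -> R -> prob R X)
    (d' : measure_display) (Om' : measurableType d') (P' : probability Om' R)
    (M' : Om' -> R -> prob R X) :=
  random_path M' /\
  exists phi : nat -> nat, {homo phi : m n / (m < n)%N} /\
    forall T : R, 0 < T ->
      cvg_in_law (@continuous_paths R X T) (fun k => P (phi k))
        (fun k => (M (phi k) : Om (phi k) -> paths X T))
        P' (M' : Om' -> paths X T).

Definition cvg_in_prob (R : realType) (E : topologicalType)
    (d : nat -> measure_display) (Om : forall n, measurableType (d n))
    (P : forall n, probability (Om n) R) (Y : forall n, Om n -> E) (y : E) :=
  forall U : set E, open U -> U y ->
    P n [set w | U (Y n w)] @[n --> \oo] --> 1%E.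

(** * The curve *)

Definition cderive (R : realType) (g : R -> R[i]) (s : R) : R[i] :=
  derive1 (fun s => complex.Re (g s)) s +i*
  derive1 (fun s => complex.Im (g s)) s.

Definition cderivable (R : realType) (g : R -> R[i]) :=
  forall s, derivable (fun s => complex.Re (g s)) s 1 /\
            derivable (fun s => complex.Im (g s)) s 1.

Definition C2 (R : realType) (g : R -> R[i]) :=
  [/\ cderivable g, cderivable (cderive g) &
      continuous (cderive (cderive g))].

Definition winding_number (R : realType) (l : R) (g : R -> R[i]) (a : R[i]) : R :=
  (2 * pi)^-1 *
  \int[lebesgue_measure]_(s in `[0, l]) complex.Im (cderive g s / (g s - a)).

(* [g] is an [l]-periodic arc-length parametrization of the Jordan curve
   [range g], which is differentiable and has length [l]; it is
   counterclockwise, i.e. it winds once in the positive direction around each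
   point of the bounded component of the complement. *)
Definition jordan_arclength (R : realType) (l : R) (g : R -> R[i]) :=
  [/\ 0 < l,
      forall s, g (s + l) = g s,
      {in `[0, l[ &, injective g},
      cderivable g /\ (forall s, `|cderive g s| = 1) &
      forall a, ~ range g a ->
        bounded_set (connected_component (~` range g) a) ->
        winding_number l g a = 1].

Definition curve (R : realType) (g : R -> R[i]) : Type := set_type (range g).

Definition on_curve (R : realType) (g : R -> R[i]) (s : R) : curve g :=
  exist _ (g s) (mem_set (imageT g s)).

Definition curve_val (R : realType) (g : R -> R[i]) (z : curve g) : R[i] :=
  projT1 z.

HB.instance Definition _ (R : realType) (g : R -> R[i]) :=
  Topological.copy (curve g) (set_type (range g)).
HB.instance Definition _ (R : realType) (g : R -> R[i]) :=
  isPointed.Build (curve g) (on_curve g 0).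

(** * Test functions *)

Definition dir_derive (R : realType) (f : R[i] -> R) (v z : R[i]) : R :=
  derive1 (fun h : R => f (z + v * h%:C)) 0.

Fixpoint Ck (R : realType) (k : nat) (U : set R[i]) (f : R[i] -> R) : Prop :=
  {within U, continuous f} /\
  if k is k'.+1 then
    forall v, v = 1 \/ v = 'i ->
      (forall z, U z -> derivable (fun h : R => f (z + v * h%:C)) 0 1) /\
      Ck k' U (dir_derive f v)
  else True.

Definition smooth_near (R : realType) (G : set R[i]) (f : R[i] -> R) :=
  exists U : set R[i], [/\ open U, G `<=` U & forall k, Ck k U f].

Definition tangential (R : realType) (tau : R[i] -> R[i]) (f : R[i] -> R)
    (z : R[i]) : R := dir_derive f (tau z) z.

Definition kernel_off_diag (R : realType) (tau : R[i] -> R[i])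
    (f : R[i] -> R) (z w : R[i]) : R :=
  tangential tau f z * complex.Re (tau z / (z - w))
  - tangential tau f w * complex.Re (tau w / (z - w)).

(* Continuous extension to the diagonal of [G `*` G]. *)
Definition extend_diag (R : realType) (G : set R[i])
    (H : R[i] -> R[i] -> R) (z w : R[i]) : R :=
  if z == w then
    lim (H p.1 p.2 @[p --> within [set p | [/\ G p.1, G p.2 & p.1 != p.2]]
                                  (nbhs (z, z))])
  else H z w.

Definition limit_drift (R : realType) (g : R -> R[i]) (tau : R[i] -> R[i])
    (f : R[i] -> R) (m : prob R (curve g)) : R :=
  pairing m (fun z => pairing m (fun w =>
    extend_diag (range g) (kernel_off_diag tau f) (curve_val z) (curve_val w))).

(** * Dyson Brownian motion *)

Section processes.
Context {R : realType} {d : measure_display} {Om : measurableType d}.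
Variable P : probability Om R.

Definition sigma_gen (I : Type) (D : set I) (Y : I -> Om -> R) :
    set (set Om) :=
  <<s \bigcup_(i in D) preimage_set_system setT (Y i) measurable >>.

Definition independent (F G : set (set Om)) :=
  forall A B, F A -> G B -> P (A `&` B) = (P A * P B)%E.

(* Membership in the P-completion of F. *)
Definition completion (F : set (set Om)) (A : set Om) :=
  exists2 A', F A' & P.-negligible (A `+` A').

Definition continuous_process (N : nat) (Y : 'I_N -> R -> Om -> R) :=
  (forall i t, 0 <= t -> measurable_fun setT (Y i t)) /\
  (forall i w, {within `[0, +oo[, continuous (fun t => Y i t w)}).

Definition history (N : nat) (Y : 'I_N -> R -> Om -> R) (t : R) :=
  sigma_gen [set p : 'I_N * R | 0 <= p.2 <= t] (fun p => Y p.1 p.2).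

Definition full_history (N : nat) (Y : 'I_N -> R -> Om -> R) :=
  sigma_gen [set p : 'I_N * R | 0 <= p.2] (fun p => Y p.1 p.2).

(* The increment over [s, t] has law N(0, (t - s) I) and is independent of the
   past; the second argument of [normal_prob] is the standard deviation. *)
Definition brownian_motion (N : nat) (B : 'I_N -> R -> Om -> R) :=
  [/\ continuous_process B,
      {ae P, forall w, forall i, B i 0 w = 0} &
      forall s t, 0 <= s -> s < t ->
      forall A, history B s A ->
      forall U : 'I_N -> set R, (forall i, measurable (U i)) ->
        P (A `&` [set w | forall i, U i (B i t w - B i s w)]) =
        (P A * \prod_(i < N) normal_prob 0 (Num.sqrt (t - s)) (U i))%E].

Definition dyson_drift (N : nat) (g : R -> R[i]) (x : 'I_N -> R) (i : 'I_N) :=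
  \sum_(j < N | j != i) complex.Re (cderive g (x i) / (g (x i) - g (x j))).

Definition chamber (l : R) (N : nat) (x : 'I_N -> R) :=
  (forall i j : 'I_N, (i < j)%N -> x i < x j) /\ (forall i j, x j < x i + l).

(* X is a strong solution of the Dyson SDE driven by B: it is adapted to the
   completed filtration generated by X(0) and B, X(0) being independent of B.
   The noise is additive, so that the SDE needs no stochastic integral. *)
Definition dyson_bm (l : R) (g : R -> R[i]) (beta : R) (N : nat)
    (B X : 'I_N -> R -> Om -> R) :=
  [/\ brownian_motion B /\ continuous_process X,
      independent (history X 0) (full_history B),
      forall t, 0 <= t -> forall i (U : set R), measurable U ->
        completion <<s history X 0 `|` history B t >> (X i t @^-1` U),
      {ae P, forall w, forall t, 0 <= t -> chamber l (fun i => X i t w)} &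
      {ae P, forall w, forall t, 0 <= t -> forall i,
        X i t w = X i 0 w + B i t w + beta / 2 *
          \int[lebesgue_measure]_(r in `[0, t])
            dyson_drift g (fun j => X j r w) i}].

(* With N = n.+1 particles Z_i = g (X_i), run at speed 1 / N. *)
Definition empirical_path (g : R -> R[i]) (n : nat)
    (X : 'I_n.+1 -> R -> Om -> R) (w : Om) (t : R) :
    prob R (curve g) :=
  empirical (fun i => on_curve g (X i (t / n.+1%:R) w)).

End processes.

(* Main.v *)
(* In the arc-length coordinate a test function becomes an [l]-periodic C^2
   function [phi], and after symmetrisation in the two particles the singular
   drift acts on [phi] through a kernel which is continuous on the whole torus:
   the chord-arc inequality and C^2 regularity give its extension [phi''] to the
   diagonal.  Hence the limiting drift is a continuous function of the measure
   for the weak topology.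

   Instead of Ito's formula, second-order Taylor expansion along fine time grids
   is used.  With [m] the empirical measure and [m_t(phi)] its integral of [phi]
   at time [t], the difference
     m_t(phi) - m_0(phi) - int_0^t (beta/4) drift(m_r) dr
   is the sum of a martingale, bounded by Chebyshev's inequality for the stopped
   martingale, of quadratic variation terms of order [1/N], and of diagonal terms
   of order [1/N]; so it tends to [0] uniformly on [0, T], in probability.

   A countable family is dense among the periodic C^2 functions for the C^2 norm,
   so this bounds the moduli of continuity of all [m_t(phi)] at once and yields
   tightness.  Compactness of the set of measures comes from writing each of them
   as the image of the uniform law by a nondecreasing quantile function and taking
   pointwise ultrafilter limits of these.  Applying the convergence in law to the
   truncated absolute value of the difference above, a bounded continuous function
   of the path, identifies the limit. *)

Require Import Defs.
From HB Require Import structures.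
From mathcomp Require Import all_boot all_order all_algebra.
From mathcomp Require Import complex ring lra.
From mathcomp Require Import all_classical all_reals all_analysis measurable_realfun.

Set Implicit Arguments.
Unset Strict Implicit.
Unset Printing Implicit Defensive.

Import Order.TTheory GRing.Theory Num.Theory.
Import numFieldNormedType.Exports.

Local Open Scope classical_set_scope.
Local Open Scope ring_scope.
Local Open Scope complex_scope.

(** * Periodic C2 functions and the geometry of the curve *)

(** For a fixed number of particles the pair drift has no bound uniform over paths: it is finite and
    continuous along each path because the particles stay distinct. Hence the mesh that makes the
    Taylor expansion accurate depends on the path, and the exceptional event is a lower limit of
    events over finer and finer grids, whose probability bounds do not depend on the mesh. The
    singular drift never enters a probability bound: averaged over the particles it is, up to the
    diagonal term, an integral of the bounded symmetrised kernel. The decay in the number of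
    particles comes from the time change: at speed [1 / N] a noise increment over a mesh [T / m] has
    variance [T / (m N)], and the average over particles is handled by convexity. Quantile functions
    appear because dominated convergence fails along ultrafilters: for monotone functions with a
    common range, Riemann sums converge at a uniform rate, so a limit of integrals reduces to
    finitely many pointwise limits. *)

HB.lock Definition rderiv (R : realType) (h : R -> R) : R -> R := derive1 h.

Definition derivable1 (R : realType) (h : R -> R) : Prop :=
  forall x : R, derivable h x 1.

Lemma derivable_continuous (R : realType) (h : R -> R) :
  derivable1 h -> continuous h.
Proof.
by move=> dh x; apply: differentiable_continuous; exact/derivable1_diffP.
Qed.

Lemma is_derive_deriv (R : realType) (h : R -> R) (x : R) : derivable1 h ->
  is_derive x 1 h (rderiv h x).
Proof. by move=> dh; rewrite rderiv.unlock derive1E; exact/derivableP/dh. Qed.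

Lemma deriv_val (R : realType) (h : R -> R) (x d : R) :
  is_derive x 1 h d -> rderiv h x = d.
Proof. by move=> dh; rewrite rderiv.unlock derive1E derive_val. Qed.

Section difference_quotient.
Context {R : realType}.
Implicit Types h : R -> R.

(** Difference quotient completed by the derivative on the diagonal. Written with it, the
    interaction kernel contains no division by [s - u]. *)
Definition dq h (s u : R) : R :=
  if s == u then rderiv h s else (h s - h u) / (s - u).

Lemma dq_mul h s u : dq h s u * (s - u) = h s - h u.
Proof.
rewrite /dq; case: eqVneq => [->|su]; first by rewrite !subrr mulr0.
by rewrite divfK// subr_eq0.
Qed.

Lemma dqC h s u : dq h s u = dq h u s.
Proof.
rewrite /dq eq_sym; case: eqVneq => [->//|su].
by rewrite -mulrNN -invrN !opprB.
Qed.

Lemma dq_mvt h s u : derivable1 h ->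
  exists c, [/\ `|c - s| <= `|s - u|, `|c - u| <= `|s - u| &
    dq h s u = rderiv h c].
Proof.
move=> dh; wlog su : s u / s <= u.
  move=> H; case: (leP s u) => [/H//|/ltW /H[c [c1 c2 E]]].
  by exists c; rewrite dqC (distrC s u); split.
move: su; rewrite le_eqVlt => /orP[/eqP->|su].
  by exists u; rewrite subrr normr0; split => //; rewrite /dq eqxx.
have [||c cab E] := @MVT R h (rderiv h) s u su.
- by move=> x _; exact: is_derive_deriv.
- by apply: continuous_subspaceT; exact: derivable_continuous.
move: cab; rewrite in_itv/= => /andP[sc cu].
exists c; split.
- by rewrite (distrC s) (@gtr0_norm _ (u - s)) ?subr_gt0// ler_norml; lra.
- by rewrite (distrC s) (@gtr0_norm _ (u - s)) ?subr_gt0// ler_norml; lra.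
by rewrite dqC /dq gt_eqF// E mulfK// subr_eq0 gt_eqF//.
Qed.

(** Off the diagonal this is a quotient of continuous functions. At a diagonal point the mean value
    theorem replaces [dq h a b] by [rderiv h c] with [c] between [a] and [b], and [rderiv h] is
    continuous. *)
Lemma dq_continuous h : derivable1 h -> continuous (rderiv h) ->
  continuous (fun p : R * R => dq h p.1 p.2).
Proof.
move=> dh ch [s u]; have ch0 := derivable_continuous dh.
have [<-{u}|su] := eqVneq s u.
  apply/cvgrPdist_le => e e0 /=.
  have /cvgrPdist_le/(_ e e0)[d /= d0 Hd] := ch s.
  exists (ball s d, ball s d) => /=; first by split; exact: nbhsx_ballx.
  move=> [a b] /= [sa sb]; have [c [c1 c2 ->]] := dq_mvt a b dh.
  rewrite {1}/dq eqxx; apply: Hd => /=.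
  have [c' [c1' c2']] : exists c', [/\ (c = c') & `|c' - s| < d].
    exists c; split => //.
    move: c1 c2 sa sb; rewrite /ball/= => c1 c2 sa sb.
    (* Being within [|a - b|] of both [a] and [b] forces [c] to lie between them. *)
    have : c <= Num.max a b /\ Num.min a b <= c.
      move: c1 c2; have [ab|ab] := leP a b.
        by rewrite (distrC a) (@ger0_norm _ (b - a)) ?subr_ge0// !ler_norml;
          move=> ? ?; split; lra.
      rewrite (@gtr0_norm _ (a - b)) ?subr_gt0// !ler_norml.
      by move=> ? ?; split; lra.
    move: sa sb; rewrite !ltr_norml; have [ab|ab] := leP a b;
      move=> ? ? []; lra.
  by rewrite distrC c1'.
have E : {near (s, u), (fun p : R * R => (h p.1 - h p.2) / (p.1 - p.2)) =1
                       (fun p : R * R => dq h p.1 p.2)}.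
  have cB : ((p : R * R).1 - p.2) @[p --> (s, u)] --> s - u.
    by apply: cvgB; [exact: cvg_fst|exact: cvg_snd].
  have su0 : s - u != 0 by rewrite subr_eq0.
  apply: filterS (cvgr_neq0 (s - u) cB su0) => p.
  by rewrite subr_eq0 /dq => /negbTE ->.
rewrite /continuous_at /= -(nbhs_singleton E) /=.
apply: cvg_trans; first exact: near_eq_cvg E.
apply: cvgM.
  apply: cvgB.
    by apply: (@cvg_comp _ _ _ fst h _ (nbhs s)); [exact: cvg_fst|exact: ch0].
  by apply: (@cvg_comp _ _ _ snd h _ (nbhs u)); [exact: cvg_snd|exact: ch0].
by apply: cvgV; [rewrite subr_eq0|apply: cvgB; [exact: cvg_fst|exact: cvg_snd]].
Qed.

End difference_quotient.

Section periodic.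
Context {R : realType} (l : R) (l0 : 0 < l).
Implicit Types h : R -> R.

Lemma periodic_int (T : Type) (h : R -> T) : (forall s, h (s + l) = h s) ->
  forall (k : int) s, h (s + k%:~R * l) = h s.
Proof.
move=> ph; have pn (n : nat) s : h (s + n%:R * l) = h s.
  elim: n s => [|n IH] s; first by rewrite mul0r addr0.
  by rewrite -natr1 mulrDl mul1r addrA ph IH.
move=> [n|n] s; first exact: pn.
rewrite NegzE -(pn n.+1 (s + _)) -addrA -mulrDl.
by rewrite rmorphN/= addNr mul0r addr0.
Qed.

Lemma shift_itv (a s : R) : exists k : int, a <= s + k%:~R * l < a + l.
Proof.
exists (- Num.floor ((s - a) / l)).
have /andP[f1 f2] := @floor_itv R ((s - a) / l).
rewrite rmorphN/= mulNr.
have H0 : ((s - a) / l) * l = s - a by rewrite divfK// gt_eqF.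
have H1 : (Num.floor ((s - a) / l))%:~R * l <= ((s - a) / l) * l.
  by rewrite ler_pM2r.
have H2 : ((s - a) / l) * l < (Num.floor ((s - a) / l))%:~R * l + l.
  rewrite -[X in _ < _ + X]mul1r -mulrDl ltr_pM2r//.
  by rewrite -[1]/(1%:~R) -intrD.
move: H1 H2; rewrite H0; set x := _ * l; lra.
Qed.

Lemma periodic_bounded h : (forall s, h (s + l) = h s) -> continuous h ->
  exists2 M : R, 0 <= M & forall s, `|h s| <= M.
Proof.
move=> ph ch; have [|c _ Hc] := @EVT_max R (fun s => `|h s|) 0 l (ltW l0).
  apply: continuous_subspaceT => x.
  by apply: (@continuous_comp _ _ _ h Num.norm); [exact: ch|exact: norm_continuous].
exists `|h c| => // s; have [k /andP[k1 k2]] := shift_itv 0 s.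
rewrite -(periodic_int ph k s) Hc// in_itv/= k1 ltW//.
by rewrite -[X in _ < X]add0r.
Qed.

Lemma periodic2_ucont (K : R -> R -> R) : (forall s u, K (s + l) u = K s u) ->
  (forall s u, K s (u + l) = K s u) ->
  continuous (fun p : R * R => K p.1 p.2) ->
  forall e : R, 0 < e -> exists2 d : R, 0 < d &
    forall s s' u u', `|s - s'| < d -> `|u - u'| < d -> `|K s u - K s' u'| < e.
Proof.
move=> p1 p2 cK e e0.
(* Only the first of the two points is confined to the compact square; this allows both to be
   translated by the same periods at the end. *)
pose P (d : R) (p : R * R) := forall a b, `|p.1 - a| < d -> `|p.2 - b| < d ->
  `|K p.1 p.2 - K a b| < e.
have cpt := compact_setX (@segment_compact R 0 l) (@segment_compact R 0 l).
have : \forall d \near (0:R)^'+, (`[0, l]%classic `*` `[0, l]%classic) `<=` P d.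
  have /compact_near_coveringP := cpt; apply.
  move=> [s u] _; have e20 : 0 < e / 2 by rewrite divr_gt0.
  have /cvgrPdist_lt/(_ _ e20) := cK (s, u).
  case=> -[A B] /= [[r1 /= r10 Hr1] [r2 /= r20 Hr2]] HAB.
  pose r := Num.min r1 r2; have r0 : 0 < r by rewrite lt_min r10.
  have H a b : `|s - a| < r -> `|u - b| < r -> `|K s u - K a b| < e / 2.
    rewrite !lt_min => /andP[a1 a2] /andP[b1 b2].
    by apply: (HAB (a, b)); split; [exact: Hr1|exact: Hr2].
  exists (ball s (r / 2) `*` ball u (r / 2), [set d | d < r / 2]) => /=.
    split; last by apply: nbhs_right_lt; rewrite divr_gt0.
    by exists (ball s (r / 2), ball u (r / 2)) => //=; split; apply: nbhsx_ballx;
      rewrite divr_gt0.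
  move=> [[a b] d] /= [[sa ub] dr] a' b' /= aa' bb'.
  rewrite -[K a b](subrK (K s u)) -addrA (le_lt_trans (ler_normD _ _))//.
  rewrite (splitr e) ltrD//.
    rewrite distrC H//.
      by rewrite (lt_trans sa)// ltr_pdivrMr// ltr_pMr// ltr1n.
    by rewrite (lt_trans ub)// ltr_pdivrMr// ltr_pMr// ltr1n.
  rewrite H//.
    rewrite -[s](subrK a) -addrA (le_lt_trans (ler_normD _ _))//.
    by rewrite (splitr r) ltrD// (lt_trans aa').
  rewrite -[u](subrK b) -addrA (le_lt_trans (ler_normD _ _))//.
  by rewrite (splitr r) ltrD// (lt_trans bb').
move=> H; have [d [d0 Hd]] := @filter_ex _ _ _ _
  (filterI (nbhs_right_gt (0 : R)) H).
exists d => // s s' u u' ss' uu'.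
have [k /andP[k1 k2]] := shift_itv 0 s.
have [j /andP[j1 j2]] := shift_itv 0 u.
have K1 x y : K (x + k%:~R * l) y = K x y.
  exact: (@periodic_int _ (fun x => K x y)).
have K2 x y : K x (y + j%:~R * l) = K x y by exact: periodic_int.
have := Hd (s + k%:~R * l, u + j%:~R * l) _ (s' + k%:~R * l) (u' + j%:~R * l).
rewrite /= !K1 !K2; apply.
- by split; rewrite /= in_itv/= ?k1 ?j1 /= ltW// -[X in _ < X]add0r.
- by have -> : s + k%:~R * l - (s' + k%:~R * l) = s - s' by lra.
- by have -> : u + j%:~R * l - (u' + j%:~R * l) = u - u' by lra.
Qed.

Lemma periodic_ucont h : (forall s, h (s + l) = h s) -> continuous h ->
  forall e : R, 0 < e -> exists2 d : R, 0 < d &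
    forall s u, `|s - u| < d -> `|h s - h u| < e.
Proof.
move=> ph ch e e0.
have [//|//||d d0 Hd] := @periodic2_ucont (fun s _ => h s) _ _ _ e e0.
  move=> p; apply: (@cvg_comp _ _ _ fst h _ (nbhs p.1)); last exact: ch.
  by case: p => a b; exact: cvg_fst.
by exists d => // s u su; apply: (Hd s u 0 0) => //; rewrite subrr normr0.
Qed.

End periodic.

Definition C2per (R : realType) (l : R) (phi : R -> R) : Prop :=
  [/\ forall s, phi (s + l) = phi s, derivable1 phi,
      derivable1 (rderiv phi) & continuous (rderiv (rderiv phi))].

Lemma deriv_periodic (R : realType) (l : R) (h : R -> R) :
  (forall s, h (s + l) = h s) -> forall s, rderiv h (s + l) = rderiv h s.
Proof.
move=> ph s; rewrite rderiv.unlock /derive1.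
suff -> : (fun h0 : R => h0^-1 *: (h (h0 + (s + l)) - h (s + l))) =
  (fun h0 : R => h0^-1 *: (h (h0 + s) - h s)) by [].
by apply/funext => x /=; rewrite ph addrA ph.
Qed.

Lemma deriv_lipschitz (R : realType) (h : R -> R) (M : R) :
  derivable1 h -> (forall s, `|rderiv h s| <= M) ->
  forall s u, `|h s - h u| <= M * `|s - u|.
Proof.
move=> dh hM s u; rewrite -dq_mul normrM ler_wpM2r//.
by have [c [_ _ ->]] := dq_mvt s u dh.
Qed.

(** By periodicity [rderiv phi] vanishes somewhere, and every point is, modulo the period, at
    distance at most [l] from that zero. *)
Lemma periodic_deriv_bound (R : realType) (l : R) (phi : R -> R) (M : R) :
  0 < l -> C2per l phi -> (forall s, `|rderiv (rderiv phi) s| <= M) ->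
  forall s, `|rderiv phi s| <= l * M.
Proof.
move=> l0 [pphi d1 d2 c2] hM s.
have M0 : 0 <= M by apply: le_trans (hM 0); exact: normr_ge0.
have [||c _ E] := @MVT R phi (rderiv phi) 0 l l0.
- by move=> x _; exact: is_derive_deriv.
- by apply: continuous_subspaceT; exact: derivable_continuous.
have pc : rderiv phi c = 0.
  have := pphi 0; rewrite add0r => E'; move/eqP: E.
  rewrite E' subrr subr0 eq_sym mulf_eq0 (gt_eqF l0) orbF.
  by move/eqP.
have [k /andP[k1 k2]] := shift_itv l0 c s.
rewrite -(periodic_int (deriv_periodic pphi) k s) -[rderiv phi _]subr0 -pc.
apply: le_trans (deriv_lipschitz d2 hM _ _) _.
rewrite mulrC ler_wpM2r// ger0_norm; first by lra.
by rewrite subr_ge0.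
Qed.

Lemma continuous_comp2 (R : realType) (T : topologicalType) (K : R -> R -> R)
    (a b : T -> R) (t : T) :
  {for (a t, b t), continuous (fun p : R * R => K p.1 p.2)} ->
  {for t, continuous a} -> {for t, continuous b} ->
  {for t, continuous (fun t => K (a t) (b t))}.
Proof.
move=> cK ca cb; have H : (a x, b x) @[x --> t] --> (a t, b t).
  exact: (@cvg_pair T R R (nbhs t) (nbhs (a t)) (nbhs (b t)) _ _ _ a b ca cb).
exact: (@cvg_comp _ _ _ (fun x => (a x, b x)) (fun p => K p.1 p.2) _ _ _ H cK).
Qed.

Lemma fst_continuous (R : realType) (h : R -> R) (p : R * R) :
  continuous h -> {for p, continuous (fun p : R * R => h p.1)}.
Proof.
by move=> ch; apply: (@cvg_comp _ _ _ fst h _ (nbhs p.1)); [exact: cvg_fst|exact: ch].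
Qed.

Lemma snd_continuous (R : realType) (h : R -> R) (p : R * R) :
  continuous h -> {for p, continuous (fun p : R * R => h p.2)}.
Proof.
by move=> ch; apply: (@cvg_comp _ _ _ snd h _ (nbhs p.2)); [exact: cvg_snd|exact: ch].
Qed.

(** * Chord-arc inequality and the symmetrised interaction kernel *)

Section plane_curve.
Context {R : realType} (l : R) (x y : R -> R).
Hypotheses (l0 : 0 < l) (xC2 : C2per l x) (yC2 : C2per l y).
Hypothesis unit_speed : forall s, rderiv x s ^+ 2 + rderiv y s ^+ 2 = 1.
Hypothesis curve_inj : forall s u, `|s - u| < l -> x s = x u -> y s = y u -> s = u.

(** Derivative of the unit-speed identity. It removes the [rderiv phi] term of the kernel on the
    diagonal. *)
Lemma unit_speed_orth s :
  rderiv x s * rderiv (rderiv x) s + rderiv y s * rderiv (rderiv y) s = 0.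
Proof.
case: xC2 => _ _ d1 _; case: yC2 => _ _ d2 _.
have H1 := is_derive_deriv s d1; have H2 := is_derive_deriv s d2.
have := is_deriveD (is_deriveM H1 H1) (is_deriveM H2 H2).
rewrite (_ : _ * _ + _ = cst 1); last first.
  by apply/funext => t; rewrite -[RHS](unit_speed t) !expr2.
move=> [_]; rewrite derive_cst /GRing.scale/=; lra.
Qed.

(** Squared chord length over squared parameter difference, with the squared speed as its value on
    the diagonal. *)
Definition chord s u : R := dq x s u ^+ 2 + dq y s u ^+ 2.

Lemma chord_gt0 s u : `|s - u| < l -> 0 < chord s u.
Proof.
move=> su; rewrite lt_def addr_ge0 ?sqr_ge0// andbT.
apply/eqP => /eqP; rewrite paddr_eq0 ?sqr_ge0// !sqrf_eq0 => /andP[/eqP q1 /eqP q2].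
have E : s = u.
  apply: curve_inj => //.
    by apply/eqP; rewrite -subr_eq0 -dq_mul q1 mul0r.
  by apply/eqP; rewrite -subr_eq0 -dq_mul q2 mul0r.
have := unit_speed s; move: q1 q2; rewrite /dq E eqxx => -> ->.
by rewrite expr0n addr0 => /eqP; rewrite eq_sym oner_eq0.
Qed.

Lemma C2per_dq h : C2per l h -> continuous (fun p : R * R => dq h p.1 p.2).
Proof.
by case=> _ d1 d2 _; apply: dq_continuous => //; exact: derivable_continuous.
Qed.

Lemma C2per_dq_deriv h : C2per l h ->
  continuous (fun p : R * R => dq (rderiv h) p.1 p.2).
Proof. by case=> _ d1 d2 c2; apply: dq_continuous. Qed.

Lemma C2per_dq_periodic h s u : C2per l h -> dq h (s + l) (u + l) = dq h s u.
Proof.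
case=> ph _ _ _; rewrite /dq !ph (deriv_periodic ph) (inj_eq (addIr l)).
by rewrite opprD addrACA subrr addr0.
Qed.

Lemma chord_continuous : continuous (fun p : R * R => chord p.1 p.2).
Proof.
by move=> p; apply: cvgD; apply: cvgM; exact: C2per_dq.
Qed.

Lemma chord_periodic s u (k : int) :
  chord (s + k%:~R * l) (u + k%:~R * l) = chord s u.
Proof.
have := @periodic_int _ l _ (fun t => chord (s + t) (u + t)) _ k 0.
rewrite !add0r !addr0; apply => t.
by rewrite !addrA /chord !C2per_dq_periodic.
Qed.

(** A positive continuous function has a positive minimum on a compact set. The restriction to half
    a period keeps away from [|s - u| = l], where the chord closes up. In the variables [(s, u - s)]
    joint periodicity confines [s] to one period. *)
Lemma chord_arc : exists2 c : R, 0 < c &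
  forall s u, `|s - u| <= l / 2 -> c <= chord s u.
Proof.
have cpt := compact_setX (@segment_compact R 0 l)
  (@segment_compact R (- (l / 2)) (l / 2)).
pose f (p : R * R) := chord p.1 (p.1 + p.2).
have cf : continuous f.
  move=> p; apply: (@continuous_comp2 _ _ chord fst (fun p => p.1 + p.2)).
  - exact: chord_continuous.
  - exact: cvg_fst.
  - by apply: cvgD; [exact: cvg_fst|exact: cvg_snd].
have [||p + pmin] := @compact_EVT_min _ _ f (`[0, l] `*` `[- (l / 2), l / 2]) _ cpt.
- by exists (0, 0); split; rewrite /= in_itv/=; move: l0; lra.
- exact: continuous_subspaceT.
rewrite inE => -[_]; rewrite /= in_itv/= => p2.
exists (f p).
  apply: chord_gt0; rewrite opprD addrA subrr sub0r normrN ltr_norml; move: l0; lra.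
move=> s u su; have [k k12] := shift_itv l0 0 s.
have -> : chord s u = f (s + k%:~R * l, u - s).
  rewrite /f/= (_ : _ + (u - s) = u + k%:~R * l) ?chord_periodic//; lra.
apply: pmin; rewrite inE; split => /=; rewrite in_itv/=.
  by move: k12; rewrite add0r => /andP[-> /ltW].
by rewrite distrC ler_norml in su.
Qed.

Definition sqdist s u : R := (x s - x u) ^+ 2 + (y s - y u) ^+ 2.

Lemma sqdist_chord s u : sqdist s u = (s - u) ^+ 2 * chord s u.
Proof. rewrite /sqdist -!dq_mul /chord; ring. Qed.

(** The real part of [gamma'(s) / (gamma(s) - gamma(u))], in real coordinates. *)
Definition tan_kernel s u : R :=
  (rderiv x s * (x s - x u) + rderiv y s * (y s - y u)) / sqdist s u.

(** The diagonal is tested on the coordinates and not on the parameters, since parameters that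
    differ by a period name the same point. *)
Definition dyson_kernel phi s u : R :=
  if (x s == x u) && (y s == y u) then rderiv (rderiv phi) s
  else rderiv phi s * tan_kernel s u + rderiv phi u * tan_kernel u s.

(** With D the chord vector, the numerator of the kernel is [(phi'(s) - phi'(u)) gamma'(s).D +
    phi'(u) (gamma'(s) - gamma'(u)).D]. Each product is of second order in [s - u], and dividing it
    and the squared chord by [(s - u) ^+ 2] gives this pole-free form. *)
Definition strip_kernel phi s u : R :=
  (dq (rderiv phi) s u * (rderiv x s * dq x s u + rderiv y s * dq y s u)
   + rderiv phi u * (dq (rderiv x) s u * dq x s u
                      + dq (rderiv y) s u * dq y s u)) / chord s u.

Lemma same_point s u : x s = x u -> y s = y u -> exists k : int, s = u + k%:~R * l.
Proof.
move=> ex ey; have [px _ _ _] := xC2; have [py _ _ _] := yC2.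
have [k /andP[k1 k2]] := shift_itv l0 s u; exists k.
apply: curve_inj; rewrite ?(periodic_int px) ?(periodic_int py)//.
by rewrite distrC ger0_norm ?subr_ge0//; lra.
Qed.

(** The chord-arc inequality read backwards: two close points of the curve have close parameters up
    to a multiple of the period, because the squared distance is at least [c * (s - u) ^+ 2] within
    half a period. *)
Lemma near_point (d : R) : 0 < d -> exists2 r : R, 0 < r & forall s u,
  sqdist s u < r -> exists k : int, `|s - (u + k%:~R * l)| < d.
Proof.
move=> d0; have [c c0 Hc] := chord_arc; have [px _ _ _] := xC2; have [py _ _ _] := yC2.
exists (c * d ^+ 2); first by rewrite mulr_gt0// exprn_gt0.
move=> s u; have [k /andP[k1 k2]] := shift_itv l0 (s - l / 2) u.
have <- : sqdist s (u + k%:~R * l) = sqdist s u.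
  by rewrite /sqdist !(periodic_int px) !(periodic_int py).
move=> H; exists k; move: (u + k%:~R * l) k1 k2 H => {}u k1 k2.
have su : `|s - u| <= l / 2 by rewrite ler_norml; lra.
rewrite sqdist_chord => H.
have : (s - u) ^+ 2 * c < c * d ^+ 2.
  by apply: le_lt_trans H; rewrite ler_wpM2l ?sqr_ge0// Hc.
rewrite mulrC ltr_pM2l// => H2.
rewrite -(@ltr_pXn2r _ 2)// ?nnegrE ?normr_ge0 ?(ltW d0)//.
by rewrite real_normK// num_real.
Qed.

Lemma dyson_kernelC phi s u : C2per l phi -> dyson_kernel phi s u = dyson_kernel phi u s.
Proof.
case=> pphi _ _ _; rewrite /dyson_kernel (eq_sym (x u)) (eq_sym (y u)).
case: andP => [[/eqP ex /eqP ey]|_]; last exact: addrC.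
have [k ->] := same_point ex ey.
by rewrite (periodic_int (deriv_periodic (deriv_periodic pphi))).
Qed.

Lemma dyson_kernel_periodicl phi s u : C2per l phi ->
  dyson_kernel phi (s + l) u = dyson_kernel phi s u.
Proof.
case=> pphi _ _ _; have [px _ _ _] := xC2; have [py _ _ _] := yC2.
by rewrite /dyson_kernel /tan_kernel /sqdist !px !py (deriv_periodic px)
  (deriv_periodic py) (deriv_periodic (deriv_periodic pphi)) (deriv_periodic pphi).
Qed.

Lemma dyson_kernel_periodicr phi s u : C2per l phi ->
  dyson_kernel phi s (u + l) = dyson_kernel phi s u.
Proof. by move=> H; rewrite dyson_kernelC// dyson_kernel_periodicl// dyson_kernelC. Qed.

Lemma dyson_kernel_stripE phi s u : `|s - u| < l ->
  dyson_kernel phi s u = strip_kernel phi s u.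
Proof.
move=> su; have ch := chord_gt0 su; rewrite /dyson_kernel /strip_kernel.
case: andP => [[/eqP ex /eqP ey]|E].
  (* On the diagonal the strip formula is [phi''] times the squared speed plus [phi'] times the
     scalar product of velocity and acceleration, that is [phi'']. *)
  rewrite {ch} (curve_inj su ex ey) /chord /dq eqxx.
  have := unit_speed_orth u; have := unit_speed u.
  rewrite -!expr2 => ->.
  rewrite mulr1 divr1 => H0; rewrite [X in _ * X](_ : _ = 0) ?mulr0 ?addr0//.
  by rewrite -H0; ring.
have su0 : s - u != 0.
  by rewrite subr_eq0; apply/eqP => e; apply: E; rewrite e.
have Edq h : dq h s u = (h s - h u) / (s - u) by rewrite -dq_mul mulfK.
have H : chord s u != 0 by rewrite gt_eqF.
have usC : chord u s = chord s u by rewrite /chord !(dqC _ u s).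
rewrite /tan_kernel !sqdist_chord usC -!dq_mul !(dqC _ u s) !(Edq (rderiv _)).
move: (chord s u) H => C H.
by field; rewrite su0 H -opprB oppr_eq0.
Qed.

Lemma strip_kernel_continuous phi p : C2per l phi -> chord p.1 p.2 != 0 ->
  {for p, continuous (fun p : R * R => strip_kernel phi p.1 p.2)}.
Proof.
move=> phiC2 Hc; have [_ _ dx _] := xC2; have [_ _ dy _] := yC2.
have [_ _ dphi _] := phiC2.
have cx := derivable_continuous dx; have cy := derivable_continuous dy.
have cphi := derivable_continuous dphi.
apply: cvgM; last by apply: cvgV => //; exact: chord_continuous.
apply: cvgD; apply: cvgM.
- exact: C2per_dq_deriv.
- by apply: cvgD; apply: cvgM; (exact: fst_continuous || exact: C2per_dq).
- exact: snd_continuous.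
- by apply: cvgD; apply: cvgM; (exact: C2per_dq_deriv || exact: C2per_dq).
Qed.

(** Translating [s] by a period brings it within half a period of [u]; there the strip formula is
    valid on a whole neighbourhood and its denominator is positive. *)
Lemma dyson_kernel_continuous phi : C2per l phi ->
  continuous (fun p : R * R => dyson_kernel phi p.1 p.2).
Proof.
move=> phiC2 [s u].
have [k /andP[k1 k2]] := shift_itv l0 (u - l / 2) s.
have pk a b : dyson_kernel phi (a + k%:~R * l) b = dyson_kernel phi a b.
  exact: (@periodic_int _ _ _ (fun a => dyson_kernel phi a b) (fun a => dyson_kernel_periodicl a b phiC2)).
pose f (p : R * R) := strip_kernel phi (p.1 + k%:~R * l) p.2.
have E : {near (s, u), f =1 (fun p => dyson_kernel phi p.1 p.2)}.
  have cB : ((p : R * R).1 + k%:~R * l - p.2) @[p --> (s, u)] --> s + k%:~R * l - u.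
    by apply: cvgB; [apply: cvgD; [exact: cvg_fst|exact: cvg_cst]|exact: cvg_snd].
  have H : `|s + k%:~R * l - u| < l by rewrite ltr_norml; lra.
  have N := cvgr_norm_lt (s + k%:~R * l - u) cB l H.
  apply: filterS (N _) => p pl.
  by rewrite /f -dyson_kernel_stripE// pk.
rewrite /continuous_at /= -(nbhs_singleton E) /=.
apply: cvg_trans; first exact: near_eq_cvg E.
apply: (@continuous_comp2 _ _ (strip_kernel phi) (fun p => p.1 + k%:~R * l) snd).
- apply: strip_kernel_continuous => //=; rewrite gt_eqF// chord_gt0// ltr_norml; lra.
- by apply: cvgD; [exact: cvg_fst|exact: cvg_cst].
- exact: cvg_snd.
Qed.

(** The constant depends on the curve only and the bound is linear in the size of [phi'']. As the
    kernel is linear in [phi], this makes the drift Lipschitz in [phi]. *)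
Lemma dyson_kernel_bound : exists2 C : R, 0 <= C & forall phi (M : R), C2per l phi ->
  (forall s, `|rderiv (rderiv phi) s| <= M) -> forall s u, `|dyson_kernel phi s u| <= C * M.
Proof.
have [c c0 Hc] := chord_arc.
have bnd (h : R -> R) : C2per l h -> exists2 M : R, 0 <= M & forall s, `|rderiv (rderiv h) s| <= M.
  case=> ph _ _ ch; apply: (periodic_bounded l0 _ ch).
  exact: (deriv_periodic (deriv_periodic ph)).
have [X X0 HX] := bnd _ xC2; have [Y Y0 HY] := bnd _ yC2.
have dqb (h : R -> R) (M s u : R) : derivable1 h -> (forall s, `|rderiv h s| <= M) -> `|dq h s u| <= M.
  by move=> dh hM; have [e [_ _ ->]] := dq_mvt s u dh.
have [_ dx ddx _] := xC2; have [_ dy ddy _] := yC2.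
have x1 s : `|rderiv x s| <= 1.
  rewrite -(@ler_pXn2r _ 2)// ?nnegrE// expr1n real_normK ?num_real//.
  by rewrite -(unit_speed s) lerDl sqr_ge0.
have y1 s : `|rderiv y s| <= 1.
  rewrite -(@ler_pXn2r _ 2)// ?nnegrE// expr1n real_normK ?num_real//.
  by rewrite -(unit_speed s) lerDr sqr_ge0.
(* The factor [2] comes from two products of unit-bounded terms multiplying the quotient of [phi'],
   the term [l * (X + Y)] from [|phi'| <= l * M] against the accelerations, and [c] from the
   chord-arc inequality. *)
exists ((2 + l * (X + Y)) / c).
  by rewrite divr_ge0 ?addr_ge0 ?mulr_ge0 ?addr_ge0// ltW.
move=> phi M phiC2 hM s u; have [_ dphi ddphi _] := phiC2.
have M0 : 0 <= M by apply: le_trans (hM 0); exact: normr_ge0.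
have phi1 := periodic_deriv_bound l0 phiC2 hM.
have [k /andP[k1 k2]] := shift_itv l0 (u - l / 2) s.
have <- : dyson_kernel phi (s + k%:~R * l) u = dyson_kernel phi s u.
  exact: (@periodic_int _ _ _ (fun a => dyson_kernel phi a u) (fun a => dyson_kernel_periodicl a u phiC2)).
move: (s + k%:~R * l) k1 k2 => {}s k1 k2.
have su : `|s - u| <= l / 2 by rewrite ler_norml; lra.
rewrite dyson_kernel_stripE; last by apply: le_lt_trans su _; rewrite ltr_pdivrMr// ltr_pMr// ltr1n.
have chc := Hc _ _ su; have ch0 := lt_le_trans c0 chc.
rewrite /strip_kernel normrM normfV (gtr0_norm ch0) mulrAC.
apply: ler_pM => //; [by rewrite invr_ge0 ltW| |by rewrite lef_pV2].
have b2 (a b A B : R) : `|a| <= A -> `|b| <= B -> 0 <= A -> `|a * b| <= A * B.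
  by move=> aA bB A0; rewrite normrM ler_pM.
apply: (le_trans (ler_normD _ _)); rewrite mulrDl.
have -> : l * (X + Y) * M = (l * M) * (X * 1 + Y * 1) by ring.
rewrite (mulrC 2) lerD//; apply: (b2) => //.
- exact: dqb.
- rewrite -[2]/(1 + 1); apply: (le_trans (ler_normD _ _)).
  rewrite lerD// -[leRHS]mulr1; apply: (b2) => //; exact: dqb.
- apply: (le_trans (ler_normD _ _)).
  rewrite lerD//; apply: (b2) => //; exact: dqb.
- by rewrite mulr_ge0// ltW.
Qed.

End plane_curve.

Lemma Re_complex_div (R : realType) (a b : R[i]) : complex.Re (a / b) =
  (complex.Re a * complex.Re b + complex.Im a * complex.Im b) /
  (complex.Re b ^+ 2 + complex.Im b ^+ 2).
Proof. by case: a b => [a1 a2] [b1 b2] /=; ring. Qed.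

Lemma normc_sqr (R : realType) (z : R[i]) :
  `|z| ^+ 2 = (complex.Re z ^+ 2 + complex.Im z ^+ 2)%:C.
Proof.
case: z => a b; rewrite normc_def -rmorphXn /= sqr_sqrtr//.
by rewrite addr_ge0// sqr_ge0.
Qed.

Lemma normc_lt (R : realType) (z : R[i]) (e : R) : 0 < e ->
  (`|z| < e%:C) = (complex.Re z ^+ 2 + complex.Im z ^+ 2 < e ^+ 2).
Proof.
move=> e0; rewrite -(@ltr_pXn2r _ 2)// ?nnegrE ?normr_ge0 ?ler0c ?(ltW e0)//.
by rewrite normc_sqr -rmorphXn ltcR.
Qed.

(** * The complex plane as a real plane *)

Section complex_plane.
Context {R : realType}.
Implicit Types (z w : R[i]) (A : set R[i]).

Lemma complex_subrK z w : z + (complex.Re (w - z) +i* complex.Im (w - z)) = w.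
Proof.
case: z w => [a b] [c d]; apply/eqP; rewrite eq_complex /=.
by apply/andP; split; apply/eqP; ring.
Qed.

Lemma nbhs_complexP z A : nbhs z A <-> exists2 e : R, 0 < e &
  forall a b : R, `|a| < e -> `|b| < e -> A (z + (a +i* b)).
Proof.
split.
  (* Radii of balls are complex numbers here; positivity in the order of the complex field forces
     the imaginary part [e2] to vanish. *)
  move=> /nbhs_ballP[[e1 e2] /= e0 H]; move: e0; rewrite ltcE/= => /andP[/eqP e20 e10].
  rewrite {}e20 in H; exists (e1 / 2); first by rewrite divr_gt0.
  move=> a b ae be; apply: H; rewrite -ball_normE /ball_ /=.
  rewrite opprD addrA subrr sub0r normrN (_ : _ +i* 0 = e1%:C)// normc_lt//=.
  have a2 : a ^+ 2 < (e1 / 2) ^+ 2.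
    by rewrite -(@real_normK _ a) ?num_real// ltr_pXn2r ?nnegrE ?divr_ge0// ltW.
  have b2 : b ^+ 2 < (e1 / 2) ^+ 2.
    by rewrite -(@real_normK _ b) ?num_real// ltr_pXn2r ?nnegrE ?divr_ge0// ltW.
  apply: lt_le_trans (ltrD a2 b2) _; rewrite expr_div_n.
  have := sqr_ge0 e1; lra.
move=> [e e0 H]; apply/nbhs_ballP; exists e%:C => /=; first by rewrite ltcR.
move=> w; rewrite -ball_normE /ball_ /= normc_lt// => zw.
rewrite -(complex_subrK z w).
have e2 : forall a b : R, a ^+ 2 + b ^+ 2 < e ^+ 2 -> `|a| < e.
  move=> a b ab; rewrite -(@ltr_pXn2r _ 2)// ?nnegrE ?normr_ge0 ?(ltW e0)//.
  rewrite real_normK ?num_real//; apply: le_lt_trans ab.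
  by rewrite lerDl sqr_ge0.
by apply: H; rewrite -(opprB z w) raddfN normrN;
  [apply: e2 zw|rewrite addrC in zw; apply: e2 zw].
Qed.

Lemma continuous_Re : continuous (fun z : R[i] => complex.Re z).
Proof.
move=> z; have FF : Filter (nbhs (z : R[i])) by exact: nbhs_filter.
apply/(@cvgrPdist_lt _ _ _ _ FF) => e e0; apply/nbhs_complexP; exists e => // a b ae be.
by rewrite raddfD /= opprD addrA subrr sub0r normrN.
Qed.

Lemma continuous_Im : continuous (fun z : R[i] => complex.Im z).
Proof.
move=> z; have FF : Filter (nbhs (z : R[i])) by exact: nbhs_filter.
apply/(@cvgrPdist_lt _ _ _ _ FF) => e e0; apply/nbhs_complexP; exists e => // a b ae be.
by rewrite raddfD /= opprD addrA subrr sub0r normrN.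
Qed.

Lemma cvg_complex (T : Type) (F : set_system T) (FF : Filter F) (f : T -> R[i]) z :
  complex.Re (f t) @[t --> F] --> complex.Re z ->
  complex.Im (f t) @[t --> F] --> complex.Im z -> f t @[t --> F] --> z.
Proof.
move=> h1 h2 A /nbhs_complexP[e e0 H].
have /cvgrPdist_lt/(_ _ e0) H1 := h1; have /cvgrPdist_lt/(_ _ e0) H2 := h2.
apply: filterS2 H1 H2 => t t1 t2 /=.
rewrite -(complex_subrK z (f t)).
by apply: H; rewrite -(opprB z) raddfN normrN raddfB.
Qed.

End complex_plane.

(** * First-order expansions and the chain rule in the plane *)

Section expansion.
Context {R : realType}.

Lemma is_derive_expand (k : R -> R) (t d : R) : is_derive t 1 k d <->
  forall e : R, 0 < e -> exists2 r : R, 0 < r &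
    forall h, `|h| < r -> `|k (t + h) - k t - d * h| <= e * `|h|.
Proof.
have -> : is_derive t 1 k d <-> (h^-1 *: (k (h *: 1 + t) - k t) @[h --> 0^'] --> d).
  split; first by case=> dk <-; exact: dk.
  by move=> H; split; [apply/cvg_ex; exists d|apply/cvg_lim].
split.
  move=> /cvgrPdist_le H e e0; have [r /= r0 Hr] := H e e0.
  exists r => // h hr; have [->|h0] := eqVneq h 0.
    by rewrite addr0 subrr mulr0 subrr normr0 mulr0.
  have := Hr h; rewrite /= sub0r normrN => /(_ hr h0).
  rewrite /GRing.scale/= mulr1 (addrC h) distrC => H'.
  have -> : k (t + h) - k t - d * h = (h^-1 * (k (t + h) - k t) - d) * h.
    by rewrite mulrBl mulrAC mulVf// mul1r.
  by rewrite normrM ler_wpM2r.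
move=> H; apply/cvgrPdist_le => e e0; have [r r0 Hr] := H e e0.
exists r => //= h; rewrite /= sub0r normrN => hr h0.
rewrite /GRing.scale/= mulr1 (addrC h) distrC.
have -> : h^-1 * (k (t + h) - k t) - d = (k (t + h) - k t - d * h) / h.
  by rewrite mulrBl mulfK// mulrC.
by rewrite normrM normfV ler_pdivrMr ?normr_gt0// Hr.
Qed.

Lemma mvt_bound (k dk : R -> R) (b e : R) :
  (forall t : R, `|t| <= `|b| -> is_derive t 1 k (dk t)) ->
  (forall t : R, `|t| <= `|b| -> `|dk t| <= e) -> `|k b - k 0| <= e * `|b|.
Proof.
move=> Hd He; have [b0|b0] := leP 0 b.
  have H t : 0 <= t <= b -> `|t| <= `|b|.
    by move=> /andP[t0 tb]; rewrite !ger0_norm.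
  have [||c] := @MVT_segment R k dk 0 b b0.
  - by move=> t; rewrite in_itv/= => /andP[t0 tb]; apply/Hd/H; rewrite !ltW.
  - apply: derivable_within_continuous => t; rewrite in_itv/= => tb.
    by have [] := Hd t (H t tb).
  by rewrite in_itv/= subr0 => /H/He cb ->; rewrite normrM ler_wpM2r.
have H t : b <= t <= 0 -> `|t| <= `|b|.
  by move=> /andP[t0 tb]; rewrite !ler0_norm ?lerN2// ltW.
have [||c] := @MVT_segment R k dk b 0 (ltW b0).
- by move=> t; rewrite in_itv/= => /andP[t0 tb]; apply/Hd/H; rewrite !ltW.
- apply: derivable_within_continuous => t; rewrite in_itv/= => tb.
  by have [] := Hd t (H t tb).
rewrite in_itv/= sub0r => /H/He cb E; rewrite distrC E normrM normrN.
by rewrite ler_wpM2r.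
Qed.

Lemma is_derive_line (f : R[i] -> R) (z v : R[i]) (t : R) :
  derivable (fun h : R => f (z + v * t%:C + v * h%:C)) 0 1 ->
  is_derive t 1 (fun h : R => f (z + v * h%:C)) (dir_derive f v (z + v * t%:C)).
Proof.
move=> d; rewrite /dir_derive derive1E.
have /is_derive_expand H := derivableP d.
apply/is_derive_expand => e /H[r r0 Hr]; exists r => // h /Hr.
by rewrite mulr0 addr0 add0r rmorphD mulrDr addrA.
Qed.

(** Continuous partial derivatives give total differentiability: the increment is split along two
    sides of a rectangle, and on each side the mean value inequality is applied to [f] minus its
    linear part. *)
Lemma partials_expand (U : set R[i]) (f : R[i] -> R) (z : R[i]) : open U -> Ck 1 U f ->
  U z -> forall e : R, 0 < e -> exists2 r : R, 0 < r &
  forall a b : R, `|a| < r -> `|b| < r ->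
   `|f (z + (a +i* b)) - f z - dir_derive f 1 z * a - dir_derive f 'i z * b|
     <= e * (`|a| + `|b|).
Proof.
move=> oU [_ H] Uz e e0.
have [d1 [c1 _]] := H 1 (or_introl erefl); have [d2 [c2 _]] := H 'i (or_intror erefl).
move: c1 c2; rewrite !continuous_open_subspace// => c1 c2.
have /cvgrPdist_le/(_ _ e0) n1 := c1 z (mem_set Uz).
have /cvgrPdist_le/(_ _ e0) n2 := c2 z (mem_set Uz).
have [r r0 Hr] := (nbhs_complexP z _).1
  (filterI (open_nbhs_nbhs (conj oU Uz)) (filterI n1 n2)).
have cE a b : (a +i* b) = 1 * a%:C + 'i * b%:C :> R[i].
  by apply/eqP; rewrite eq_complex /=; apply/andP; split; apply/eqP; ring.
exists r => // a b ar br.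
pose k1 := fun h : R => f (z + 1 * h%:C) - dir_derive f 1 z * h.
pose k2 := fun h : R => f (z + 1 * a%:C + 'i * h%:C) - dir_derive f 'i z * h.
have small t : `|t| <= `|a| -> `|t| < r by move=> /le_lt_trans; exact.
have smallb t : `|t| <= `|b| -> `|t| < r by move=> /le_lt_trans; exact.
have normr00 : `|0 : R| < r by rewrite normr0.
have B1 : `|k1 a - k1 0| <= e * `|a|.
  apply: (@mvt_bound k1 (fun t => dir_derive f 1 (z + 1 * t%:C) - dir_derive f 1 z)).
    move=> t /small ta; have [Ut _] := Hr t 0 ta normr00.
    rewrite cE mulr0 addr0 in Ut.
    apply: is_deriveB; first by apply: is_derive_line; apply: d1.
    by apply: is_derive_eq; rewrite /GRing.scale/= mulr1.
  move=> t /small ta; have [_ [N _]] := Hr t 0 ta normr00.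
  by rewrite cE mulr0 addr0 in N; rewrite distrC.
have B2 : `|k2 b - k2 0| <= e * `|b|.
  apply: (@mvt_bound k2 (fun t => dir_derive f 'i (z + 1 * a%:C + 'i * t%:C) - dir_derive f 'i z)).
    move=> t /smallb tb; have [Ut _] := Hr a t ar tb.
    rewrite cE addrA in Ut.
    apply: is_deriveB; first by apply: is_derive_line; apply: d2.
    by apply: is_derive_eq; rewrite /GRing.scale/= mulr1.
  move=> t /smallb tb; have [_ [_ N]] := Hr a t ar tb.
  by rewrite cE addrA in N; rewrite distrC.
rewrite mulrDr; apply: le_trans (lerD B1 B2); apply: le_trans (ler_normD _ _).
rewrite /k1 /k2 cE !mulr0 !addr0 addrA le_eqVlt; apply/orP; left; apply/eqP.
congr `|_|; ring.
Qed.

Lemma chain_rule (U : set R[i]) (f : R[i] -> R) (a b : R -> R) (t da db : R) :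
  open U -> Ck 1 U f -> U (a t +i* b t) -> is_derive t 1 a da ->
  is_derive t 1 b db ->
  is_derive t 1 (fun s => f (a s +i* b s))
    (dir_derive f 1 (a t +i* b t) * da + dir_derive f 'i (a t +i* b t) * db).
Proof.
move=> oU fU Uz /is_derive_expand Ha /is_derive_expand Hb.
apply/is_derive_expand => e e0; set z := a t +i* b t.
set p := dir_derive f 1 z; set q := dir_derive f 'i z.
(* [S] collects all the factors that will multiply [e']: the gradient from the errors of [a] and
   [b], and [|da| + 1], [|db| + 1] from the bounds on their increments. *)
pose S := `|p| + `|q| + `|da| + `|db| + 2.
have S0 : 0 < S by rewrite ltr_wpDl// !addr_ge0.
pose e' := Num.min 1 (e / S).
have e'0 : 0 < e' by rewrite lt_min ltr01 divr_gt0.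
have e'1 : e' <= 1 by rewrite ge_min lexx.
have e'S : e' * S <= e by rewrite -ler_pdivlMr// ge_min lexx orbT.
have [r r0 Hr] := partials_expand oU fU Uz e'0.
have [ra ra0 Hra] := Ha _ e'0; have [rb rb0 Hrb] := Hb _ e'0.
pose B := `|da| + `|db| + 1.
have B0 : 0 < B by rewrite ltr_wpDl// addr_ge0.
exists (Num.min (Num.min ra rb) (r / B)).
  by rewrite !lt_min ra0 rb0 divr_gt0.
move=> h; rewrite !lt_min => /andP[/andP[ha hb]]; rewrite ltr_pdivlMr// => hr.
have {}Hra := Hra h ha; have {}Hrb := Hrb h hb.
have bound (d x : R) : `|x - d * h| <= e' * `|h| -> `|x| <= (`|d| + e') * `|h|.
  move=> H; rewrite -[x](subrK (d * h)) (le_trans (ler_normD _ _))//.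
  by rewrite mulrDl addrC normrM lerD2l.
have Ba := bound _ _ Hra; have Bb := bound _ _ Hrb.
have h0 := normr_ge0 h.
have Ba' : `|a (t + h) - a t| < r.
  apply: le_lt_trans Ba (le_lt_trans _ hr); rewrite mulrC ler_wpM2l// /B.
  by have := normr_ge0 db; lra.
have Bb' : `|b (t + h) - b t| < r.
  apply: le_lt_trans Bb (le_lt_trans _ hr); rewrite mulrC ler_wpM2l// /B.
  by have := normr_ge0 da; lra.
have := Hr _ _ Ba' Bb'.
have -> : z + ((a (t + h) - a t) +i* (b (t + h) - b t)) = a (t + h) +i* b (t + h).
  by apply/eqP; rewrite eq_complex /=; apply/andP; split; apply/eqP; ring.
move: Ba Bb Hra Hrb; rewrite -/p -/q; set A := a (t + h) - a t; set C := b (t + h) - b t.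
set D := f _ - f z => Ba Bb Hra Hrb Hf.
have -> : D - (p * da + q * db) * h =
  (D - p * A - q * C) + (p * (A - da * h) + q * (C - db * h)) by ring.
apply: le_trans (ler_normD _ _) _.
have P1 : `|D - p * A - q * C| <= e' * ((`|da| + 1 + (`|db| + 1)) * `|h|).
  apply: le_trans Hf _; rewrite ler_pM2l// mulrDl lerD//.
    by apply: le_trans Ba _; rewrite ler_wpM2r// lerD2l.
  by apply: le_trans Bb _; rewrite ler_wpM2r// lerD2l.
have P2 : `|p * (A - da * h) + q * (C - db * h)| <= e' * ((`|p| + `|q|) * `|h|).
  apply: le_trans (ler_normD _ _) _; rewrite !normrM mulrDl mulrDr lerD// mulrCA.
    by rewrite ler_wpM2l.
  by rewrite ler_wpM2l.
apply: le_trans (lerD P1 P2) _; rewrite -mulrDr -mulrDl mulrA ler_wpM2r//.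
by apply: le_trans e'S; rewrite ler_pM2l// /S; lra.
Qed.

End expansion.

Definition re_path (R : realType) (g : R -> R[i]) (s : R) : R := complex.Re (g s).
Definition im_path (R : realType) (g : R -> R[i]) (s : R) : R := complex.Im (g s).

Lemma cderiveE (R : realType) (g : R -> R[i]) s :
  cderive g s = rderiv (re_path g) s +i* rderiv (im_path g) s.
Proof. by rewrite rderiv.unlock. Qed.

Lemma path_complexE (R : realType) (g : R -> R[i]) s :
  g s = re_path g s +i* im_path g s.
Proof. by rewrite /re_path /im_path; case: (g s). Qed.

(** * The Jordan curve in periodic coordinates *)

Section jordan_curve.
Context {R : realType} (l : R) (g : R -> R[i]).
Hypotheses (jg : jordan_arclength l g) (cg : C2 g).
Local Notation x := (re_path g).
Local Notation y := (im_path g).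

Lemma jordan_length_gt0 : 0 < l. Proof. by case: jg. Qed.
Let l0 := jordan_length_gt0.

Lemma jordan_periodic s : g (s + l) = g s. Proof. by case: jg. Qed.

Lemma jordan_C2per : C2per l x /\ C2per l y.
Proof.
have ex : (fun s => complex.Re (cderive g s)) = rderiv x.
  by apply/funext => s; rewrite cderiveE.
have ey : (fun s => complex.Im (cderive g s)) = rderiv y.
  by apply/funext => s; rewrite cderiveE.
have [d1 d2 c2] := cg.
split; split.
- by move=> s; rewrite /re_path jordan_periodic.
- by move=> s; have [] := d1 s.
- by move=> s; have [] := d2 s; rewrite ex.
- rewrite (_ : rderiv _ = fun s => complex.Re (cderive (cderive g) s)).
    move=> s; apply: (@continuous_comp _ _ _ (cderive (cderive g)) (@complex.Re R));
      [exact: c2|exact: continuous_Re].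
  apply/funext => s; rewrite (cderiveE (cderive g)) /= -ex //.
- by move=> s; rewrite /im_path jordan_periodic.
- by move=> s; have [] := d1 s.
- by move=> s; have [] := d2 s; rewrite ey.
- rewrite (_ : rderiv _ = fun s => complex.Im (cderive (cderive g) s)).
    move=> s; apply: (@continuous_comp _ _ _ (cderive (cderive g)) (@complex.Im R));
      [exact: c2|exact: continuous_Im].
  apply/funext => s; rewrite (cderiveE (cderive g)) /= -ey //.
Qed.

Let xC2 := jordan_C2per.1.
Let yC2 := jordan_C2per.2.

Lemma jordan_unit_speed s : rderiv x s ^+ 2 + rderiv y s ^+ 2 = 1.
Proof.
case: jg => _ _ _ [_ /(_ s) gu _]; have := normc_sqr (cderive g s).
by rewrite gu expr1n cderiveE => -[].
Qed.

(** Injectivity is assumed on one period [[0, l[] only; both parameters are shifted together so that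
    the smaller one falls into it. *)
Lemma jordan_inj s u : `|s - u| < l -> x s = x u -> y s = y u -> s = u.
Proof.
wlog su : s u / s <= u.
  move=> H; case: (leP s u) => [/H//|/ltW /H H' d ex ey].
  by apply/esym/H'; rewrite 1?distrC.
move=> d ex ey; have e : g s = g u by rewrite (path_complexE g s) (path_complexE g u) ex ey.
have [k /andP[k1 k2]] := shift_itv l0 0 s; rewrite add0r in k2.
have [_ _ inj _ _] := jg; have pk := periodic_int jordan_periodic.
have {}inj a b : 0 <= a < l -> 0 <= b < l -> g a = g b -> a = b.
  by move=> ha hb; apply: inj; rewrite ?inE/= ?in_itv/=.
move: d; rewrite distrC ger0_norm ?subr_ge0// => d.
have [uk|uk] := ltP (u + k%:~R * l) l.
  have H : s + k%:~R * l = u + k%:~R * l.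
    by apply: inj; rewrite ?pk// ?k1 ?k2// uk andbT; lra.
  exact: (addIr _ H).
(* The shifted [u] has passed [l], so one more period is subtracted; injectivity would then give
   [u - s = l], which is excluded. *)
have E : (k - 1)%:~R * l = k%:~R * l - l by rewrite intrD mulrDl mulN1r.
have H : s + k%:~R * l = u + (k - 1)%:~R * l.
  by apply: inj; rewrite ?pk// ?k1 ?k2// E; apply/andP; split; lra.
by move: H; rewrite E; lra.
Qed.

Lemma jordan_continuous : continuous g.
Proof.
move=> s; apply: cvg_complex.
  by have [_ d _ _] := xC2; exact: (derivable_continuous d).
by have [_ d _ _] := yC2; exact: (derivable_continuous d).
Qed.

Lemma sqdist0P s u : x s = x u -> y s = y u -> g s = g u.
Proof. by move=> ex ey; rewrite (path_complexE g s) (path_complexE g u) ex ey. Qed.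

Lemma Ck1_along (U : set R[i]) (h : R[i] -> R) : open U -> range g `<=` U ->
  Ck 1 U h -> [/\ derivable1 (h \o g), continuous (rderiv (h \o g)) &
    forall s, rderiv (h \o g) s =
      dir_derive h 1 (g s) * rderiv x s + dir_derive h 'i (g s) * rderiv y s].
Proof.
move=> oU gU hU.
have gE : h \o g = (fun s => h (x s +i* y s)).
  by apply/funext => s /=; rewrite -path_complexE.
have D (s : R) : is_derive s 1 (h \o g)
    (dir_derive h 1 (g s) * rderiv x s + dir_derive h 'i (g s) * rderiv y s).
  rewrite gE path_complexE; have [_ dx _ _] := xC2; have [_ dy _ _] := yC2.
  apply: (chain_rule oU hU); last 2 first.
  - exact: is_derive_deriv.
  - exact: is_derive_deriv.
  by apply: gU; exists s => //; rewrite -path_complexE.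
have F s : rderiv (h \o g) s =
    dir_derive h 1 (g s) * rderiv x s + dir_derive h 'i (g s) * rderiv y s.
  by apply: deriv_val.
split; [by move=> s; case: (D s)| |exact: F].
rewrite (_ : rderiv _ = fun s => dir_derive h 1 (g s) * rderiv x s +
  dir_derive h 'i (g s) * rderiv y s); last by apply/funext => s; exact: F.
have cont v : v = 1 \/ v = 'i -> continuous (fun s => dir_derive h v (g s)).
  move=> hv s; have [_ /(_ v hv)[_ [c _]]] := hU.
  move: c; rewrite continuous_open_subspace// => c.
  apply: (@continuous_comp _ _ _ g (dir_derive h v)); first exact: jordan_continuous.
  by apply: c; rewrite inE; apply: gU; exists s.
have [_ _ dx _] := xC2; have [_ _ dy _] := yC2.
move=> s; apply: cvgD; apply: cvgM; try exact: derivable_continuous.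
  by apply: (cont 1); left.
by apply: (cont 'i); right.
Qed.

Lemma C1M (a b : R -> R) : derivable1 a -> continuous (rderiv a) ->
  derivable1 b -> continuous (rderiv b) ->
  derivable1 (fun s => a s * b s) /\ continuous (rderiv (fun s => a s * b s)).
Proof.
move=> da ca db cb.
have D (s : R) : is_derive s 1 (fun s => a s * b s) (a s * rderiv b s + b s * rderiv a s).
  exact: (is_deriveM (is_derive_deriv s da) (is_derive_deriv s db)).
split; first by move=> s; case: (D s).
rewrite (_ : rderiv _ = fun s => a s * rderiv b s + b s * rderiv a s); last first.
  by apply/funext => s; exact: deriv_val.
have ca0 := derivable_continuous da; have cb0 := derivable_continuous db.
by move=> s; apply: cvgD; apply: cvgM; (exact: ca0 || exact: cb || exact: cb0 || exact: ca).
Qed.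

Lemma C1D (a b : R -> R) : derivable1 a -> continuous (rderiv a) ->
  derivable1 b -> continuous (rderiv b) ->
  derivable1 (fun s => a s + b s) /\ continuous (rderiv (fun s => a s + b s)).
Proof.
move=> da ca db cb.
have D (s : R) : is_derive s 1 (fun s => a s + b s) (rderiv a s + rderiv b s).
  exact: (is_deriveD (is_derive_deriv s da) (is_derive_deriv s db)).
split; first by move=> s; case: (D s).
rewrite (_ : rderiv _ = fun s => rderiv a s + rderiv b s); last first.
  by apply/funext => s; exact: deriv_val.
by move=> s; apply: cvgD; (exact: cb || exact: ca).
Qed.

Lemma smooth_C2per (f : R[i] -> R) : smooth_near (range g) f -> C2per l (f \o g).
Proof.
case=> U [oU gU fU]; have [_ H] := fU 2.
have [_ f1] := H 1 (or_introl erefl); have [_ f2] := H 'i (or_intror erefl).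
have [d0 c0 F0] := Ck1_along oU gU (fU 1).
have [d1 c1 _] := Ck1_along oU gU f1; have [d2 c2 _] := Ck1_along oU gU f2.
have [_ _ dx cx] := xC2; have [_ _ dy cy] := yC2.
have E : rderiv (f \o g) = (fun s => (dir_derive f 1 \o g) s * rderiv x s
    + (dir_derive f 'i \o g) s * rderiv y s) by apply/funext.
have [D1 K1] := C1M d1 c1 dx cx; have [D2 K2] := C1M d2 c2 dy cy.
have [D K] := C1D D1 K1 D2 K2.
split; last by rewrite E.
- by move=> s; rewrite /comp jordan_periodic.
- exact: d0.
- by rewrite E.
Qed.

Variable tau : R[i] -> R[i].
Hypothesis tauE : forall s, tau (g s) = cderive g s.

(** The tangent line at [g s] and the curve have the same velocity there, so the chain rule gives
    the same derivative of [f] along both. *)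
Lemma tangentialE (f : R[i] -> R) s : smooth_near (range g) f ->
  tangential tau f (g s) = rderiv (f \o g) s.
Proof.
case=> U [oU gU fU]; have [_ _ ->] := Ck1_along oU gU (fU 1).
rewrite /tangential tauE /dir_derive -/(dir_derive f 1 (g s)) -/(dir_derive f 'i (g s)).
pose a h := x s + rderiv x s * h; pose b h := y s + rderiv y s * h.
have gE : g s = a 0 +i* b 0 by rewrite /a /b !mulr0 !addr0 path_complexE.
have Us : U (a 0 +i* b 0) by rewrite -gE; apply: gU; exists s.
have da : is_derive (0 : R) 1 a (rderiv x s).
  apply/is_derive_expand => e e0; exists 1 => // h _; rewrite (_ : _ - _ = 0).
    by rewrite normr0 mulr_ge0// ltW.
  by rewrite /a /b; ring.
have db : is_derive (0 : R) 1 b (rderiv y s).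
  apply/is_derive_expand => e e0; exists 1 => // h _; rewrite (_ : _ - _ = 0).
    by rewrite normr0 mulr_ge0// ltW.
  by rewrite /a /b; ring.
have := chain_rule oU (fU 1) Us da db; rewrite -gE => D.
rewrite (_ : (fun h : R => _) = (fun h => f (a h +i* b h))).
  by rewrite derive1E derive_val.
apply/funext => h; congr f; rewrite cderiveE path_complexE.
by apply/eqP; rewrite eq_complex /a /b /=; apply/andP; split; apply/eqP; ring.
Qed.

Lemma Re_tangent_kernel s u :
  complex.Re (cderive g s / (g s - g u)) = tan_kernel x y s u.
Proof. by rewrite Re_complex_div cderiveE /= !raddfB. Qed.

(** The minus sign of the second term is absorbed by reversing [z - w], which makes the kernel
    symmetric. *)
Lemma kernel_off_diagE (f : R[i] -> R) s u : smooth_near (range g) f -> g s <> g u ->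
  kernel_off_diag tau f (g s) (g u) = dyson_kernel x y (f \o g) s u.
Proof.
move=> sf ne; rewrite /kernel_off_diag !tangentialE// !tauE /dyson_kernel.
case: andP => [[/eqP ex /eqP ey]|_]; first by case: ne; exact: sqdist0P.
rewrite [X in _ - _ * complex.Re (_ / X)](_ : _ = - (g u - g s)); last by rewrite opprB.
have -> : cderive g u / - (g u - g s) = - (cderive g u / (g u - g s)).
  by rewrite invrN mulrN.
by rewrite raddfN mulrN opprK Re_tangent_kernel -(Re_tangent_kernel u s).
Qed.

Lemma dyson_kernel_diag (phi : R -> R) s u : g s = g u ->
  dyson_kernel x y phi s u = rderiv (rderiv phi) s.
Proof. by move=> e; rewrite /dyson_kernel /re_path /im_path e !eqxx. Qed.

(** Close points of the curve lift to close parameters, so the limit along pairs of distinct points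
    follows from the continuity of the periodic kernel. *)
Lemma extend_diag_kernel (f : R[i] -> R) s u : smooth_near (range g) f ->
  extend_diag (range g) (kernel_off_diag tau f) (g s) (g u)
    = dyson_kernel x y (f \o g) s u.
Proof.
move=> sf; rewrite /extend_diag; case: eqP => [e|]; last exact: kernel_off_diagE.
have fC2 := smooth_C2per sf.
rewrite dyson_kernel_diag//; set A := [set p | _].
(* A value of [lim] can be identified only along a proper filter: distinct pairs on the curve must
   accumulate at the diagonal point. The pairs used are [(g (s + h), g s)], with [h < l] to keep
   them distinct. *)
have FP : ProperFilter (within A (nbhs (g s, g s))).
  have FF := @within_filter _ A (nbhs (g s, g s)) (nbhs_filter _).
  apply: Build_ProperFilter_ex.
  move=> P [[B C] /= [/nbhs_complexP[r1 r10 H1] /nbhs_singleton H2] HP].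
  have /nbhs_ballP[r /= r0 Hr] : nbhs s (g @^-1` B).
    by apply: jordan_continuous; apply/nbhs_complexP; exists r1.
  pose h := Num.min (r / 2) (l / 2).
  have h0 : 0 < h by rewrite lt_min !divr_gt0.
  have hl : h < l by rewrite gt_min [X in _ || X](_ : _ = true) ?orbT//; move: l0; lra.
  have hr : h < r by rewrite gt_min [X in X || _](_ : _ = true)//; move: r0; lra.
  have Bsh : B (g (s + h)).
    by apply: Hr; rewrite /ball/= opprD addrA subrr sub0r normrN gtr0_norm.
  exists (g (s + h), g s); apply: HP => //; split => /=; [by exists (s + h)|by exists s|].
  apply/eqP => E; have : s + h = s.
    apply: jordan_inj; rewrite /re_path /im_path ?E//.
    by rewrite addrAC subrr add0r gtr0_norm.
  lra.
apply: cvg_lim => //.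
apply/cvgrPdist_le => e0 e00.
have cK := @dyson_kernel_continuous _ l x y l0 xC2 yC2 jordan_unit_speed jordan_inj
  _ fC2 (s, s).
have /cvgrPdist_le/(_ _ e00)[[B C] /= [[d1 /= d10 HB] [d2 /= d20 HC]] HK] := cK.
have d0 : 0 < Num.min d1 d2 by rewrite lt_min d10.
have [r r0 Hr] := @near_point _ l x y l0 xC2 yC2 jordan_unit_speed jordan_inj _ d0.
have [e1 e10 He1] : exists2 e1 : R, 0 < e1 & e1 ^+ 2 + e1 ^+ 2 <= r.
  exists (Num.min 1 (r / 2)); first by rewrite lt_min ltr01 divr_gt0.
  set m := Num.min _ _; have m0 : 0 < m by rewrite lt_min ltr01 divr_gt0.
  have m1 : m <= 1 by rewrite ge_min lexx.
  have mr : m <= r / 2 by rewrite ge_min lexx orbT.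
  have : m ^+ 2 <= m by rewrite expr2 ger_pMr.
  lra.
pose N := [set z : R[i] | `|complex.Re (z - g s)| < e1 /\ `|complex.Im (z - g s)| < e1].
have nN : nbhs (g s) N.
  apply/nbhs_complexP; exists e1 => // a b ae be.
  by rewrite /N /= addrAC subrr add0r.
have NP z : N z -> range g z -> exists2 t, g t = z & `|s - t| < Num.min d1 d2.
  move=> [n1 n2] [t _ E]; have /Hr[k kd] : sqdist x y s t < r.
    apply: lt_le_trans He1; rewrite /sqdist /re_path /im_path E ltrD//.
      rewrite -(@real_normK _ (_ - _)) ?num_real// distrC -raddfB.
      by rewrite ltr_pXn2r ?nnegrE// ltW.
    rewrite -(@real_normK _ (_ - _)) ?num_real// distrC -raddfB.
    by rewrite ltr_pXn2r ?nnegrE// ltW.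
  by exists (t + k%:~R * l); rewrite ?(periodic_int jordan_periodic).
exists (N, N) => // -[z w] /= [Nz Nw] [Gz Gw /eqP zw] /=.
have [a Ea]:= NP z Nz Gz; have [b Eb] := NP w Nw Gw.
rewrite -{}Ea -{}Eb in zw *; rewrite !lt_min => /andP[b1 b2] /andP[a1 a2].
rewrite kernel_off_diagE// -(@dyson_kernel_diag _ s s)//.
by apply: (HK (a, b)); split; [apply: HB|apply: HC].
Qed.

End jordan_curve.

(** * The weak topology *)

Section pairing.
Context {R : realType} {X : ptopologicalType}.
Implicit Types (m : prob R X) (H : X -> R).

Lemma continuous_borel_measurable H : continuous H ->
  measurable_fun [set: borel X] (H : borel X -> R).
Proof.
move=> cH; apply: (measurability _ (measurable_realfun.RGenOpens.measurableE R)).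
move=> _ [_ [a [b ->] <-]]; rewrite setTI; apply: sub_sigma_algebra.
by move/continuousP : cH; apply; exact: interval_open.
Qed.

Definition bounded_cont H := continuous H /\ exists M : R, forall x, `|H x| <= M.

Lemma prob_setT m : (m : probability (borel X) R) [set: borel X] = 1%E.
Proof. exact: probability_setT. Qed.

Lemma pairing_integrable m H : bounded_cont H ->
  (m : probability (borel X) R).-integrable setT (EFin \o (H : borel X -> R)).
Proof.
move=> [cH [M HM]]; apply: measurable_bounded_integrable => //.
- exact: (eq_ind_r (fun x : \bar R => (x < +oo)%E) (ltry 1) (prob_setT m)).
- exact: continuous_borel_measurable.
- exists M; split; first exact: num_real.
  by move=> x /ltW Mx t _; exact: le_trans (HM t) Mx.
Qed.

Lemma bounded_cont_cst (c : R) : bounded_cont (fun=> c).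
Proof. by split; [move=> x; exact: cvg_cst|exists `|c|]. Qed.

Lemma bounded_contD H H' : bounded_cont H -> bounded_cont H' ->
  bounded_cont (fun x => H x + H' x).
Proof.
move=> [c [M HM]] [c' [M' HM']]; split; first by move=> x; apply: cvgD; [exact: c|exact: c'].
by exists (M + M') => x; rewrite (le_trans (ler_normD _ _))// lerD.
Qed.

Lemma bounded_contZ (k : R) H : bounded_cont H -> bounded_cont (fun x => k * H x).
Proof.
move=> [c [M HM]]; split; first by move=> x; apply: cvgM; [exact: cvg_cst|exact: c].
by exists (`|k| * M) => x; rewrite normrM ler_wpM2l.
Qed.

Lemma pairing_cst m (c : R) : pairing m (fun=> c) = c.
Proof.
by rewrite /pairing Rintegral_cst// [X in fine X](_ : _ = 1%E) ?mulr1//; exact: prob_setT.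
Qed.

Lemma pairingD m H H' : bounded_cont H -> bounded_cont H' ->
  pairing m (fun x => H x + H' x) = pairing m H + pairing m H'.
Proof. by move=> h h'; apply: RintegralD => //; exact: pairing_integrable. Qed.

Lemma pairingZ m (k : R) H : bounded_cont H ->
  pairing m (fun x => k * H x) = k * pairing m H.
Proof. by move=> h; apply: RintegralZl => //; exact: pairing_integrable. Qed.

Lemma pairingB m H H' : bounded_cont H -> bounded_cont H' ->
  pairing m (fun x => H x - H' x) = pairing m H - pairing m H'.
Proof. by move=> h h'; apply: RintegralB => //; exact: pairing_integrable. Qed.

Lemma pairing_le m H H' : bounded_cont H -> bounded_cont H' ->
  (forall x, H x <= H' x) -> pairing m H <= pairing m H'.
Proof. by move=> h h' le; apply: le_Rintegral => //; exact: pairing_integrable. Qed.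

Lemma pairing_norm m H (M : R) : bounded_cont H -> (forall x, `|H x| <= M) ->
  `|pairing m H| <= M.
Proof.
move=> h HM; rewrite ler_norml -(pairing_cst m (- M)) -{2}(pairing_cst m M).
apply/andP; split; apply: pairing_le => //; try exact: bounded_cont_cst;
  by move=> x; move: (HM x); rewrite ler_norml => /andP[].
Qed.

Lemma pairing_dist m H H' (M : R) : bounded_cont H -> bounded_cont H' ->
  (forall x, `|H x - H' x| <= M) -> `|pairing m H - pairing m H'| <= M.
Proof.
move=> h h' HM; rewrite -pairingB//; apply: pairing_norm => //.
have := bounded_contD h (bounded_contZ (-1) h').
by under [X in bounded_cont X]eq_fun do rewrite mulN1r.
Qed.

(** Integration against a scaled sum of Dirac masses is available for nonnegative functions; a
    bounded function is reduced to that case by adding its bound [M]. *)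
Lemma pairing_empirical (n : nat) (x : 'I_n.+1 -> X) H : bounded_cont H ->
  pairing (empirical x : prob R X) H = n.+1%:R^-1 * \sum_(i < n.+1) H (x i).
Proof.
move=> h; have [cH [M HM]] := h.
have pos (K : X -> R) : continuous K -> (forall z, 0 <= K z) ->
    pairing (empirical x : prob R X) K = n.+1%:R^-1 * \sum_(i < n.+1) K (x i).
  move=> cK K0; rewrite /pairing /Rintegral.
  have /measurable_EFinP mK := continuous_borel_measurable cK.
  rewrite (_ : (\int[_]_(z in _) _ = (n.+1%:R^-1 * \sum_(i < n.+1) K (x i))%:E)%E)//.
  rewrite /= /empirical /empirical_meas ge0_integral_mscale//; last first.
    by move=> z _; rewrite lee_fin.
  rewrite ge0_integral_measure_sum//; last by move=> z _; rewrite lee_fin.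
  rewrite EFinM -sumEFin; congr (_ * _)%E; apply: eq_bigr => i _.
  by rewrite integral_dirac// diracT mul1e /= inord_val.
have E : H = (fun z => (H z + M) - M) by apply/funext => z; rewrite addrK.
have h1 := bounded_contD h (bounded_cont_cst M).
rewrite {1}E pairingB//; last exact: bounded_cont_cst.
rewrite pairing_cst pos; last 2 first.
- by case: h1.
- by move=> z; have := HM z; rewrite ler_norml => /andP[]; lra.
rewrite big_split/= mulrDr sumr_const card_ord -[M *+ _]mulr_natl mulKf ?addrK//.
Qed.

End pairing.

(** * Functions on the curve through its parameter *)

Section curve_functions.
Context {R : realType} (l : R) (g : R -> R[i]).
Hypotheses (jg : jordan_arclength l g) (cg : C2 g).

Let l0 := jordan_length_gt0 jg.

Lemma on_curve_continuous : continuous (on_curve g).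
Proof.
apply: continuous_comp_initial; exact: (jordan_continuous jg cg).
Qed.

Lemma on_curve_eq s u : g s = g u -> on_curve g s = on_curve g u.
Proof. by move=> e; apply/val_inj. Qed.

Lemma on_curve_periodic s : on_curve g (s + l) = on_curve g s.
Proof. by apply: on_curve_eq; exact: (jordan_periodic jg). Qed.

Lemma on_curve_surj (z : curve g) : exists s, 0 <= s < l /\ on_curve g s = z.
Proof.
case: z => z Gz; have /set_mem[t _ E] := Gz.
have [k] := shift_itv l0 0 t; rewrite add0r => H; exists (t + k%:~R * l); split => //.
by apply/val_inj; rewrite /= (periodic_int (jordan_periodic jg)).
Qed.

Definition curve_param (z : curve g) : R := projT1 (cid (on_curve_surj z)).

Lemma curve_paramP z : 0 <= curve_param z < l /\ on_curve g (curve_param z) = z.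
Proof. exact: projT2 (cid (on_curve_surj z)). Qed.

(** The chosen parameter in [[0, l[] jumps at the base point of the curve; the composition is
    continuous when [h] is continuous and periodic. *)
Definition curve_fun (h : R -> R) (z : curve g) : R := h (curve_param z).

Lemma curve_fun_on (h : R -> R) s : (forall s, h (s + l) = h s) ->
  curve_fun h (on_curve g s) = h s.
Proof.
move=> ph; have [_ e] := curve_paramP (on_curve g s).
have {}e : g (curve_param (on_curve g s)) = g s by move/(congr1 val) : e.
have [||k] := @same_point _ l _ _ l0 (jordan_C2per jg cg).1 (jordan_C2per jg cg).2
  (jordan_inj jg) (curve_param (on_curve g s)) s.
- by rewrite /re_path e.
- by rewrite /im_path e.
by rewrite /curve_fun => ->; exact: periodic_int.
Qed.

(** The topology of the curve is the one induced by the plane, so nearness in the plane has to be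
    converted into nearness of parameters, which is what the chord-arc inequality does. *)
Lemma curve_continuous (H : curve g -> R) : continuous (H \o on_curve g) -> continuous H.
Proof.
move=> cH z; have [s [_ <-]] := on_curve_surj z.
have FF : Filter (nbhs (on_curve g s)) by exact: nbhs_filter.
apply/(@cvgrPdist_lt _ _ _ _ FF) => e e0.
have /cvgrPdist_lt/(_ _ e0)[d /= d0 Hd] := cH s.
have [r r0 Hr] := @near_point _ l _ _ l0 (jordan_C2per jg cg).1
  (jordan_C2per jg cg).2 (jordan_unit_speed jg) (jordan_inj jg) _ d0.
have [e1 e10 He1] : exists2 e1 : R, 0 < e1 & e1 ^+ 2 + e1 ^+ 2 <= r.
  exists (Num.min 1 (r / 2)); first by rewrite lt_min ltr01 divr_gt0.
  set m := Num.min _ _; have m0 : 0 < m by rewrite lt_min ltr01 divr_gt0.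
  have m1 : m <= 1 by rewrite ge_min lexx.
  have mr : m <= r / 2 by rewrite ge_min lexx orbT.
  have : m ^+ 2 <= m by rewrite expr2 ger_pMr.
  lra.
pose N := [set w : R[i] | `|complex.Re (w - g s)| < e1 /\ `|complex.Im (w - g s)| < e1].
have nN : nbhs (g s) N.
  apply/nbhs_complexP; exists e1 => // a b ae be.
  by rewrite /N /= addrAC subrr add0r.
have nN' : nbhs (on_curve g s) (@curve_val R g @^-1` N).
  exact: (@initial_continuous (curve g) R[i] (@curve_val R g) (on_curve g s) N nN).
apply: (@filterS _ _ FF _ _ _ nN') => w; have [t [_ <-]] := on_curve_surj w => -[n1 n2].
have /Hr[k kd] : sqdist (re_path g) (im_path g) s t < r.
  apply: lt_le_trans He1; rewrite /sqdist /re_path /im_path ltrD//.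
    rewrite -(@real_normK _ (_ - _)) ?num_real// distrC -raddfB.
    by rewrite ltr_pXn2r ?nnegrE// ltW.
  rewrite -(@real_normK _ (_ - _)) ?num_real// distrC -raddfB.
  by rewrite ltr_pXn2r ?nnegrE// ltW.
have := Hd _ kd; rewrite /=.
by rewrite (periodic_int on_curve_periodic).
Qed.

Lemma curve_fun_continuous (h : R -> R) : (forall s, h (s + l) = h s) ->
  continuous h -> bounded_cont (curve_fun h).
Proof.
move=> ph ch; split.
  apply: curve_continuous; rewrite (_ : _ \o _ = h)//.
  by apply/funext => s; exact: curve_fun_on.
have [M _ HM] := periodic_bounded l0 ph ch.
by exists M => z; exact: HM.
Qed.

Lemma curve_fun_onE (H : curve g -> R) : curve_fun (H \o on_curve g) = H.
Proof.
by apply/funext => z; rewrite /curve_fun /=; have [_ ->] := curve_paramP z.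
Qed.

End curve_functions.

Section weak_topology.
Context {R : realType} {X : ptopologicalType}.
Implicit Types (m : prob R X) (H : X -> R).

Lemma ptws_entourage1 (I : Type) (i : I) (e : R) : 0 < e ->
  entourage [set fg : {ptws I -> R} * {ptws I -> R} | `|fg.1 i - fg.2 i| < e].
Proof.
move=> e0.
have entA : @entourage (initial_topology (@proj I (fun=> R) i))
    [set fg | `|fg.1 i - fg.2 i| < e].
  exists [set ab | `|ab.1 - ab.2| < e] => //.
  by rewrite -entourage_ballE; exists e.
exists [set fg | `|fg.1 i - fg.2 i| < e] => //.
match goal with |- @finI_from ?J _ _ ?f ?A =>
  have [q <-] : exists q : Choice.sort J, f q = A end; last exact: finI_from1.
have pA := asboolT entA.
by exists (exist _ (i, [set fg | `|fg.1 i - fg.2 i| < e]) pA).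
Qed.

Lemma ptws_entourageE (I : Type) (E : set ({ptws I -> R} * {ptws I -> R})) :
  entourage E -> exists r : seq I, exists2 e : R, 0 < e &
    forall f g : I -> R, (forall i, List.In i r -> `|f i - g i| < e) -> E (f, g).
Proof.
move=> [B [F _ <-] BE].
suff [r [e e0 Hr]] : exists r : seq I, exists2 e : R, 0 < e &
    forall f g : I -> R, (forall i, List.In i r -> `|f i - g i| < e) ->
    forall p, p \in finmap.enum_fset F -> (projT1 p).2 (f, g).
  by exists r, e => // f g /Hr H; apply: BE => p pF; exact: H.
elim: (finmap.enum_fset F) => [|p s [r [e e0 Hr]]]; first by exists [::], 1.
case: p => -[i A] pA; have [V + VA] := asboolW pA; rewrite -entourage_ballE.
case=> e' /= e'0 He'.
exists (i :: r), (Num.min e e'); first by rewrite lt_min e0.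
move=> f g fg q; rewrite inE => /orP[/eqP ->/=|].
  apply: VA => /=; apply: He'; have := fg i (or_introl erefl).
  by rewrite lt_min => /andP[].
by apply: Hr => j jr; have := fg j (or_intror jr); rewrite lt_min => /andP[].
Qed.

Lemma prob_entourage1 H (e : R) : bounded_cont H -> 0 < e ->
  entourage [set mm : prob R X * prob R X | `|pairing mm.1 H - pairing mm.2 H| < e].
Proof.
move=> h e0; pose i : bounded_continuous R X := exist _ H h.
by exists [set fg | `|fg.1 i - fg.2 i| < e] => //; exact: ptws_entourage1.
Qed.

(** The uniformity is pulled back from a product of lines, so each entourage is controlled by
    finitely many test functions and one tolerance. *)
Lemma prob_entourageE (E : set (prob R X * prob R X)) : entourage E ->
  exists2 r : seq (X -> R), (forall H, List.In H r -> bounded_cont H) &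
   exists2 e : R, 0 < e & forall m m',
    (forall H, List.In H r -> `|pairing m H - pairing m' H| < e) -> E (m, m').
Proof.
move=> [V /ptws_entourageE[r [e e0 Hr]] VE].
exists (List.map (fun i : bounded_continuous R X => projT1 i) r).
  by move=> H /List.in_map_iff[i [<- _]]; exact: projT2 i.
exists e => // m m' Hm; apply: VE; apply: Hr => i ir /=.
by apply: Hm; apply/List.in_map_iff; exists i.
Qed.

Lemma pairing_continuous H : bounded_cont H -> continuous (fun m : prob R X => pairing m H).
Proof.
move=> h m; have FF : Filter (nbhs m) by exact: nbhs_filter.
apply/(@cvgrPdist_lt _ _ _ _ FF) => e e0.
have := @nbhs_entourage _ m _ (prob_entourage1 h e0).
by apply: (@filterS _ _ FF) => m' /xsectionP.
Qed.

(** Uniform convergence of measure-valued paths can be tested one function at a time, since an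
    entourage involves only finitely many of them. *)
Lemma paths_cvgP (T : R) (F : set_system (paths X T)) (p : paths X T) : Filter F ->
  (forall H, bounded_cont H -> forall e : R, 0 < e -> F [set q |
     forall t, `[0, T]%classic t -> `|pairing (p t) H - pairing (q t) H| < e]) ->
  F --> p.
Proof.
move=> FF HF A /uniform_nbhs[E [/prob_entourageE[r hr [e e0 Hr]] EA]].
suff : F [set q | forall t, `[0, T]%classic t ->
    forall H, List.In H r -> `|pairing (p t) H - pairing (q t) H| < e].
  by apply: filterS => q Hq; apply: EA => t /Hq; exact: Hr.
elim: r hr {Hr} => [|H r IH] hr; first by apply: (@filterS _ F FF setT);
  [move=> q _ t _ H []|exact: (@filterT _ F FF)].
have F1 := HF H (hr H (or_introl erefl)) e e0.
have F2 := IH (fun K Kr => hr K (or_intror Kr)).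
by apply: filterS2 F1 F2 => q q1 q2 t tT K [<-|Kr]; [exact: q1|exact: q2].
Qed.

Lemma paths_nbhs (T : R) (p : paths X T) H (e : R) : bounded_cont H -> 0 < e ->
  nbhs p [set q : paths X T |
     forall t, `[0, T]%classic t -> `|pairing (p t) H - pairing (q t) H| < e].
Proof.
move=> h e0; apply/uniform_nbhs.
by exists [set mm | `|pairing mm.1 H - pairing mm.2 H| < e]; split => //;
  exact: prob_entourage1.
Qed.

Lemma continuous_pathsP (T : R) (p : paths X T) :
  (forall H, bounded_cont H ->
     {within `[0, T], continuous (fun t => pairing (p t) H)}) ->
  continuous_paths p.
Proof.
move=> cp t; have FF : Filter (nbhs (t : subspace `[0, T])) by exact: nbhs_filter.
move=> A; rewrite /= -nbhs_entourageE.
move=> [E /prob_entourageE[r hr [e e0 Hr]] EA].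
suff : \forall u \near (t : subspace `[0, T]),
    forall H, List.In H r -> `|pairing (p t) H - pairing (p u) H| < e.
  by apply: (@filterS _ _ FF) => u Hu; apply: EA; apply/xsectionP/Hr.
elim: r hr {Hr} => [|H r IH] hr; first by apply: (@filterS _ _ FF) filterT.
have := cp H (hr H (or_introl erefl)) t.
move/(@cvgrPdist_lt _ _ _ _ FF) => /(_ e e0) F1.
have F2 := IH (fun K Kr => hr K (or_intror Kr)).
by apply: (@filterS2 _ _ FF) F1 F2 => u u1 u2 K [<-|Kr]; [exact: u1|exact: u2].
Qed.

Lemma continuous_paths_pairing (T : R) (p : paths X T) H : bounded_cont H ->
  continuous_paths p -> {within `[0, T], continuous (fun t => pairing (p t) H)}.
Proof.
move=> h cp t; apply: (@continuous_comp (subspace `[0, T]) _ _ (p : R -> prob R X)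
  (fun m => pairing m H)); first exact: cp.
exact: pairing_continuous.
Qed.

End weak_topology.

(** * The mean-field drift *)

Lemma continuous_sum (R : realType) (T : topologicalType) (I : Type) (r : seq I)
    (F : I -> T -> R) : (forall i, continuous (F i)) ->
  continuous (fun t => \sum_(i <- r) F i t).
Proof.
move=> cF; elim: r => [|i r IH] t.
  rewrite (_ : (fun t => _) = cst 0); first exact: cvg_cst.
  by apply/funext => u; rewrite big_nil.
rewrite (_ : (fun t => _) = (fun t => F i t + \sum_(j <- r) F j t)).
  by apply: cvgD; [exact: cF|exact: IH].
by apply/funext => u; rewrite big_cons.
Qed.

Section mean_field_drift.
Context {R : realType} (l : R) (g : R -> R[i]).
Hypotheses (jg : jordan_arclength l g) (cg : C2 g).
Local Notation x := (re_path g).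
Local Notation y := (im_path g).
Let l0 := jordan_length_gt0 jg.
Let xC2 := (jordan_C2per jg cg).1.
Let yC2 := (jordan_C2per jg cg).2.
Let us := jordan_unit_speed jg.
Let inj := jordan_inj jg.
Local Notation K := (dyson_kernel x y).

Let periodic (h : R -> R) := forall s, h (s + l) = h s.

Lemma coord_lipschitz (h : R -> R) s u :
  h = x \/ h = y -> (h s - h u) ^+ 2 <= (s - u) ^+ 2.
Proof.
move=> hxy; have [d H] : derivable1 h /\ forall s, `|rderiv h s| <= 1.
  have [_ dx _ _] := xC2; have [_ dy _ _] := yC2.
  case: hxy => ->; split => // t; rewrite -(@ler_pXn2r _ 2)// ?nnegrE// expr1n
    real_normK ?num_real// -(us t) ?lerDl ?lerDr sqr_ge0//.
have := deriv_lipschitz d H s u; rewrite mul1r -(@ler_pXn2r _ 2)// ?nnegrE//.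
by rewrite !real_normK ?num_real.
Qed.

(** A partition of unity [b j] in the second variable, subordinate to small discs around nodes of
    the curve, gives [K(s, u)] as nearly the sum of [K(s, v j) * b j u]. Such a separated sum turns
    the double integral of the drift into a polynomial in pairings. *)
Lemma kernel_partition phi (e : R) : C2per l phi -> 0 < e ->
  exists2 r : seq ((R -> R) * (R -> R)),
    (forall p, List.In p r -> [/\ periodic p.1, continuous p.1, periodic p.2 & continuous p.2])
  & forall s u, `|K phi s u - \sum_(p <- r) p.1 s * p.2 u| <= e.
Proof.
move=> phiC2 e0.
have Kl s u := @dyson_kernel_periodicl _ l x y xC2 yC2 phi s u phiC2.
have Kr s u := @dyson_kernel_periodicr _ l x y l0 xC2 yC2 inj phi s u phiC2.
have cK := @dyson_kernel_continuous _ l x y l0 xC2 yC2 us inj phi phiC2.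
have [d d0 Hd] := periodic2_ucont l0 Kl Kr cK e0.
have [rho rho0 Hrho] := @near_point _ l x y l0 xC2 yC2 us inj _ d0.
(* Adjacent nodes are [l / J] apart in arc length. Each coordinate is 1-Lipschitz, so
   [2 * (l / J) ^+ 2 < rho] puts every point of the curve within squared distance [rho] of a
   node. *)
pose J := (Num.truncn (2 * l ^+ 2 / rho)).+1.
have J1 : 1 <= J%:R :> R by rewrite ler1n.
have J0 : 0 < J%:R :> R by rewrite ltr0n.
have HJ : 2 * (l / J%:R) ^+ 2 < rho.
  have H : 2 * l ^+ 2 / rho < J%:R by exact: truncnS_gt.
  rewrite ltr_pdivrMr// in H; rewrite expr_div_n mulrA ltr_pdivrMr ?exprn_gt0//.
  apply: lt_le_trans H _; rewrite mulrC ler_wpM2l ?(ltW rho0)//.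
  by rewrite expr2 ler_peMl ?(ltW J0).
pose v (j : 'I_J) : R := j%:R * (l / J%:R).
(* Twice the positive part of [rho - sqdist]: continuous, and zero outside the disc of node [j]. *)
pose psi j u := rho - sqdist x y u (v j) + `|rho - sqdist x y u (v j)|.
have psi0 j u : 0 <= psi j u.
  have := ler_norm (- (rho - sqdist x y u (v j))); rewrite normrN /psi => H; lra.
pose Psi u := \sum_j psi j u.
have Psi0 u : 0 < Psi u.
  have [k] := shift_itv l0 0 u; rewrite add0r; set u' := u + _ => /andP[u1 u2].
  have jlt : (Num.truncn (u' * J%:R / l) < J)%N.
    rewrite truncn_lt_nat; last by rewrite divr_ge0 ?mulr_ge0// ltW.
    by rewrite ltr_pdivrMr// mulrC ltr_pM2l.
  pose j := Ordinal jlt.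
  rewrite /Psi (bigD1 j)//= ltr_pwDl//; last by apply: sumr_ge0.
  have dist : sqdist x y u (v j) < rho.
    have -> : sqdist x y u (v j) = sqdist x y u' (v j).
      have [px _ _ _] := xC2; have [py _ _ _] := yC2.
      by rewrite /sqdist /u' !(periodic_int px) !(periodic_int py).
    have near_node : (u' - v j) ^+ 2 <= (l / J%:R) ^+ 2.
      have u'0 : 0 <= u' * J%:R / l by rewrite divr_ge0 ?mulr_ge0// ltW.
      have /andP[t1 t2] := truncn_itv u'0.
      have E : u' = (u' * J%:R / l) * (l / J%:R).
        by field; rewrite gt_eqF//= gt_eqF.
      have lJ : 0 < l / J%:R by rewrite divr_gt0.
      have h1 : v j <= u' by rewrite /v [leRHS]E ler_pM2r.
      have h2 : u' < v j + l / J%:R.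
        rewrite /v -[X in _ < _ + X]mul1r -mulrDl [ltLHS]E ltr_pM2r//.
        by rewrite natr1.
      rewrite ler_pXn2r ?nnegrE ?subr_ge0// ?(ltW lJ)//; lra.
    apply: le_lt_trans HJ; rewrite mulr_natl mulr2n lerD//.
      exact: le_trans (coord_lipschitz u' (v j) (or_introl erefl)) near_node.
    exact: le_trans (coord_lipschitz u' (v j) (or_intror erefl)) near_node.
  have H : 0 < rho - sqdist x y u (v j) by rewrite subr_gt0.
  by rewrite /psi gtr0_norm//; apply: addr_gt0.
pose b j u := psi j u / Psi u.
have b0 j u : 0 <= b j u by apply: divr_ge0; [exact: psi0|exact: ltW].
exists [seq (fun s => K phi s (v j), b j) | j <- enum 'I_J].
  have cx := derivable_continuous (let: And4 _ d _ _ := xC2 in d).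
  have cy := derivable_continuous (let: And4 _ d _ _ := yC2 in d).
  have cpsi j : continuous (psi j).
    have csq : continuous (fun u => rho - sqdist x y u (v j)).
      move=> u; apply: cvgB; first exact: cvg_cst.
      by apply: cvgD; apply: cvgM; apply: cvgB; (exact: cx || exact: cy || exact: cvg_cst).
    move=> u; apply: cvgD; first exact: csq.
    exact: (cvg_norm (csq u)).
  have ppsi j : periodic (psi j).
    have [px _ _ _] := xC2; have [py _ _ _] := yC2.
    by move=> u; rewrite /psi /sqdist px py.
  move=> p /List.in_map_iff[j [<- _]]; split => /=.
  - by move=> s; exact: Kl.
  - move=> s; apply: (@continuous_comp2 _ _ (K phi) id (fun=> v j)).
    + exact: cK.
    + exact: cvg_id.
    + exact: cvg_cst.
  - move=> u; rewrite /b ppsi /Psi; congr (_ / _).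
    by apply: eq_bigr => i _; rewrite ppsi.
  - move=> u; apply: cvgM; first exact: cpsi.
    by apply: cvgV; [rewrite gt_eqF|exact: continuous_sum].
move=> s u; rewrite big_map big_enum /=.
rewrite [X in _ - X](_ : _ = \sum_j K phi s (v j) * b j u); last exact: eq_bigl.
have sb : \sum_j b j u = 1 by rewrite /b -mulr_suml divff// gt_eqF//; exact: Psi0.
rewrite -[K phi s u]mulr1 -sb mulr_sumr -sumrB.
apply: le_trans (ler_norm_sum _ _ _) _.
rewrite -[leRHS]mulr1 -sb mulr_sumr; apply: ler_sum => j _.
rewrite -mulrBl normrM (ger0_norm (b0 j u)).
have [z|nz] := eqVneq (psi j u) 0; first by rewrite /b z mul0r !mulr0.
rewrite ler_wpM2r//.
have /Hrho[k kd] : sqdist x y u (v j) < rho.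
  rewrite ltNge; apply: contra nz => le; rewrite /psi ler0_norm ?subr_le0//.
  by rewrite subrr.
have -> : K phi s (v j) = K phi s (v j + k%:~R * l).
  by rewrite (periodic_int (Kr s)).
by apply/ltW/Hd => //; rewrite subrr normr0.
Qed.

(** The double integral of the equation in the arc-length coordinate, without the factor
    [beta / 4]. *)
Definition mean_drift (phi : R -> R) (m : prob R (curve g)) : R :=
  pairing m (fun z => pairing m (fun w =>
    K phi (curve_param jg z) (curve_param jg w))).

Lemma limit_driftE (tau : R[i] -> R[i]) (f : R[i] -> R) m :
  (forall s, tau (g s) = cderive g s) -> smooth_near (range g) f ->
  limit_drift tau f m = mean_drift (f \o g) m.
Proof.
move=> tauE sf; congr pairing; apply/funext => z; congr pairing; apply/funext => w.
have [_ ez] := curve_paramP jg z; have [_ ew] := curve_paramP jg w.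
by rewrite -{1}ez -{1}ew /= (extend_diag_kernel jg cg tauE).
Qed.

Section fixed_test_function.
Variables (phi : R -> R) (phiC2 : C2per l phi).

Let Kl s u := @dyson_kernel_periodicl _ l x y xC2 yC2 phi s u phiC2.
Let Kr s u := @dyson_kernel_periodicr _ l x y l0 xC2 yC2 inj phi s u phiC2.
Let cK := @dyson_kernel_continuous _ l x y l0 xC2 yC2 us inj phi phiC2.

Lemma kernel_bounded_cont s :
  bounded_cont (fun w : curve g => K phi s (curve_param jg w)).
Proof.
apply: (@curve_fun_continuous _ _ _ jg cg (K phi s)); first exact: Kr.
move=> u; apply: (@continuous_comp2 _ _ (K phi) (fun=> s) id).
- exact: cK.
- exact: cvg_cst.
- exact: cvg_id.
Qed.

Lemma kernel_pairing_bounded_cont m : bounded_cont (fun z : curve g =>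
  pairing m (fun w => K phi (curve_param jg z) (curve_param jg w))).
Proof.
apply: (@curve_fun_continuous _ _ _ jg cg (fun s =>
  pairing m (fun w => K phi s (curve_param jg w)))).
  by move=> s; congr pairing; apply/funext => w; exact: Kl.
move=> s; apply/cvgrPdist_le => e e0.
have [d d0 Hd] := periodic2_ucont l0 Kl Kr cK e0.
exists d => //= s' ss'; apply: pairing_dist; try exact: kernel_bounded_cont.
by move=> w; apply/ltW/Hd => //; rewrite subrr normr0.
Qed.

(** The same measure appears twice, so replacing the kernel by a separated one costs its uniform
    error once, and Fubini for a finite sum is mere linearity. *)
Lemma mean_drift_separated (e : R) (r : seq ((R -> R) * (R -> R))) m :
  (forall p, List.In p r ->
     [/\ periodic p.1, continuous p.1, periodic p.2 & continuous p.2]) ->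
  (forall s u, `|K phi s u - \sum_(p <- r) p.1 s * p.2 u| <= e) ->
  `|mean_drift phi m - \sum_(p <- r)
     pairing m (curve_fun jg p.1) * pairing m (curve_fun jg p.2)| <= e.
Proof.
move=> Hr He.
have bc p : List.In p r -> bounded_cont (curve_fun jg p.1) /\ bounded_cont (curve_fun jg p.2).
  by move=> /Hr[a b c d]; split; exact: curve_fun_continuous.
have sumbc (c : (R -> R) * (R -> R) -> R) (F : (R -> R) * (R -> R) -> curve g -> R) :
    (forall p, List.In p r -> bounded_cont (F p)) ->
    bounded_cont (fun z => \sum_(p <- r) c p * F p z) /\
    pairing m (fun z => \sum_(p <- r) c p * F p z) = \sum_(p <- r) c p * pairing m (F p).
  elim: (r) => [|p q IH] H.
    under [X in bounded_cont X /\ pairing m X = _]eq_fun do rewrite big_nil.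
    by rewrite big_nil pairing_cst; split => //; exact: bounded_cont_cst.
  have [b1 b2] := IH (fun p pq => H p (or_intror pq)).
  have b0 := H p (or_introl erefl).
  under [X in bounded_cont X /\ pairing m X = _]eq_fun do rewrite big_cons.
  rewrite big_cons -b2 -pairingZ// -pairingD//; last exact: bounded_contZ.
  by split => //; apply: bounded_contD => //; exact: bounded_contZ.
have [S1 S2] := sumbc (fun p => pairing m (curve_fun jg p.2)) (fun p => curve_fun jg p.1)
  (fun p pr => (bc p pr).1).
under [X in _ - X]eq_bigr do rewrite mulrC.
rewrite -S2; apply: pairing_dist => // [|z]; first exact: kernel_pairing_bounded_cont.
have [T1 T2] := sumbc (fun p => p.1 (curve_param jg z)) (fun p => curve_fun jg p.2)
  (fun p pr => (bc p pr).2).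
under [X in _ - X]eq_bigr do rewrite mulrC.
by rewrite -T2; apply: pairing_dist => //; exact: kernel_bounded_cont.
Qed.

(** Uniform continuity and not only continuity: on path space it makes the drifts of two uniformly
    close paths close at all times simultaneously. A product of two bounded pairings is uniformly
    continuous, and finitely many products approximate the drift. *)
Lemma mean_drift_entourage (e : R) : 0 < e ->
  entourage [set mm : prob R (curve g) * prob R (curve g) |
    `|mean_drift phi mm.1 - mean_drift phi mm.2| < e].
Proof.
move=> e0; have e30 : 0 < e / 3 by rewrite divr_gt0.
have [r Hr He] := kernel_partition phiC2 e30.
have bc p : List.In p r -> bounded_cont (curve_fun jg p.1) /\ bounded_cont (curve_fun jg p.2).
  by move=> /Hr[a b c d]; split; exact: curve_fun_continuous.
have prod (H H' : curve g -> R) (d : R) : bounded_cont H -> bounded_cont H' -> 0 < d ->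
  entourage [set mm : prob R (curve g) * prob R (curve g) |
    `|pairing mm.1 H * pairing mm.1 H' - pairing mm.2 H * pairing mm.2 H'| < d].
  move=> h h' d0; have [_ [M HM]] := h; have [_ [M' HM']] := h'.
  pose B := `|M| + `|M'| + 1; have B0 : 0 < B by rewrite ltr_wpDl// addr_ge0.
  have MB : M <= B by rewrite /B; have := ler_norm M; have := normr_ge0 M'; lra.
  have MB' : M' <= B by rewrite /B; have := ler_norm M'; have := normr_ge0 M; lra.
  have dB : 0 < d / (2 * B) by rewrite divr_gt0// mulr_gt0.
  apply: filterS (filterI (prob_entourage1 h dB) (prob_entourage1 h' dB)).
  move=> [m m'] /= [q1 q2].
  have -> : pairing m H * pairing m H' - pairing m' H * pairing m' H' =
    (pairing m H - pairing m' H) * pairing m H' +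
    pairing m' H * (pairing m H' - pairing m' H') by ring.
  apply: le_lt_trans (ler_normD _ _) _; rewrite !normrM.
  have nB1 : `|pairing m H'| <= B by apply: le_trans MB'; exact: pairing_norm.
  have nB2 : `|pairing m' H| <= B by apply: le_trans MB; exact: pairing_norm.
  have -> : d = d / (2 * B) * B + B * (d / (2 * B)).
    by field; rewrite gt_eqF.
  have := ler_wpM2l (normr_ge0 (pairing m H - pairing m' H)) nB1.
  have := ler_wpM2r (normr_ge0 (pairing m H' - pairing m' H')) nB2.
  have : `|pairing m H - pairing m' H| * B < d / (2 * B) * B by rewrite ltr_pM2r.
  have : B * `|pairing m H' - pairing m' H'| < B * (d / (2 * B)) by rewrite ltr_pM2l.
  set a1 := _ * B; set a2 := B * _; set a3 := _ * B; set a4 := B * _; lra.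
have sume : forall d : R, 0 < d -> entourage [set mm : prob R (curve g) * prob R (curve g) |
    `|\sum_(p <- r) pairing mm.1 (curve_fun jg p.1) * pairing mm.1 (curve_fun jg p.2)
    - \sum_(p <- r) pairing mm.2 (curve_fun jg p.1) * pairing mm.2 (curve_fun jg p.2)| < d].
  elim: (r) bc => [|p q IH] bc d d0.
    by apply: filterS filterT => mm _ /=; rewrite !big_nil subrr normr0.
  have d20 : 0 < d / 2 by rewrite divr_gt0.
  have [b1 b2] := bc p (or_introl erefl).
  apply: filterS (filterI (prod _ _ _ b1 b2 d20)
    (IH (fun p pq => bc p (or_intror pq)) _ d20)) => -[m m'] /= [q1 q2].
  rewrite !big_cons opprD addrACA; apply: le_lt_trans (ler_normD _ _) _.
  by rewrite (splitr d) ltrD.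
apply: filterS (sume _ e30) => -[m m'] /= q.
have M1 := mean_drift_separated m Hr He; have M2 := mean_drift_separated m' Hr He.
move: M1 M2 q; set a := mean_drift phi m; set a' := mean_drift phi m'.
set S := \sum_(p <- r) _; set S' := \sum_(p <- r) _ => M1 M2 q.
have -> : a - a' = (a - S) + ((S - S') + - (a' - S')) by ring.
apply: le_lt_trans (ler_normD _ _) _.
have := ler_normD (S - S') (- (a' - S')); rewrite normrN; lra.
Qed.

Lemma mean_drift_continuous : continuous (mean_drift phi).
Proof.
move=> m; have FF : Filter (nbhs m) by exact: nbhs_filter.
apply/(@cvgrPdist_lt _ _ _ _ FF) => e e0.
have := @nbhs_entourage _ m _ (mean_drift_entourage e0).
by apply: (@filterS _ _ FF) => m' /xsectionP.
Qed.

Lemma mean_drift_norm (m : prob R (curve g)) (M : R) :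
  (forall s u, `|K phi s u| <= M) -> `|mean_drift phi m| <= M.
Proof.
move=> HM; apply: pairing_norm; first exact: kernel_pairing_bounded_cont.
by move=> z; apply: pairing_norm => //; exact: kernel_bounded_cont.
Qed.

Lemma mean_drift_empirical (n : nat) (X : 'I_n.+1 -> R) :
  mean_drift phi (empirical (fun i => on_curve g (X i))) =
  n.+1%:R^-1 * \sum_(i < n.+1) (n.+1%:R^-1 * \sum_(j < n.+1) K phi (X i) (X j)).
Proof.
rewrite /mean_drift pairing_empirical; last exact: kernel_pairing_bounded_cont.
congr (_ * _); apply: eq_bigr => i _.
rewrite pairing_empirical; last exact: kernel_bounded_cont.
congr (_ * _); apply: eq_bigr => j _.
have := @curve_fun_on _ _ _ jg cg (K phi (curve_param jg (on_curve g (X i)))) (X j) (Kr _).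
rewrite /curve_fun => ->.
exact: (@curve_fun_on _ _ _ jg cg (fun s => K phi s (X j)) (X i) (Kl ^~ _)).
Qed.

End fixed_test_function.

(** The kernel is linear in [phi], so its bound by the second derivative applies to the difference
    of two test functions. *)
Lemma mean_drift_C2_dist : exists2 C : R, 0 <= C & forall phi psi (e : R) m,
  C2per l phi -> C2per l psi ->
  (forall s, `|rderiv (rderiv phi) s - rderiv (rderiv psi) s| <= e) ->
  `|mean_drift phi m - mean_drift psi m| <= C * e.
Proof.
have [C C0 HC] := @dyson_kernel_bound _ l x y l0 xC2 yC2 us inj.
exists C => // phi psi e m h1 h2 H.
have [p1 d1 dd1 c1] := h1; have [p2 d2 dd2 c2] := h2.
have E1 : rderiv (fun s => phi s - psi s) = (fun s => rderiv phi s - rderiv psi s).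
  apply/funext => s; apply: deriv_val.
  exact: (is_deriveB (is_derive_deriv s d1) (is_derive_deriv s d2)).
have E2 : rderiv (fun s => rderiv phi s - rderiv psi s) =
    (fun s => rderiv (rderiv phi) s - rderiv (rderiv psi) s).
  apply/funext => s; apply: deriv_val.
  exact: (is_deriveB (is_derive_deriv s dd1) (is_derive_deriv s dd2)).
have h3 : C2per l (fun s => phi s - psi s).
  split.
  - by move=> s; rewrite p1 p2.
  - move=> s; have := is_deriveB (is_derive_deriv s d1) (is_derive_deriv s d2).
    by case.
  - rewrite E1 => s; have := is_deriveB (is_derive_deriv s dd1) (is_derive_deriv s dd2).
    by case.
  - by rewrite E1 E2 => s; apply: cvgB; [exact: c1|exact: c2].
have HK : forall s u, `|K phi s u - K psi s u| <= C * e.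
  move=> s u; have := HC _ e h3; rewrite E1 E2 => /(_ H s u).
  rewrite /dyson_kernel E1 E2; case: ifP => // _ H'.
  apply: le_trans H'; rewrite le_eqVlt; apply/orP; left; apply/eqP; congr `|_|; ring.
apply: pairing_dist; try exact: kernel_pairing_bounded_cont.
by move=> z; apply: pairing_dist => //; exact: kernel_bounded_cont.
Qed.

End mean_field_drift.

(** * Quantile representation and compactness *)

Section lebesgue_estimates.
Context {R : realType}.
Local Notation leb := (@lebesgue_measure R).

Lemma bounded_itv_integrable (f : R -> R) (M : R) (i : interval R) (a b : R) :
  measurable_fun setT f -> (forall u, `|f u| <= M) -> [set` i] `<=` `[a, b] ->
  leb.-integrable [set` i] (EFin \o f).
Proof.
move=> mf fM iab; apply: measurable_bounded_integrable => //.
- apply: le_lt_trans (_ : (leb `[a, b]%classic < +oo)%E).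
    by apply: le_measure => //; rewrite inE; exact: measurable_itv.
  by rewrite /= lebesgue_measure_itv /=; case: ifP => _; rewrite ltry.
- exact: measurable_funTS.
- exists M; split; first exact: num_real.
  by move=> x /ltW Mx t _; exact: le_trans (fM t) Mx.
Qed.

Lemma Rintegral_itv_close (f : R -> R) (M a b c e : R) : a <= b ->
  measurable_fun setT f -> (forall u, `|f u| <= M) ->
  (forall u, a < u < b -> `|f u - c| <= e) ->
  `|\int[leb]_(u in `]a, b]) f u - c * (b - a)| <= e * (b - a).
Proof.
move=> ab mf fM fc.
have len : fine (leb `]a, b[%classic) = b - a.
  rewrite /= lebesgue_measure_itv /= lte_fin; case: ltP => [//|ba].
  by rewrite (@le_anti _ _ a b) ?ab ?ba// subrr.
have sub : [set` `]a, b[] `<=` `[a, b]%classic by exact: subset_itv_oo_cc.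
have int1 := bounded_itv_integrable mf fM sub.
rewrite -Rintegral_itv_bndo_bndc//.
have mc (k : R) : measurable_fun setT (fun _ : R => k) by exact: measurable_cst.
have intc (k : R) : leb.-integrable `]a, b[%classic (EFin \o (fun=> k)).
  by apply: (@bounded_itv_integrable _ `|k| _ a b).
have int2 : leb.-integrable `]a, b[%classic (EFin \o (fun u => f u - c)).
  apply: (@bounded_itv_integrable _ (M + `|c|) _ a b) => //.
    exact: measurable_funB.
  by move=> u; apply: le_trans (ler_normB _ _) _; rewrite lerD2r.
have cst (k : R) : \int[leb]_(_ in `]a, b[) k = k * (b - a).
  by rewrite Rintegral_cst ?len//; exact: measurable_itv.
have mi : measurable `]a, b[%classic by exact: measurable_itv.
rewrite -(cst c) -RintegralB//.
apply: le_trans (le_normr_Rintegral _ _) _ => //.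
rewrite -(cst e); apply: le_Rintegral => //; first exact: integrable_norm.
Qed.

Lemma Rintegral_split (f : R -> R) (M a b c : R) : a <= b -> b <= c ->
  measurable_fun setT f -> (forall u, `|f u| <= M) ->
  \int[leb]_(u in `[a, c]) f u =
  \int[leb]_(u in `[a, b]) f u + \int[leb]_(u in `]b, c]) f u.
Proof.
move=> ab bc mf fM; apply/eqP; rewrite addrC -subr_eq; apply/eqP.
apply: Rintegral_itvB; rewrite ?bnd_simp//.
exact: (bounded_itv_integrable mf fM (@subset_refl _ _)).
Qed.

Lemma Rintegral_step (f : R -> R) (M : R) (n : nat) (c e : nat -> R) :
  measurable_fun setT f -> (forall u, `|f u| <= M) ->
  (forall k u, (k < n.+1)%N -> k%:R / n.+1%:R < u < k.+1%:R / n.+1%:R ->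
     `|f u - c k| <= e k) ->
  `|\int[leb]_(u in `[0, 1]) f u - n.+1%:R^-1 * \sum_(k < n.+1) c k|
  <= n.+1%:R^-1 * \sum_(k < n.+1) e k.
Proof.
move=> mf fM H; set N := n.+1%:R; have N0 : 0 < N by rewrite ltr0n.
suff : forall k, (k <= n.+1)%N ->
    `|\int[leb]_(u in `[0, (k%:R / N)]) f u - N^-1 * \sum_(j < k) c j|
     <= N^-1 * \sum_(j < k) e j.
  by move=> /(_ n.+1 (leqnn _)); rewrite divff ?gt_eqF.
elim=> [_|k IH kn].
  by rewrite mul0r set_itv1 Rintegral_set1 !big_ord0 mulr0 subrr normr0.
have kk : k%:R / N <= k.+1%:R / N by rewrite ler_pM2r ?invr_gt0// ler_nat.
have k0 : 0 <= k%:R / N by rewrite divr_ge0// ltW.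
have kd : k.+1%:R / N - k%:R / N = N^-1 by rewrite -mulrBl -natr1 addrAC subrr add0r mul1r.
rewrite (Rintegral_split k0 kk mf fM) !big_ord_recr /= !mulrDr opprD addrACA.
apply: le_trans (ler_normD _ _) _; apply: lerD; first by apply: IH; exact: ltnW.
have := Rintegral_itv_close kk mf fM (H k ^~ kn).
by rewrite kd !(mulrC N^-1).
Qed.

(** On each cell the error is at most [L] times the increase of [q], and these increases telescope.
    The rate depends on [q] only through its total increase. *)
Lemma monotone_riemann (phi q : R -> R) (L M : R) (n : nat) :
  {homo q : a b / a <= b} -> measurable_fun setT phi ->
  (forall s, `|phi s| <= M) -> (forall s u, `|phi s - phi u| <= L * `|s - u|) ->
  0 <= L ->
  `|\int[leb]_(u in `[0, 1]) phi (q u)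
    - n.+1%:R^-1 * \sum_(k < n.+1) phi (q (k%:R / n.+1%:R))|
  <= L * (q 1 - q 0) / n.+1%:R.
Proof.
move=> hq mphi phiM phiL L0; set N := n.+1%:R; have N0 : 0 < N by rewrite ltr0n.
have mf : measurable_fun setT (phi \o q).
  by apply: measurableT_comp => //; exact: nondecreasing_measurable.
pose e k := L * (q (k.+1%:R / N) - q (k%:R / N)).
have := @Rintegral_step (phi \o q) M n (fun k => phi (q (k%:R / N))) e mf
  (fun u => phiM (q u)).
rewrite -mulr_sumr -(big_mkord xpredT (fun k => q (k.+1%:R / N) - q (k%:R / N))).
rewrite (telescope_sumr (fun k => q (k%:R / N)))// divff ?gt_eqF// mul0r.
rewrite [leRHS]mulrC; apply => k u _ /andP[ku uk].
apply: le_trans (phiL _ _) _; rewrite ler_wpM2l//.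
by rewrite ger0_norm ?subr_ge0 ?lerD2r; apply: hq; exact: ltW.
Qed.

End lebesgue_estimates.

Lemma ultra_bounded_cvg (R : realType) (I : Type) (F : set_system I) (f : I -> R)
    (a b : R) : UltraFilter F -> F [set i | a <= f i <= b] ->
  exists2 c, a <= c <= b & forall e : R, 0 < e -> F [set i | `|f i - c| < e].
Proof.
move=> UF Fab; have FF : ProperFilter F by exact: ultra_proper.
have [|c [cab Hc]] := @segment_compact R a b (f @ F) _.
  by apply: (@filterS _ F _ [set i | a <= f i <= b]) Fab => i /= H; rewrite in_itv/=.
exists c; first by move: cab; rewrite /= in_itv.
move=> e e0; have [//|FC] := in_ultra_setVsetC [set i | `|f i - c| < e] UF.
have [|y [/= fy yc]] := Hc (~` [set y | `|y - c| < e]) (ball c e) _ (nbhsx_ballx _ _ e0).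
  exact: FC.
by case: fy; rewrite distrC.
Qed.

Section quantile_representation.
Context {R : realType} (l : R) (g : R -> R[i]).
Hypotheses (jg : jordan_arclength l g) (cg : C2 g).
Let l0 := jordan_length_gt0 jg.
Local Notation leb := (@lebesgue_measure R).

(* [m] is the image of the uniform law on [0, 1] by a nondecreasing map, at least
   as far as test functions can see. *)
Definition quantile_rep (m : prob R (curve g)) : Prop :=
  exists q : R -> R, [/\ {homo q : a b / a <= b}, forall u, 0 <= q u <= 2 * l &
    forall phi, C2per l phi ->
      pairing m (curve_fun jg phi) = \int[leb]_(u in `[0, 1]) phi (q u)].

Lemma C2per_continuous (phi : R -> R) : C2per l phi -> continuous phi.
Proof. by case=> _ d _ _; exact: derivable_continuous. Qed.

Lemma C2per_bounds (phi : R -> R) : C2per l phi -> exists2 M : R, 0 <= M &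
  (forall s, `|phi s| <= M) /\ forall s u, `|phi s - phi u| <= M * `|s - u|.
Proof.
move=> h; have [p d1 d2 c2] := h.
have [M1 M10 H1] := periodic_bounded l0 p (C2per_continuous h).
have [M2 M20 H2] := periodic_bounded l0 (deriv_periodic p) (derivable_continuous d2).
exists (M1 + M2); first exact: addr_ge0.
split; first by move=> s; apply: le_trans (H1 s) _; rewrite lerDl.
move=> s u; apply: le_trans (deriv_lipschitz d1 H2 s u) _.
by rewrite ler_wpM2r// lerDr.
Qed.

Lemma C2per_bounded_cont (phi : R -> R) : C2per l phi -> bounded_cont (curve_fun jg phi).
Proof.
move=> h; apply: curve_fun_continuous => //; first by case: h.
exact: C2per_continuous.
Qed.

(** [q] is the pointwise limit of the quantile functions along the ultrafilter. Integrals follow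
    because the Riemann sums of all these monotone functions converge at a common rate, which leaves
    finitely many points at which convergence is used. *)
Lemma quantile_ultra_limit (I : Type) (F : set_system I) (f : I -> prob R (curve g)) :
  UltraFilter F -> F [set i | quantile_rep (f i)] ->
  exists q : R -> R, [/\ {homo q : a b / a <= b}, forall u, 0 <= q u <= 2 * l &
    forall phi, C2per l phi -> forall e : R, 0 < e ->
      F [set i | `|pairing (f i) (curve_fun jg phi)
                   - \int[leb]_(u in `[0, 1]) phi (q u)| < e]].
Proof.
move=> UF FW; have FF : ProperFilter F by exact: ultra_proper.
pose qs i : R -> R := if pselect (quantile_rep (f i)) is left h
  then projT1 (cid h) else fun=> 0.
have qsP i : quantile_rep (f i) -> [/\ {homo qs i : a b / a <= b},
    forall u, 0 <= qs i u <= 2 * l & forall phi, C2per l phi ->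
      pairing (f i) (curve_fun jg phi) = \int[leb]_(u in `[0, 1]) phi (qs i u)].
  by rewrite /qs; case: pselect => // h _; exact: projT2 (cid h).
have lim u : exists c : R, 0 <= c <= 2 * l /\
    forall e : R, 0 < e -> F [set i | `|qs i u - c| < e].
  have [|c c1 c2] := @ultra_bounded_cvg _ _ F (fun i => qs i u) 0 (2 * l) UF.
    by apply: filterS FW => i /qsP[_ H _]; exact: H.
  by exists c.
have [q Hq] := choice lim.
have hq : {homo q : a b / a <= b}.
  move=> a b ab; rewrite leNgt; apply/negP => ba.
  have d0 : 0 < (q a - q b) / 2 by rewrite divr_gt0// subr_gt0.
  have Fa := (Hq a).2 _ d0; have Fb := (Hq b).2 _ d0.
  have [i [/qsP[hi _ _] /= [ha hb]]] := filter_ex (filterI FW (filterI Fa Fb)).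
  have := hi _ _ ab; move: ha hb; rewrite !ltr_norml; lra.
exists q; split => //; first by move=> u; exact: (Hq u).1.
move=> phi h e e0; have [M M0 [HM HL]] := C2per_bounds h.
have mphi : measurable_fun setT phi.
  exact: continuous_measurable_fun (C2per_continuous h).
(* Makes the Riemann error, at most [M * (2 * l) / n.+1], smaller than [e / 3]; it is the same for
   every quantile function. *)
pose n := Num.truncn (3 * (M * (2 * l)) / e).
have n0 : 0 < n.+1%:R :> R by rewrite ltr0n.
have Hn : M * (2 * l) / n.+1%:R < e / 3.
  have : 3 * (M * (2 * l)) / e < n.+1%:R by exact: truncnS_gt.
  rewrite !ltr_pdivrMr// => H; lra.
have riem (p : R -> R) : {homo p : a b / a <= b} -> (forall u, 0 <= p u <= 2 * l) ->
  `|\int[leb]_(u in `[0, 1]) phi (p u)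
    - n.+1%:R^-1 * \sum_(k < n.+1) phi (p (k%:R / n.+1%:R))| < e / 3.
  move=> hp bp; apply: le_lt_trans (monotone_riemann n hp mphi HM HL M0) _.
  apply: le_lt_trans Hn; rewrite ler_pM2r ?invr_gt0// ler_wpM2l//.
  have /andP[_ +] := bp 1; have /andP[+ _] := bp 0; lra.
(* The added [1] covers the case [M = 0]. *)
pose d := e / (3 * (M + 1)).
have d0 : 0 < d by rewrite divr_gt0// mulr_gt0// ltr_wpDl.
have Md : M * d < e / 3.
  rewrite /d mulrA ltr_pdivrMr ?mulr_gt0 ?ltr_wpDl//.
  have -> : e / 3 * (3 * (M + 1)) = M * e + e by field.
  by rewrite ltrDl.
have FN : F [set i | forall k : 'I_n.+1, `|qs i (k%:R / n.+1%:R) - q (k%:R / n.+1%:R)| < d].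
  by apply: filter_forall => k; exact: (Hq _).2.
apply: filterS (filterI FW FN) => i /= [/qsP[hi bi ->] // near_k].
have R1 := riem _ hi bi; have R2 := riem q hq (fun u => (Hq u).1).
have R3 : `|n.+1%:R^-1 * \sum_(k < n.+1) phi (qs i (k%:R / n.+1%:R))
   - n.+1%:R^-1 * \sum_(k < n.+1) phi (q (k%:R / n.+1%:R))| <= M * d.
  rewrite -mulrBr -sumrB normrM ger0_norm ?invr_ge0 ?ler0n//.
  rewrite ler_pdivrMl//; apply: le_trans (ler_norm_sum _ _ _) _.
  have -> : n.+1%:R * (M * d) = \sum_(k < n.+1) (M * d).
    by rewrite sumr_const card_ord mulr_natl.
  apply: ler_sum => k _.
  apply: le_trans (HL _ _) _; rewrite ler_wpM2l//; exact/ltW/near_k.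
move: R1 R2 R3; rewrite !ltr_norml ler_norml.
set A := Rintegral _ _ _; set B := Rintegral _ _ _.
set C := n.+1%:R^-1 * \sum_(k < n.+1) phi (qs i _).
set D := n.+1%:R^-1 * \sum_(k < n.+1) phi (q _).
move: Md; set E := M * d; lra.
Qed.

(** The measure is the law of [on_curve g (q u)] for [u] uniform on the unit interval. *)
Lemma quantile_prob (q : R -> R) : {homo q : a b / a <= b} ->
  (forall u, 0 <= q u <= 2 * l) ->
  exists nu : prob R (curve g), forall phi, C2per l phi ->
    pairing nu (curve_fun jg phi) = \int[leb]_(u in `[0, 1]) phi (q u).
Proof.
move=> hq bq.
have mq : measurable_fun setT q by exact: nondecreasing_measurable.
pose f : R -> borel (curve g) := fun u => on_curve g (q u).
have mf : measurable_fun setT f.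
  apply: (@measurability _ _ _ (borel (curve g)) setT f (@open (curve g)) erefl) => _ [U oU <-]; rewrite setTI.
  have -> : f @^-1` U = q @^-1` (on_curve g @^-1` U) by [].
  rewrite -[X in measurable X]setTI; apply: mq => //.
  apply: open_measurable; move/continuousP : (on_curve_continuous jg cg); exact.
have mf' : @measurable_fun _ _ (measurableTypeR R) (borel (curve g)) setT f := mf.
pose X : {mfun measurableTypeR R >-> borel (curve g)} :=
  MeasurableFun.Pack (MeasurableFun.Class (isMeasurableFun.Build _ _ _ _ _ mf')).
pose nu : prob R (curve g) := distribution (uniform_prob (@ltr01 R)) X.
exists nu => phi h.
have pos (psi : R -> R) : C2per l psi -> (forall s, 0 <= psi s) ->
    pairing nu (curve_fun jg psi) = \int[leb]_(u in `[0, 1]) psi (q u).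
  move=> hpsi psi0; rewrite /pairing /Rintegral; congr fine.
  have mpsi : measurable_fun setT psi.
    exact: continuous_measurable_fun (C2per_continuous hpsi).
  rewrite /nu ge0_integral_distribution; last 2 first.
  - apply/measurable_EFinP; apply: continuous_borel_measurable.
    by case: (C2per_bounded_cont hpsi).
  - by move=> z; rewrite lee_fin; exact: psi0.
  rewrite integral_uniform; last 2 first.
  - apply/measurable_EFinP.
    rewrite (_ : (fun u => _) = psi \o q); first exact: measurableT_comp.
    by apply/funext => u /=; rewrite /f curve_fun_on//; case: hpsi.
  - by move=> u; rewrite lee_fin; exact: psi0.
  rewrite subr0 invr1 mul1e; apply: eq_integral => u _ /=.
  by rewrite curve_fun_on//; case: hpsi.
have [M M0 [HM HL]] := C2per_bounds h.
(* The image-measure formula is used for nonnegative functions, hence the shift by the bound of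
   [phi]. *)
pose psi s := phi s + M.
have hpsi : C2per l psi.
  have [p d1 d2 c2] := h.
  have D (s : R) : is_derive s 1 psi (rderiv phi s + 0).
    by apply: is_deriveD; exact: is_derive_deriv.
  have E : rderiv psi = rderiv phi.
    by apply/funext => s; rewrite (deriv_val (D s)) addr0.
  split; [by move=> s; rewrite /psi p|by move=> s; case: (D s)|by rewrite E|by rewrite E].
have psi0 s : 0 <= psi s by have := HM s; rewrite /psi ler_norml => /andP[]; lra.
have E : phi = (fun s => psi s - M) by apply/funext => s; rewrite /psi addrK.
transitivity (pairing nu (curve_fun jg psi) - M).
  rewrite {1}E -{2}(pairing_cst nu M) -pairingB//; first exact: C2per_bounded_cont.
  exact: bounded_cont_cst.
rewrite pos// {1}/psi.
have mphi : measurable_fun setT phi.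
  exact: continuous_measurable_fun (C2per_continuous h).
have mphiq : measurable_fun setT (phi \o q) by exact: measurableT_comp.
rewrite RintegralD//; last 2 first.
- apply: (@bounded_itv_integrable _ (phi \o q) M _ 0 1) => //.
  by move=> u; exact: HM.
- apply: (@bounded_itv_integrable _ (fun=> M) `|M| _ 0 1) => //.
have -> : \int[leb]_(_ in `[0, 1]) M = M.
  rewrite Rintegral_cst; last exact: measurable_itv.
  rewrite [X in fine X](_ : _ = 1%E) ?mulr1//.
  by rewrite /= lebesgue_measure_itv /= lte_fin ltr01 -EFinB subr0.
by rewrite addrK.
Qed.

(** The quantile function of an empirical measure is the step function through its sorted atoms,
    with parameters first reduced to one period. *)
Lemma quantile_empirical (n : nat) (x : 'I_n.+1 -> R) :
  quantile_rep (empirical (fun i => on_curve g (x i))).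
Proof.
have [k Hk] := choice (fun i => shift_itv l0 0 (x i)).
pose r i := x i + (k i)%:~R * l.
pose s := sort <=%R [seq r i | i <- enum 'I_n.+1].
have sz : size s = n.+1 by rewrite size_sort size_map size_enum_ord.
have mem_s a : a \in s -> 0 <= a <= l.
  rewrite mem_sort => /mapP[i _ ->]; have := Hk i.
  by rewrite add0r => /andP[-> /ltW].
have ss : sorted <=%R s by apply: sort_sorted; exact: le_total.
pose N : R := n.+1%:R; have N0 : 0 < N by rewrite ltr0n.
(* The default [l] dominates all sorted values, so [q] stays nondecreasing past [u = 1]; negative
   [u] are sent to index [0]. *)
pose q u := nth l s (Num.truncn (u * N)).
have bq u : 0 <= q u <= l.
  rewrite /q; have [h|h] := ltnP (Num.truncn (u * N)) (size s).
    by apply: mem_s; exact: mem_nth.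
  by rewrite nth_default// lexx ltW.
have hq : {homo q : a b / a <= b}.
  move=> a b ab; have tab : (Num.truncn (a * N) <= Num.truncn (b * N))%N.
    by apply: le_truncn; rewrite ler_pM2r.
  have [h|h] := ltnP (Num.truncn (b * N)) (size s).
    rewrite /q; apply: (sorted_leq_nth le_trans le_refl) => //.
    by rewrite inE; exact: leq_ltn_trans tab h.
  by rewrite [leRHS]/q nth_default//; case/andP: (bq a).
exists q; split => //.
  by move=> u; have /andP[-> h] := bq u; apply: le_trans h _; move: l0; lra.
move=> phi h; rewrite pairing_empirical; last exact: C2per_bounded_cont.
have [M M0 [HM HL]] := C2per_bounds h.
have mphiq : measurable_fun setT (phi \o q).
  apply: measurableT_comp; last exact: nondecreasing_measurable.
  exact: continuous_measurable_fun (C2per_continuous h).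
have := @Rintegral_step _ (phi \o q) M n (fun k => phi (nth l s k)) (fun=> 0) mphiq
  (fun u => HM (q u)).
have Z : \sum_(k0 < n.+1) (0 : R) = 0 by rewrite big1.
rewrite Z mulr0 normr_le0 subr_eq0 => H.
rewrite (eqP (H _)) => [|j u jn /andP[ju uj]].
  have -> : \sum_(k0 < n.+1) phi (nth l s k0) = \sum_(a <- s) phi a.
    by rewrite (big_nth l) big_mkord sz.
  congr (_ * _); rewrite (perm_big [seq r i | i <- enum 'I_n.+1]); last by rewrite perm_sort.
  rewrite big_map big_enum; apply: eq_big => // i _.
  have [p _ _ _] := h.
  by rewrite curve_fun_on// /r (periodic_int p).
rewrite /= /q (_ : Num.truncn _ = j) ?subrr ?normr0//.
apply: truncn_def; apply/andP; split.
  by rewrite -ler_pdivrMr// ltW.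
by rewrite -ltr_pdivlMr.
Qed.

End quantile_representation.

Lemma ler_dist3 (R : realDomainType) (a b c d x y z : R) :
  `|a - b| <= x -> `|b - c| <= y -> `|c - d| <= z -> `|a - d| <= x + y + z.
Proof. by rewrite !ler_norml; lra. Qed.

(** Composition with [clamp T] freezes a path outside [[0, T]], so that continuity within the
    interval becomes continuity on the line. *)
Definition clamp (R : realType) (T t : R) : R := Num.max 0 (Num.min T t).

Section clamp.
Context {R : realType} (T : R) (T0 : 0 <= T).

Lemma clamp_itv t : 0 <= clamp T t <= T.
Proof. by rewrite /clamp le_max lexx /= ge_max T0 ge_min lexx. Qed.

Lemma clamp_id t : 0 <= t <= T -> clamp T t = t.
Proof. by move=> /andP[t0 tT]; rewrite /clamp (min_idPr tT) (max_idPr t0). Qed.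

Lemma clamp_dist s t : `|clamp T s - clamp T t| <= `|s - t|.
Proof.
wlog st : s t / s <= t.
  by move=> H; case: (leP s t) => [/H//|/ltW/H]; rewrite distrC (distrC t).
rewrite distrC (distrC s) (@ger0_norm _ (t - s)) ?subr_ge0// /clamp.
have H u : [\/ u <= 0 /\ Num.max 0 (Num.min T u) = 0,
    (0 <= u <= T) /\ Num.max 0 (Num.min T u) = u | T <= u /\ Num.max 0 (Num.min T u) = T].
  have [u0|u0] := leP u 0.
    by constructor 1; rewrite (min_idPr (le_trans u0 T0)) (max_idPl u0).
  have [uT|uT] := leP u T.
    by constructor 2; rewrite (max_idPr (ltW u0)) (ltW u0).
  by constructor 3; rewrite (max_idPr T0) (ltW uT).
rewrite ler_norml; move: T0 st.
by case: (H s) => -[? ->]; case: (H t) => -[? ->]; lra.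
Qed.

Lemma within_itvP (f : R -> R) :
  (forall e : R, 0 < e -> exists2 d : R, 0 < d & forall s t, 0 <= s <= T -> 0 <= t <= T ->
     `|s - t| < d -> `|f s - f t| <= e) ->
  {within `[0, T], continuous f}.
Proof.
move=> H; apply: (@subspace_eq_continuous _ _ _ (f \o clamp T)).
  by move=> t; rewrite inE/= in_itv/= => /clamp_id ->.
apply: continuous_subspaceT => t; apply/cvgrPdist_le => e e0.
have [d d0 Hd] := H e e0; exists d => //= s ts.
by apply: Hd; rewrite ?clamp_itv//; exact: le_lt_trans (clamp_dist _ _) ts.
Qed.

End clamp.

(** * Arzelà-Ascoli for paths of measures, by ultrafilters *)

Section path_compactness.
Context {R : realType} (l : R) (g : R -> R[i]).
Hypotheses (jg : jordan_arclength l g) (cg : C2 g).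
Let l0 := jordan_length_gt0 jg.
Variables (T : R) (T0 : 0 < T) (D : nat -> R -> R) (delta : nat -> nat -> R).
Hypothesis DC2 : forall k, C2per l (D k).
Hypothesis Ddense : forall h : R -> R, (forall s, h (s + l) = h s) -> continuous h ->
  forall e : R, 0 < e -> exists k, forall s, `|h s - D k s| <= e.
Hypothesis delta0 : forall k j, 0 < delta k j.
Local Notation path := (paths (curve g) T).
Local Notation "m << f >>" := (pairing m (curve_fun jg f)) (at level 10, f at level 99).

Definition equicontinuous_at_scale (p : R -> prob R (curve g)) : Prop :=
  forall k j s t, 0 <= s <= T -> 0 <= t <= T -> `|s - t| < delta k j ->
    `|(p s) << D k >> - (p t) << D k >>| <= j.+1%:R^-1.

(** The compact sets used for tightness: a modulus of continuity is prescribed for each function of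
    a countable dense family, and the values lie in the compact set of measures with a quantile
    representation. *)
Definition path_moduli : set path :=
  [set p | (forall t, 0 <= t <= T -> quantile_rep jg (p t)) /\ equicontinuous_at_scale p].

Lemma curve_dense (H : curve g -> R) (e : R) : bounded_cont H -> 0 < e ->
  exists k, forall m : prob R (curve g), `|pairing m H - m << D k >>| <= e.
Proof.
move=> h e0; have [cH _] := h.
have [||k Hk] := @Ddense (H \o on_curve g) _ _ e e0.
- by move=> s; rewrite /comp (on_curve_periodic jg).
- by move=> s; apply: continuous_comp; [exact: (on_curve_continuous jg cg)|exact: cH].
exists k => m; apply: pairing_dist => //; first exact: C2per_bounded_cont.
by move=> z; have := Hk (curve_param jg z); rewrite /=; have [_ ->] := curve_paramP jg z.
Qed.

(** The scale [d] is the same for all paths with the prescribed moduli: an arbitrary test function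
    is replaced by some [D k] at a cost of [e / 3] at each of the two times. *)
Lemma path_moduli_equicontinuous (H : curve g -> R) (e : R) : bounded_cont H -> 0 < e ->
  exists2 d : R, 0 < d & forall p s t, equicontinuous_at_scale p ->
    0 <= s <= T -> 0 <= t <= T -> `|s - t| < d ->
    `|pairing (p s) H - pairing (p t) H| <= e.
Proof.
move=> h e0; have e30 : 0 < e / 3 by rewrite divr_gt0.
have [k Hk] := curve_dense h e30.
pose j := Num.truncn (3 / e).
have Hj : j.+1%:R^-1 <= e / 3.
  have := truncnS_gt (3 / e); rewrite -/j => H'.
  by rewrite -[e / 3]invrK lef_pV2 ?posrE ?invr_gt0// invf_div ltW.
exists (delta k j) => // p s t ep sT tT st.
have H1 := Hk (p s); have H2 := le_trans (ep k j s t sT tT st) Hj.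
have := Hk (p t); rewrite distrC => H3.
by have := ler_dist3 H1 H2 H3; rewrite (_ : e / 3 + e / 3 + e / 3 = e)//; field.
Qed.

Lemma path_moduli_continuous : path_moduli `<=` @continuous_paths R (curve g) T.
Proof.
move=> p [_ ep]; apply: continuous_pathsP => H h; apply: within_itvP; first exact: ltW.
move=> e e0; have [d d0 Hd] := path_moduli_equicontinuous h e0.
by exists d => // s t sT tT; exact: Hd.
Qed.

Lemma equicontinuous_limit (F : set_system path) (p : path) : ProperFilter F ->
  F path_moduli ->
  (forall t, 0 <= t <= T -> forall k (e : R), 0 < e ->
    F [set q : path | `|(q t) << D k >> - (p t) << D k >>| < e]) ->
  equicontinuous_at_scale p.
Proof.
move=> FF FK Fp k j s t sT tT st; apply/ler_addgt0Pr => e e0.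
have e20 : 0 < e / 2 by rewrite divr_gt0.
have F1 := Fp s sT k _ e20; have F2 := Fp t tT k _ e20.
have [q [[_ eq] /= [q1 q2]]] := filter_ex (filterI FK (filterI F1 F2)).
rewrite distrC in q1; have := ler_dist3 (ltW q1) (eq k j s t sT tT st) (ltW q2).
by rewrite (_ : e / 2 + j.+1%:R^-1 + e / 2 = j.+1%:R^-1 + e)//; field.
Qed.

(** The moduli are closed conditions. For the quantile representation, the filter converging to [p]
    is refined to an ultrafilter; its limiting quantile function must represent [p t], as limits of
    pairings are unique. *)
Lemma path_moduli_closed : closed path_moduli.
Proof.
move=> p; rewrite closureEcvg => -[G GP [Gp GK]].
have [F [UF GF]] := ultraFilterLemma GP.
have FF : ProperFilter F by exact: ultra_proper.
have FK : F path_moduli by apply/GF/GK.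
have Fp : forall t, 0 <= t <= T -> forall phi, C2per l phi -> forall e : R, 0 < e ->
    F [set q : path | `|(q t) << phi >> - (p t) << phi >>| < e].
  move=> t tT phi h e e0; apply/GF/Gp.
  have := paths_nbhs p (C2per_bounded_cont jg cg h) e0; apply: filterS => q /(_ t).
  by rewrite /= in_itv/= distrC; exact.
split; last by apply: (equicontinuous_limit FF FK) => t tT k e; exact: Fp.
move=> t tT.
have FW : F [set q : path | quantile_rep jg (q t)].
  by apply: filterS FK => q [h _]; exact: h.
have [u [u1 u2 u3]] := quantile_ultra_limit UF FW.
exists u; split => // phi h; apply/eqP; rewrite -subr_eq0 -normr_le0.
apply/ler_addgt0Pr => e e0; rewrite add0r.
have e20 : 0 < e / 2 by rewrite divr_gt0.
have [q [/= q1 q2]] := filter_ex (filterI (u3 _ h _ e20) (Fp t tT _ h _ e20)).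
rewrite distrC in q2; apply: le_trans (ler_distD ((q t) << phi >>) _ _) _.
by rewrite [leRHS]splitr; exact: lerD (ltW q2) (ltW q1).
Qed.

(** At each time the ultrafilter has a limiting quantile function, hence a limiting measure. The
    common moduli upgrade this pointwise convergence to uniform convergence, through a finite time
    grid. *)
Lemma path_moduli_compact : compact path_moduli.
Proof.
rewrite compact_ultra => F UF FK; have FF : ProperFilter F by exact: ultra_proper.
have ex t : exists nu : prob R (curve g), 0 <= t <= T -> quantile_rep jg nu /\
    forall phi, C2per l phi -> forall e : R, 0 < e ->
    F [set q : path | `|(q t) << phi >> - nu << phi >>| < e].
  case: (boolP (0 <= t <= T)) => tT; last by exists (empirical (fun _ : 'I_1 => on_curve g 0)).
  have FW : F [set q : path | quantile_rep jg (q t)].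
    by apply: filterS FK => q [h _]; exact: h.
  have [u [u1 u2 u3]] := quantile_ultra_limit UF FW.
  have [nu Hnu] := quantile_prob jg cg u1 u2.
  exists nu => _; split; first by exists u.
  by move=> phi h e e0; rewrite Hnu//; exact: u3.
have [p Hp] := choice ex.
have ep : equicontinuous_at_scale p.
  apply: (@equicontinuous_limit F p FF FK) => t tT k e.
  by have [_ H] := Hp t tT; exact: H.
exists p; split; first by split => // t /Hp[].
apply: paths_cvgP => H h e e0.
(* Five errors of [e / 6] are added: one time shift for each of [p] and [q], two replacements of [H]
   by [D k], and the convergence at the grid point. The total stays strictly below [e]. *)
have e60 : 0 < e / 6 by rewrite divr_gt0.
have [d d0 Hd] := path_moduli_equicontinuous h e60.
have [k Hk] := curve_dense h e60.
pose n := Num.truncn (T / d).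
have n0 : 0 < n.+1%:R :> R by rewrite ltr0n.
have Tn : T / n.+1%:R < d.
  have := truncnS_gt (T / d); rewrite -/n ltr_pdivrMr// => H'.
  by rewrite ltr_pdivrMr// mulrC.
have grid (i : 'I_n.+1) : 0 <= i%:R * (T / n.+1%:R) <= T.
  apply/andP; split; first by rewrite mulr_ge0// divr_ge0// ltW.
  by rewrite mulrA ler_pdivrMr// mulrC ler_pM2l// ler_nat ltnW.
have FN : F [set q : path | forall i : 'I_n.+1,
    `|(q (i%:R * (T / n.+1%:R))) << D k >> - (p (i%:R * (T / n.+1%:R))) << D k >>| < e / 6].
  by apply: filter_forall => i; have [_ H'] := Hp _ (grid i); exact: H'.
apply: filterS (filterI FK FN) => q [[_ eq] Hq] t; rewrite /= in_itv/= => tT.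
have [t0 tT'] := andP tT.
have [i it] : exists i : 'I_n.+1, `|t - i%:R * (T / n.+1%:R)| < d.
  have h0 : 0 < T / n.+1%:R by rewrite divr_gt0.
  have [tn|tn] := ltP (Num.truncn (t / (T / n.+1%:R)))%:R (n.+1%:R : R).
    rewrite ltr_nat in tn; exists (Ordinal tn) => /=.
    have q0 : 0 <= t / (T / n.+1%:R) by rewrite divr_ge0// ltW.
    have /andP[h1 h2] := truncn_itv q0.
    rewrite ler_pdivlMr// in h1; rewrite ltr_pdivrMr// -natr1 mulrDl mul1r in h2.
    by rewrite ger0_norm ?subr_ge0//; apply: lt_trans Tn; rewrite ltrBlDl.
  exists ord_max => /=.
  have q0 : 0 <= t / (T / n.+1%:R) by rewrite divr_ge0// ltW.
  have /andP[h1 _] := truncn_itv q0.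
  have h3 := le_trans tn h1; rewrite ler_pdivlMr// in h3.
  have E : n.+1%:R * (T / n.+1%:R) = T by rewrite mulrC divfK// gt_eqF.
  have E' : n%:R * (T / n.+1%:R) = T - T / n.+1%:R.
    by rewrite -{2}E -(natr1 n) [in RHS]mulrDl mul1r natr1 addrK.
  rewrite E in h3; have -> : t = T by apply/le_anti; rewrite tT' h3.
  by rewrite E' opprB addrC subrK ger0_norm// ltW.
have p1 := Hd p t _ ep tT (grid i) it; have q1 := Hd q t _ eq tT (grid i) it.
have p2 := Hk (p (i%:R * (T / n.+1%:R))); have q2 := Hk (q (i%:R * (T / n.+1%:R))).
have m := ltW (Hq i); rewrite distrC in m; rewrite distrC in q1; rewrite distrC in q2.
have {}m := ler_dist3 p2 m q2.
apply: le_lt_trans (ler_dist3 p1 m q1) _.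
by move: e0; lra.
Qed.

End path_compactness.

(** * Separability of the periodic C2 functions *)

Section box_average.
Context {R : realType} (l : R).
Hypothesis l0 : 0 < l.
Local Notation leb := (@lebesgue_measure R).
Implicit Types h : R -> R.

Definition box_average (d : R) h (s : R) : R :=
  d^-1 * \int[leb]_(u in `]s, s + d]) h u.

Lemma box_average_close h (d M c e s : R) : 0 < d -> continuous h ->
  (forall u, `|h u| <= M) -> (forall u, s < u < s + d -> `|h u - c| <= e) ->
  `|box_average d h s - c| <= e.
Proof.
move=> d0 ch hM hc.
have sd : s <= s + d by rewrite lerDl ltW.
have mh : measurable_fun setT h by exact: continuous_measurable_fun.
have := Rintegral_itv_close sd mh hM hc; rewrite addrAC subrr add0r => H.
rewrite /box_average -[c](@mulKf _ d) ?gt_eqF// -mulrBr normrM gtr0_norm ?invr_gt0//.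
by rewrite ler_pdivrMl// [d * c]mulrC [d * e]mulrC.
Qed.

Lemma box_average_periodic h (d : R) : 0 < d -> continuous h ->
  (forall s, h (s + l) = h s) -> forall s, box_average d h (s + l) = box_average d h s.
Proof.
move=> d0 ch ph s; rewrite /box_average; congr (_ * _).
have sd : s < s + d by rewrite ltrDl.
have mh : measurable_fun setT h by exact: continuous_measurable_fun.
have [M M0 hM] := periodic_bounded l0 ph ch.
have dF : derive1 (fun t : R => t + l) = cst 1.
  apply/funext => t; rewrite derive1E; have H : is_derive t 1 (fun t : R => t + l) 1.
    by apply: is_derive_eq; rewrite addr0.
  by rewrite derive_val.
rewrite !Rintegral_itv_obnd_cbnd//; last 2 first.
  exact: (bounded_itv_integrable mh hM (@subset_itv_oc_cc _ _ _ _)).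
  exact: (bounded_itv_integrable mh hM (@subset_itv_oc_cc _ _ _ _)).
rewrite addrAC /Rintegral; congr fine.
rewrite (@integration_by_substitution_increasing R (fun t => t + l)) ?dF.
- by apply: eq_integral => x _; congr EFin; rewrite -[RHS]mulr1 -[in RHS]ph.
- exact: ltW.
- by move=> x y _ _; rewrite ltrD2r.
- by move=> x _; exact: cvg_cst.
- exact: is_cvg_cst.
- exact: is_cvg_cst.
- have cF : continuous (fun t : R => t + l).
    by move=> t; apply: cvgD; [exact: cvg_id|exact: cvg_cst].
  split.
  + by move=> t _; apply/ex_derive.
  + by apply: cvg_at_right_filter; exact: cF.
  + by apply: cvg_at_left_filter; exact: cF.
- exact: continuous_subspaceT.
Qed.

(** Fundamental theorem of calculus, applied to an antiderivative based at [s - 1] so that both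
    endpoints of the window stay to the right of the base point. *)
Lemma is_derive_box_average h (d s : R) : 0 < d -> continuous h ->
  (forall s, h (s + l) = h s) ->
  is_derive s 1 (box_average d h) (d^-1 * (h (s + d) - h s)).
Proof.
move=> d0 ch ph; have [M M0 hM] := periodic_bounded l0 ph ch.
have mh : measurable_fun setT h by exact: continuous_measurable_fun.
pose F t := \int[leb]_(u in `[s - 1, t]) h u.
have dF t : s - 1 < t -> is_derive t 1 F (h t).
  move=> st; have [||||dF Fh] := @continuous_FTC1 R h (BLeft (s - 1)) t (t + 1).
  - by rewrite ltrDl.
  - exact: (bounded_itv_integrable mh hM (@subset_refl _ _)).
  - by rewrite lte_fin.
  - exact: ch.
  by apply: DeriveDef; [exact: dF|rewrite -derive1E; exact: Fh].
have H1 : is_derive s 1 F (h s) by apply: dF; rewrite ltrBlDr ltrDl.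
have H2 : is_derive (s + d) 1 F (h (s + d)).
  by apply: dF; rewrite ltrBlDr -addrA ltrDl addr_gt0.
have H3 : is_derive s 1 (fun t => F (t + d)) (h (s + d)).
  have Hs : is_derive s 1 (fun t : R => t + d) 1.
    by apply: is_derive_eq; rewrite addr0.
  have := @is_derive1_comp R F (fun t => t + d) s (h (s + d)) 1 H2 Hs.
  by rewrite /GRing.scale/= mulr1; exact.
have H4 := is_deriveZ d^-1 (is_deriveB H3 H1).
apply: (@near_eq_is_derive _ _ _ (fun t => d^-1 *: (F (t + d) - F t))) => //.
near=> t.
have st : s - 1 <= t.
  by apply: ltW; near: t; apply: lt_nbhsr; rewrite ltrBlDr ltrDl.
rewrite /box_average /F (@Rintegral_split _ h M (s - 1) t (t + d))//; last first.
  by rewrite lerDl ltW.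
by rewrite addrAC subrr add0r.
Unshelve. all: by end_near. Qed.

Lemma box_average_continuous h (d : R) : 0 < d -> continuous h ->
  (forall s, h (s + l) = h s) -> continuous (box_average d h).
Proof.
move=> d0 ch ph; apply: derivable_continuous => s.
by have [] := is_derive_box_average s d0 ch ph.
Qed.

(** Each box average gains one derivative and moves the function by at most its oscillation over the
    window; two averages give a C2 function. *)
Lemma C2per_dense h (e : R) : (forall s, h (s + l) = h s) -> continuous h -> 0 < e ->
  exists2 phi, C2per l phi & forall s, `|h s - phi s| <= e.
Proof.
move=> ph ch e0; have e20 : 0 < e / 2 by rewrite divr_gt0.
have [d d0 Hd] := periodic_ucont l0 ph ch e20.
have [M M0 hM] := periodic_bounded l0 ph ch.
pose h1 := box_average d h; pose h2 := box_average d h1.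
have p1 := box_average_periodic d0 ch ph; have c1 := box_average_continuous d0 ch ph.
have c2 := box_average_continuous d0 c1 p1.
have p2 := box_average_periodic d0 c1 p1.
have D2 (s : R) := is_derive_box_average s d0 c1 p1.
have D1 (s : R) := is_derive_box_average s d0 ch ph.
have r2 : rderiv h2 = fun s => d^-1 * (h1 (s + d) - h1 s).
  by apply/funext => s; exact/deriv_val.
have D1' (s : R) : is_derive s 1 (fun s : R => h1 (s + d)) (d^-1 * (h (s + d + d) - h (s + d))).
  have Hs : is_derive s 1 (fun t : R => t + d) 1 by apply: is_derive_eq; rewrite addr0.
  have := @is_derive1_comp R h1 (fun t => t + d) s _ 1 (D1 (s + d)) Hs.
  by rewrite /GRing.scale/= mulr1; exact.
have D3 (s : R) := is_deriveZ d^-1 (is_deriveB (D1' s) (D1 s)).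
have r3 : rderiv (rderiv h2) = fun s => d^-1 *
    (d^-1 * (h (s + d + d) - h (s + d)) - d^-1 * (h (s + d) - h s)).
  by rewrite r2; apply/funext => s; apply: deriv_val; exact: D3.
exists h2.
  split; [exact: p2|by move=> s; have [] := D2 s|by rewrite r2 => s; have [] := D3 s|].
  rewrite r3 => s; have cs : continuous (fun s : R => s + d).
    by move=> t; apply: cvgD; [exact: cvg_id|exact: cvg_cst].
  have c' : continuous (fun s => h (s + d)).
    by move=> t; apply: (@continuous_comp _ _ _ (fun s => s + d) h); [exact: cs|exact: ch].
  have c'' : continuous (fun s => h (s + d + d)).
    move=> t; apply: (@continuous_comp _ _ _ (fun s => s + d) (fun s => h (s + d))).
      exact: cs.
    exact: c'.
  apply: cvgM; first exact: cvg_cst.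
  by apply: cvgB; (apply: cvgM; [exact: cvg_cst|apply: cvgB]);
    [exact: c''|exact: c'|exact: c'|exact: ch].
have near1 c u : c < u < c + d -> `|h u - h c| < e / 2.
  by move=> /andP[u1 u2]; apply: Hd; rewrite gtr0_norm ?subr_gt0//; lra.
have B1 u : `|h1 u - h u| <= e / 2.
  by apply: (box_average_close d0 ch hM) => v /near1/ltW.
have h1M u : `|h1 u| <= M.
  by rewrite -[h1 u]subr0; apply: (box_average_close d0 ch hM) => v _; rewrite subr0.
move=> s; rewrite distrC; apply: (box_average_close d0 c1 h1M) => u /near1/ltW su.
apply: le_trans (ler_distD (h u) _ _) _; rewrite [leRHS]splitr; exact: lerD.
Qed.

End box_average.

Section separability.
Context {R : realType} (l : R).
Hypothesis l0 : 0 < l.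

Definition mesh (m i : nat) : R := i%:R * (l / m.+1%:R).

(** A function is described up to [1 / n.+1] by finitely many rationals: entries [0] to [m] of [v]
    approximate [phi''] on the mesh, entry [m.+1] approximates [phi 0]. The last clause says that
    the mesh resolves [phi'']. *)
Definition near_code (n m : nat) (v : seq rat) (phi : R -> R) : Prop :=
  [/\ C2per l phi, `|phi 0 - ratr (nth 0 v m.+1)| <= n.+1%:R^-1,
      forall i, (i < m.+1)%N ->
        `|rderiv (rderiv phi) (mesh m i) - ratr (nth 0 v i)| <= n.+1%:R^-1 &
      forall s t, `|s - t| <= l / m.+1%:R ->
        `|rderiv (rderiv phi) s - rderiv (rderiv phi) t| <= n.+1%:R^-1].

(** From one function to the other through a mesh point there are four errors: two oscillations of
    the second derivative and two roundings to the code. *)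
Lemma near_code_close n m v phi psi : near_code n m v phi -> near_code n m v psi ->
  `|phi 0 - psi 0| <= 2 / n.+1%:R /\
  forall s, `|rderiv (rderiv phi) s - rderiv (rderiv psi) s| <= 4 / n.+1%:R.
Proof.
move=> [C1 a1 b1 c1] [C2 a2 b2 c2]; split.
  apply: le_trans (ler_distD (ratr (nth 0 v m.+1)) _ _) _.
  by rewrite [X in _ + X]distrC mulrDl mul1r; exact: lerD.
move=> s; have [k /andP[k1 k2]] := shift_itv l0 0 s.
have [_ _ _ _] := C1.
have per f : C2per l f -> rderiv (rderiv f) s = rderiv (rderiv f) (s + k%:~R * l).
  by move=> [p _ _ _]; rewrite (periodic_int (deriv_periodic (deriv_periodic p))).
rewrite !per//; set t := s + _ in k1 k2 *.
have h0 : 0 < l / m.+1%:R by rewrite divr_gt0.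
have q0 : 0 <= t / (l / m.+1%:R) by rewrite divr_ge0// ltW.
have /andP[h1 h2] := truncn_itv q0; set i := Num.truncn _ in h1 h2.
rewrite ler_pdivlMr// in h1; rewrite ltr_pdivrMr// -natr1 mulrDl mul1r in h2.
have im : (i < m.+1)%N.
  rewrite -(ltr_nat R) -(ltr_pM2r h0); apply: le_lt_trans h1 _.
  by rewrite [ltRHS]mulrC divfK ?pnatr_eq0//; rewrite add0r in k2.
have ti : `|t - mesh m i| <= l / m.+1%:R.
  by rewrite ger0_norm ?subr_ge0// lerBlDl ltW.
have A := c2 _ _ ti; have B := b2 i im; have C := c1 _ _ ti; have E := b1 i im.
rewrite distrC in A; rewrite distrC in B.
apply: le_trans (ler_distD (rderiv (rderiv phi) (mesh m i)) _ _) _.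
apply: le_trans (lerD C (ler_dist3 E B A)) _.
by rewrite le_eqVlt; apply/orP; left; apply/eqP; ring.
Qed.

Lemma near_code_exists n phi : C2per l phi -> exists m v, near_code n m v phi.
Proof.
move=> h; have [p d1 d2 c2] := h.
have n0 : 0 < n.+1%:R^-1 :> R by rewrite invr_gt0.
have [d d0 Hd] := periodic_ucont l0 (deriv_periodic (deriv_periodic p)) c2 n0.
pose m := Num.truncn (l / d).
have lm : l / m.+1%:R < d.
  have := truncnS_gt (l / d); rewrite -/m ltr_pdivrMr// => H'.
  by rewrite ltr_pdivrMr// mulrC.
have near_rat (x : R) : exists q : rat, `|x - ratr q| <= n.+1%:R^-1.
  have : x - n.+1%:R^-1 < x + n.+1%:R^-1 by rewrite ltrD2l gtrN.
  move=> /rat_in_itvoo[q]; rewrite in_itv/= => /andP[q1 q2].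
  by exists q; rewrite ler_distlC !ltW// -ltrBlDr.
have [q Hq] := choice near_rat.
exists m, (rcons (mkseq (fun i => q (rderiv (rderiv phi) (mesh m i))) m.+1) (q (phi 0))).
split => //.
- by rewrite nth_rcons size_mkseq ltnn eqxx.
- by move=> i im; rewrite nth_rcons size_mkseq im nth_mkseq.
- by move=> s t st; apply/ltW/Hd/(le_lt_trans st).
Qed.

(** For each code one function having that code is chosen, when there is any; codes are countable.
    No explicit dense family is constructed. *)
Lemma C2per_separable : exists D : nat -> R -> R, (forall k, C2per l (D k)) /\
  forall phi (e : R), C2per l phi -> 0 < e -> exists k,
    (forall s, `|phi s - D k s| <= e) /\
    (forall s, `|rderiv (rderiv phi) s - rderiv (rderiv (D k)) s| <= e).
Proof.
have ex (k : nat) : exists f : R -> R, C2per l f /\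
    forall n m v, unpickle k = Some (n, m, v) -> forall phi, near_code n m v phi ->
    near_code n m v f.
  have C0 : C2per l (fun _ => 0 : R).
    have r0 : rderiv (fun _ : R => 0 : R) = fun _ => 0.
      by apply/funext => s; apply/deriv_val; exact: is_derive_cst.
    by rewrite /C2per !r0; split => // s; [exact: derivable_cst..|exact: cvg_cst].
  case E : (unpickle k) => [[[n m] v]|]; last by exists (fun _ => 0); split.
  have [[f Hf]|Hf] := pselect (exists f, near_code n m v f).
    by exists f; split; [case: Hf|move=> ? ? ? [<- <- <-]].
  by exists (fun _ => 0); split => // ? ? ? [<- <- <-] phi Hphi; case: Hf; exists phi.
have [D HD] := choice ex; exists D; split=> [k|phi e Cphi e0]; first by case: (HD k).
(* [4] for the second derivatives, [l * l * 4] for their effect on the functions through two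
   integrations over a period, and [2] for the values at [0]. *)
pose c := 4 + l * l * 4 + 2; have c0 : 0 < c by rewrite !addr_gt0 ?mulr_gt0.
pose n := Num.truncn (c / e).
have Hn : c / n.+1%:R <= e.
  have := truncnS_gt (c / e); rewrite -/n ltr_pdivrMr// => H'.
  by rewrite ler_pdivrMr// mulrC ltW.
have [m [v Hv]] := near_code_exists n Cphi.
exists (pickle (n, m, v)); set k := pickle _.
have [Ck Hk] := HD k; have {}Hk := Hk n m v (pickleK _) phi Hv.
have [A B] := near_code_close Hv Hk.
have n0 : 0 <= n.+1%:R^-1 :> R by rewrite invr_ge0.
have N1 : 4 / n.+1%:R <= e.
  by apply: le_trans Hn; rewrite ler_pM2r ?invr_gt0// /c -addrA lerDl addr_ge0// !mulr_ge0// ltW.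
split; last by move=> s; exact: le_trans (B s) N1.
have [p1 d1 dd1 c1] := Cphi; have [p2 d2 dd2 c2] := Ck.
pose h := phi - D k.
have rh : rderiv h = rderiv phi - rderiv (D k).
  by apply/funext => s; apply/deriv_val; apply: is_deriveB; exact: is_derive_deriv.
have rrh : rderiv (rderiv h) = rderiv (rderiv phi) - rderiv (rderiv (D k)).
  by rewrite rh; apply/funext => s; apply/deriv_val; apply: is_deriveB; exact: is_derive_deriv.
have Ch : C2per l h.
  split; rewrite ?rrh ?rh.
  - by move=> s; rewrite /h !fctE p1 p2.
  - by move=> s; exact: derivableB.
  - by move=> s; exact: derivableB.
  - by move=> s; apply: cvgB; [exact: c1|exact: c2].
have B' s : `|rderiv (rderiv h) s| <= 4 / n.+1%:R by rewrite rrh; exact: B.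
have L := deriv_lipschitz (_ : derivable1 h) (periodic_deriv_bound l0 Ch B').
move=> s; have [j /andP[j1 j2]] := shift_itv l0 0 s.
have -> : phi s - D k s = h (s + j%:~R * l).
  by rewrite (periodic_int (_ : forall s, h (s + l) = h s)) ?/h//; case: Ch.
rewrite -[h _](subrK (h 0)); apply: le_trans (ler_normD _ _) _.
apply: le_trans Hn; rewrite /c [leRHS]mulrDl; apply: lerD => //.
have {}L := L (let: And4 _ d _ _ := Ch in d); apply: le_trans (L _ 0) _.
rewrite subr0 ger0_norm//; rewrite add0r in j2.
apply: (@le_trans _ _ (l * (4 / n.+1%:R) * l)).
  by apply: ler_wpM2l (ltW j2); rewrite mulr_ge0 ?divr_ge0// ltW.
apply: (@le_trans _ _ (l * l * 4 / n.+1%:R)).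
  by rewrite le_eqVlt; apply/orP; left; apply/eqP; ring.
by rewrite ler_pM2r ?invr_gt0// lerDr.
Qed.

End separability.

(** * Gaussian increments and a maximal inequality *)

Section normal_moments.
Context {R : realType}.
Local Notation leb := (@lebesgue_measure R).

Lemma integral_normal_prob (s : R) (f : measurableTypeR R -> R) :
  (normal_prob 0 s : probability _ _).-integrable setT (EFin \o f) ->
  (\int[normal_prob 0 s]_x (f x)%:E = \int[leb]_x (f x * normal_pdf 0 s x)%:E)%E.
Proof.
move=> fi; have nd := @normal_prob_dominates R 0 s.
have mf : measurable_fun setT f by apply/measurable_EFinP; exact: (measurable_int _ fi).
rewrite -(Radon_Nikodym_change_of_variables nd)//.
under [RHS]eq_integral do rewrite EFinM.
apply: ae_eq_integral => //.
- apply: emeasurable_funM; first exact/measurable_EFinP.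
  apply: (measurable_int leb); apply: Radon_Nikodym_integrable; exact: nd.
- apply: emeasurable_funM; apply/measurable_EFinP => //; exact: measurable_normal_pdf.
- apply: ae_eqe_mul2l => /=; rewrite Radon_NikodymE//.
  case: cid => /= h [h1 h2 h3]; apply: integral_ae_eq => //=.
  + by apply/measurable_EFinP; exact: measurable_normal_pdf.
  + by move=> E E01 mE; rewrite -h3.
Qed.

(** With [a = x ^+ 2 / s ^+ 2] the claim reduces to [a <= 4 * exp(3 a / 8)]. A Gaussian of doubled
    width absorbs the square, so a second-moment bound follows from the total mass of a density; the
    constant [8] is [4] times the ratio [2] of the peaks. *)
Lemma sqr_normal_pdf_le (s x : R) : 0 < s ->
  x ^+ 2 * normal_pdf 0 s x <= 8 * s ^+ 2 * normal_pdf 0 (2 * s) x.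
Proof.
move=> s0; have s20 : 0 < 2 * s by rewrite mulr_gt0.
rewrite !normal_pdfE ?gt_eqF// /normal_fun !subr0.
have -> : normal_peak s = 2 * normal_peak (2 * s).
  rewrite /normal_peak (_ : (2 * s) ^+ 2 * pi *+ 2 = 2 ^+ 2 * (s ^+ 2 * pi *+ 2)); last first.
    by ring.
  by rewrite sqrtrM// sqrtr_sqr gtr0_norm// invfM mulrA divff// mul1r.
pose a := x ^+ 2 / s ^+ 2; have a0 : 0 <= a by rewrite divr_ge0 ?sqr_ge0.
have xa : x ^+ 2 = a * s ^+ 2 by rewrite divfK// expf_eq0 gt_eqF.
have -> : - x ^+ 2 / (s ^+ 2 *+ 2) = - (a / 2).
  by rewrite /a -mulr_natr; field; rewrite gt_eqF.
have -> : - x ^+ 2 / ((2 * s) ^+ 2 *+ 2) = - (a / 8).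
  by rewrite /a -mulr_natr; field; rewrite gt_eqF.
have -> : expR (- (a / 8)) = expR (- (a / 2)) * expR (3 / 8 * a).
  by rewrite -expRD; congr expR; field.
rewrite xa.
have H : a <= 4 * expR (3 / 8 * a).
  by have := expR_ge1Dx (3 / 8 * a); move: a0; lra.
set p := normal_peak _; set E := expR (- _) in H *; set G := expR _ in H *.
have -> : a * s ^+ 2 * (2 * p * E) = 2 * s ^+ 2 * p * E * a by ring.
have -> : 8 * s ^+ 2 * (p * (E * G)) = 2 * s ^+ 2 * p * E * (4 * G) by ring.
by apply: ler_wpM2l => //; do 3?apply: mulr_ge0; rewrite ?sqr_ge0 ?normal_peak_ge0// /E expR_ge0.
Qed.

Import HBNNSimple.

(** The passage to the density is made for integrable functions, so it is applied to the simple
    functions below the square, over which the integral is a supremum. *)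
Lemma normal_second_moment (s : R) : 0 < s ->
  (\int[normal_prob 0 s]_x (x ^+ 2)%:E <= (8 * s ^+ 2)%:E)%E.
Proof.
move=> s0; have s20 : 0 < 2 * s by rewrite mulr_gt0.
rewrite ge0_integralTE; last by move=> x; rewrite lee_fin sqr_ge0.
apply: ge_ereal_sup => _ [h /= hx <-]; rewrite -integralT_nnsfun.
have mh : measurable_fun setT h by exact: measurable_funPT.
rewrite integral_normal_prob; last first.
  apply: measurable_bounded_integrable => //; first by rewrite /= probability_setT ltry.
  exact: simple_bounded.
apply: (@le_trans _ _ (\int[leb]_x (8 * s ^+ 2 * normal_pdf 0 (2 * s) x)%:E)%E).
  apply: ge0_le_integral => //.
  - by move=> x _; rewrite lee_fin mulr_ge0// normal_pdf_ge0.
  - apply/measurable_EFinP/measurable_funM => //; exact: measurable_normal_pdf.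
  - apply/measurable_EFinP/measurable_funM => //; exact: measurable_normal_pdf.
  - move=> x _; rewrite lee_fin; apply: le_trans (sqr_normal_pdf_le x s0).
    by rewrite ler_wpM2r ?normal_pdf_ge0// -lee_fin; exact: hx.
under eq_integral do rewrite EFinM.
rewrite integralZl//; last exact: integrable_normal_pdf.
by rewrite integral_normal_pdf ?gt_eqF// mule1.
Qed.

Lemma integrable_normal_prob_id (s : R) : 0 < s ->
  (normal_prob 0 s : probability _ _).-integrable setT (EFin \o id).
Proof.
move=> s0; apply/integrableP; split; first exact/measurable_EFinP.
apply: (@le_lt_trans _ _ (\int[normal_prob 0 s]_x ((1 : R)%:E + (x ^+ 2)%:E))%E).
  apply: ge0_le_integral => //.
  - by apply/measurable_EFinP; exact: measurableT_comp.
  - by apply/measurable_EFinP; apply: measurable_funD => //; exact: measurable_funX.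
  - move=> x _; rewrite -EFinD lee_fin; rewrite -(real_normK (num_real x)).
    by have := sqr_ge0 (`|x| - 1); have := normr_ge0 x; move: (`|x| : R) => y; nra.
rewrite ge0_integralD//; last 2 first.
- by move=> x _; rewrite lee_fin sqr_ge0.
- by apply/measurable_EFinP; exact: measurable_funX.
have -> : (\int[normal_prob 0 s]_x (1:R)%:E = 1)%E.
  by rewrite integral_cst// mul1e; exact: (probability_setT (normal_prob 0 s : probability _ _)).
apply: le_lt_trans (leeD2l _ (normal_second_moment s0)) _.
by rewrite -EFinD ltry.
Qed.

(** The integrand is odd: its positive and negative parts have the same integral, finite by the
    second-moment bound. *)
Lemma normal_mean (s : R) : 0 < s -> (\int[normal_prob 0 s]_x x%:E = 0)%E.
Proof.
move=> s0; have ix := integrable_normal_prob_id s0.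
have fin := integrable_fin_num measurableT ix.
rewrite integral_normal_prob// in fin *.
pose f x := x * normal_pdf 0 s x.
have cf : continuous f.
  by move=> x; apply: cvgM; [exact: cvg_id|exact: (continuous_normal_pdf (lt0r_neq0 s0))].
have odd x : f (- x) = - f x.
  by rewrite /f mulNr !normal_pdfE ?gt_eqF// /normal_fun !subr0 sqrrN.
have f0 x : 0 <= x -> 0 <= f x by move=> x0; rewrite mulr_ge0// normal_pdf_ge0.
pose I := (\int[leb]_(x in `[0%R, +oo[) (f x)%:E)%E.
have I0 : (0 <= I)%E by apply: integral_ge0 => x /=; rewrite in_itv/= andbT => x0; rewrite lee_fin f0.
have E1 : (\int[leb]_x ((EFin \o f)^\+ x) = I)%E.
  rewrite /I [RHS]integral_mkcond; apply: eq_integral => x _; rewrite funepos.unlock /patch.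
  case: ifPn; rewrite ?inE ?notin_setE /= in_itv/= andbT => x0.
    by apply/max_idPl; rewrite lee_fin f0.
  apply/max_idPr; rewrite lee_fin -oppr_ge0 -odd f0// oppr_ge0 leNgt.
  by apply/negP => x1; apply: x0; exact: ltW.
have E2 : (\int[leb]_x ((EFin \o f)^\- x) = I)%E.
  have := @ge0_integration_by_substitutionNy R (fun x => - f x) 0.
  rewrite oppr0 => /(_ _ _) E; transitivity (\int[leb]_(x in `]-oo, 0%R]) (- f x)%:E)%E.
    rewrite [RHS]integral_mkcond; apply: eq_integral => x _; rewrite funeneg.unlock /patch.
    case: ifPn; rewrite ?inE ?notin_setE /= in_itv/= => x0.
      by apply/max_idPl; rewrite lee_fin -odd f0// oppr_ge0.
    apply/max_idPr; rewrite lee_fin oppr_le0 f0// leNgt.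
    by apply/negP => x1; apply: x0; exact: ltW.
  rewrite E; first by apply: eq_integral => x _; rewrite /= odd opprK.
    by apply: continuous_subspaceT => x; apply: cvgN; exact: cf.
  by move=> x; rewrite in_itv/= => x0; rewrite -odd f0// oppr_ge0 ltW.
rewrite integralE E1 E2; rewrite integralE E1 E2 in fin.
by clear E1 E2; move: (I) I0 fin; case=> [r _ _|//|//]; rewrite -EFinB subrr.
Qed.

End normal_moments.

(** * Independence of the Brownian increments from the completed past *)

Section past.
Context {R : realType} {d : measure_display} {Om : measurableType d}.
Variable P : probability Om R.

Lemma sigma_gen_measurable (I : Type) (D : set I) (Y : I -> Om -> R) :
  (forall i, D i -> measurable_fun setT (Y i)) -> sigma_gen D Y `<=` measurable.
Proof.
move=> mY; apply: smallest_sub; first exact: sigma_algebra_measurable.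
by move=> _ [i Di] [U mU <-]; exact: mY.
Qed.

Lemma sigma_gen_preimage (I : Type) (D : set I) (Y : I -> Om -> R) (i : I) (U : set R) :
  D i -> measurable U -> sigma_gen D Y (Y i @^-1` U).
Proof.
by move=> Di mU; apply: sub_sigma_algebra; exists i => //; exists U; rewrite ?setTI.
Qed.

Lemma sub_sigma_gen (I : Type) (D D' : set I) (Y : I -> Om -> R) :
  D `<=` D' -> sigma_gen D Y `<=` sigma_gen D' Y.
Proof.
move=> DD; apply: sub_smallest2r; first exact: smallest_sigma_algebra.
by move=> A [i /DD Di H]; exists i.
Qed.

Lemma measurable_sigma_gen (I : Type) (D : set I) (Y : I -> Om -> R) (i : I) :
  D i -> measurable_fun setT (Y i : g_sigma_algebraType
    (\bigcup_(i in D) preimage_set_system setT (Y i) measurable) -> R).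
Proof. by move=> Di _ U mU; rewrite setTI; exact: sigma_gen_preimage. Qed.

Lemma completion_sigma_algebra (F : set (set Om)) : sigma_algebra setT F ->
  sigma_algebra setT (completion P F).
Proof.
move=> [F0 FC FU]; split.
- by exists set0 => //; rewrite setYK; exact: negligible_set0.
- move=> A [A' FA nA]; exists (setT `\` A'); first exact: FC.
  rewrite !setTD (_ : ~` A `+` ~` A' = A `+` A')//.
  by rewrite /setY !setDE !setCK setUC [X in X `|` _]setIC [X in _ `|` X]setIC.
- move=> A HA; have [A' HA'] := choice (fun k => let: ex_intro2 A' a b := HA k in
    ex_intro (fun A' => F A' /\ P.-negligible (A k `+` A')) A' (conj a b)).
  exists (\bigcup_k A' k); first by apply: FU => k; case: (HA' k).
  apply: negligibleS (negligible_bigcup (fun k => (HA' k).2)).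
  move=> w [[[k _ Ak] nA]|[[k _ Ak] nA]]; exists k => //; [left|right]; split => // H.
    by apply: nA; exists k.
  by apply: nA; exists k.
Qed.

Lemma negligible_setI (A A' C : set Om) : measurable A -> measurable A' -> measurable C ->
  P.-negligible (A `+` A') -> P (A `&` C) = P (A' `&` C).
Proof.
move=> mA mA' mC nA; have [N [mN N0 AN]] := nA.
have sub B B' : measurable B -> measurable B' -> B `\` B' `<=` N -> (P (B `&` C) <= P (B' `&` C))%E.
  move=> mB mB' H; apply: (@le_trans _ _ (P ((B' `&` C) `|` N))%E).
    apply: le_measure; rewrite ?inE; [exact: measurableI| |].
      by apply: measurableU => //; exact: measurableI.
    by move=> w [Bw Cw]; have [?|?] := pselect (B' w); [left|right; exact: H].
  apply: le_trans (measureU2 _ _ _) _ => //; first exact: measurableI.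
  rewrite -[X in (_ <= X)%E]adde0; apply: leeD => //.
  by rewrite le_eqVlt; apply/orP; left; apply/eqP; exact: N0.
by apply/le_anti/andP; split; apply: sub => // w Hw; apply: AN; [left|right].
Qed.

Variables (N : nat) (B X : 'I_N -> R -> Om -> R).
Hypotheses (BM : brownian_motion P B) (mX : continuous_process X).
Hypothesis X0B : independent P (history X 0) (full_history B).
Hypothesis Xad : forall t, 0 <= t -> forall i (U : set R), measurable U ->
  completion P <<s history X 0 `|` history B t >> (X i t @^-1` U).

(** Sets of the completion may fail to be measurable in the ambient space; measurability is added so
    that [P] can be applied to them. *)
Definition past (t : R) : set (set Om) :=
  [set A | measurable A /\ completion P <<s history X 0 `|` history B t >> A].

Definition increment i (s t : R) (w : Om) : R := B i t w - B i s w.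

Lemma measurable_increment i s t : 0 <= s -> 0 <= t -> measurable_fun setT (increment i s t).
Proof. by move=> s0 t0; case: BM => -[mB _] _ _; apply: measurable_funB; exact: mB. Qed.

Lemma past_sigma_algebra t : sigma_algebra setT (past t).
Proof.
have [c0 cC cU] := completion_sigma_algebra (smallest_sigma_algebra setT (history X 0 `|` history B t)).
split; first by split.
- by move=> A [mA HA]; split; [exact: measurableD|exact: cC].
- move=> A HA; split; first by apply: bigcupT_measurable => k; case: (HA k).
  by apply: cU => k; case: (HA k).
Qed.

Lemma past_mono s t : s <= t -> past s `<=` past t.
Proof.
move=> st A [mA [A' FA nA]]; split => //; exists A' => //.
move: A' FA {nA}; apply: sub_smallest2r; first exact: smallest_sigma_algebra.
apply: setUS; apply: sub_sigma_gen => -[i u] /= /andP[u0 us].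
by rewrite u0 (le_trans us).
Qed.

Lemma past_X i s t U : 0 <= s -> s <= t -> measurable U -> past t (X i s @^-1` U).
Proof.
move=> s0 st mU; apply: (past_mono st); split; last exact: Xad.
by rewrite -[_ @^-1` _]setTI; case: mX => mXi _; exact: mXi.
Qed.

Lemma past_B i s t U : 0 <= s -> s <= t -> measurable U -> past t (B i s @^-1` U).
Proof.
move=> s0 st mU; split.
  by rewrite -[_ @^-1` _]setTI; case: BM => -[mB _] _ _; exact: mB.
exists (B i s @^-1` U); last by rewrite setYK; exact: negligible_set0.
apply: sub_sigma_algebra; right.
by apply: (@sigma_gen_preimage _ _ (fun p => B p.1 p.2) (i, s)) => //=; rewrite s0.
Qed.

(** The increment is independent of the past of [B], and the initial position is independent of all
    of [B]. Together these give the claim on intersections of an initial event and a Brownian event;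
    the pi-lambda theorem and a null-set correction extend it to the completed past. *)
Lemma past_increment_indep i s t A U : 0 <= s -> s < t -> past s A -> measurable U ->
  P (A `&` (increment i s t @^-1` U)) = (P A * normal_prob 0 (Num.sqrt (t - s)) U)%E.
Proof.
move=> s0 st [mA [A' FA nA]] mU; have [[mB _] _ incB] := BM.
set C := increment i s t @^-1` U; set p := normal_prob _ _ U.
have t0 : 0 <= t by exact/ltW/(le_lt_trans s0).
have mC : measurable C by rewrite -[C]setTI; exact: measurable_increment.
have HB A2 : history B s A2 -> P (A2 `&` C) = (P A2 * p)%E.
  move=> HA2; have := incB s t s0 st A2 HA2 (fun j => if j == i then U else setT).
  have -> : [set w | forall j, (if j == i then U else setT) (B j t w - B j s w)] = C.
    apply/seteqP; split => [w /(_ i)|w Cw j]; first by rewrite eqxx.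
    by case: eqP => [->|].
  rewrite (bigD1 i)//= eqxx big1 ?mule1; last first.
    by move=> j /negbTE ->; exact: (probability_setT (normal_prob 0 _ : probability _ _)).
  by apply => j; case: ifP.
have histT : history B s setT.
  by have [h0 hC _] := smallest_sigma_algebra setT
    (\bigcup_(i in [set p : 'I_N * R | 0 <= p.2 <= s])
      preimage_set_system setT (B i.1 i.2) measurable); rewrite -(setD0 setT); exact: hC.
have PC : P C = p by rewrite -(setTI C) (HB _ histT) probability_setT mul1e.
have histX : history X 0 `<=` measurable.
  by apply: sigma_gen_measurable => -[j u] /= /andP[u0 _]; case: mX => + _; exact.
have histB : history B s `<=` measurable.
  by apply: sigma_gen_measurable => -[j u] /= /andP[u0 _]; exact: mB.
have fullC : full_history B C.
  have mf : measurable_fun setT (increment i s t : g_sigma_algebraType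
    (\bigcup_(p in [set p : 'I_N * R | 0 <= p.2]) preimage_set_system setT (B p.1 p.2) measurable) -> R).
    apply: measurable_funB.
      exact: (@measurable_sigma_gen _ _ (fun p => B p.1 p.2) (i, t)).
    exact: (@measurable_sigma_gen _ _ (fun p => B p.1 p.2) (i, s)).
  by have := mf measurableT U mU; rewrite setTI.
have fullI A2 : history B s A2 -> full_history B (A2 `&` C).
  move=> H; have H' : full_history B A2.
    by move: A2 H; apply: sub_sigma_gen => -[j u] /= /andP[].
  pose M := g_sigma_algebraType (\bigcup_(p in [set p : 'I_N * R | 0 <= p.2])
    preimage_set_system setT (B p.1 p.2) measurable).
  exact: (@measurableI _ M A2 C).
pose G0 := [set A | exists A1 A2, [/\ history X 0 A1, history B s A2 & A = A1 `&` A2]].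
have FG : <<s history X 0 `|` history B s >> `<=` <<s G0 >>.
  apply: smallest_sub; first exact: smallest_sigma_algebra.
  move=> D [HD|HD]; apply: sub_sigma_algebra.
    by exists D, setT; rewrite setIT.
  exists setT, D; rewrite setTI; split => //.
  by have [h0 hC _] := smallest_sigma_algebra setT
    (\bigcup_(i in [set p : 'I_N * R | 0 <= p.2 <= 0])
      preimage_set_system setT (X i.1 i.2) measurable); rewrite -(setD0 setT); exact: hC.
have GI : setI_closed G0.
  move=> _ _ [A1 [A2 [h1 h2 ->]]] [A3 [A4 [h3 h4 ->]]].
  exists (A1 `&` A3), (A2 `&` A4); split; last by rewrite setIACA.
    exact: (@measurableI _ (g_sigma_algebraType (\bigcup_(p in [set p : 'I_N * R | 0 <= p.2 <= 0])
      preimage_set_system setT (X p.1 p.2) measurable)) A1 A3).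
  exact: (@measurableI _ (g_sigma_algebraType (\bigcup_(p in [set p : 'I_N * R | 0 <= p.2 <= s])
    preimage_set_system setT (B p.1 p.2) measurable)) A2 A4).
pose H := [set A | measurable A /\ P (A `&` C) = (P A * p)%E].
have GH : G0 `<=` H.
  move=> _ [A1 [A2 [h1 h2 ->]]]; split; first by apply: measurableI; [exact: histX|exact: histB].
  rewrite -setIA (X0B h1 (fullI _ h2)) HB// muleA; congr (_ * _)%E.
  by rewrite X0B//; move: A2 h2; apply: sub_sigma_gen => -[j u] /= /andP[].
have fp : p \is a fin_num by rewrite -PC; exact: fin_num_measure.
have LH : lambda_system setT H.
  split => //.
  - by split => //; rewrite setTI probability_setT mul1e.
  - move=> D E ED [mD HD] [mE HE]; split; first exact: measurableD.
    have -> : (D `\` E) `&` C = (D `&` C) `\` (E `&` C).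
      by apply/seteqP; split => w; rewrite /=; tauto.
    have sub : E `&` C `<=` D `&` C by exact: setSI.
    have e1 : P ((D `&` C) `\` (E `&` C)) = (P (D `&` C) - P (E `&` C))%E.
      rewrite measureD ?ltey_eq ?fin_num_measure//; try exact: measurableI.
      by rewrite (setIidr sub).
    have e2 : P (D `\` E) = (P D - P E)%E.
      by rewrite measureD ?ltey_eq ?fin_num_measure// (setIidr ED).
    by rewrite e1 e2 HD HE muleBl// ?fin_num_measure// fin_num_adde_defr// fin_num_measure.
  - move=> D ndD HD; split; first by apply: bigcupT_measurable => k; case: (HD k).
    have mD k : measurable (D k) by case: (HD k).
    have c1 := nondecreasing_cvg_mu (mu := P) mD (bigcupT_measurable _ mD) ndD.
    have c2 : P (D k `&` C) @[k --> \oo] --> P ((\bigcup_k D k) `&` C).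
      rewrite setI_bigcupl; apply: nondecreasing_cvg_mu.
      + by move=> k; exact: measurableI.
      + by apply: bigcupT_measurable => k; exact: measurableI.
      + by move=> m n mn; apply/subsetPset; apply: setSI; apply/subsetPset; exact: ndD.
    apply: (cvg_unique _ c2) => //.
    rewrite (_ : (fun k => P (D k `&` C)) = fun k => (P (D k) * p)%E); last first.
      by apply/funext => k; case: (HD k).
    by apply: cvgeZr.
have mA' : measurable A'.
  have [+ _] : H A' by apply: (lambda_system_subset GI LH GH) => //; exact: FG.
  by [].
have [_ HA'] : H A' by apply: (lambda_system_subset GI LH GH) => //; exact: FG.
rewrite (negligible_setI mA mA' mC nA) HA'; congr (_ * _)%E.
by rewrite -(setIT A) (negligible_setI mA mA' measurableT nA) setIT.
Qed.

End past.

(** * A Gaussian variable multiplied by an independent bounded one *)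

Section independent_gaussian.
Context {R : realType} {d : measure_display} {Om : measurableType d}.
Variable P : probability Om R.
Local Notation mR := (measurableTypeR R).
Variables (D : Om -> mR) (s : R).
Hypotheses (mD : measurable_fun setT D) (s0 : 0 < s).
Hypothesis Dlaw : forall U : set mR, measurable U -> P (D @^-1` U) = normal_prob 0 s U.

Definition mfun_of (d' : measure_display) (T : measurableType d') (f : Om -> T)
    (mf : measurable_fun setT f) : {mfun Om >-> T} :=
  MeasurableFun.Pack (MeasurableFun.Class (isMeasurableFun.Build _ _ _ _ _ mf)).

Lemma gaussian_second_moment : (\int[P]_w (D w ^+ 2)%:E <= (8 * s ^+ 2)%:E)%E.
Proof.
have := @ge0_integral_distribution _ _ _ _ R P (mfun_of mD) (fun x => (x ^+ 2)%:E).
rewrite /comp /= => <- //; last 2 first.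
- by apply/measurable_EFinP; exact: measurable_funX.
- by move=> x; rewrite lee_fin sqr_ge0.
apply: le_trans (normal_second_moment s0).
by rewrite le_eqVlt; apply/orP; left; apply/eqP/eq_measure_integral => U mU _; exact: Dlaw.
Qed.

Lemma integrable_gaussian_sqr : P.-integrable setT (fun w => (D w ^+ 2)%:E).
Proof.
apply/integrableP; split; first by apply/measurable_EFinP; exact: measurable_funX.
apply: le_lt_trans (ltry (8 * s ^+ 2)); apply: le_trans gaussian_second_moment.
by under eq_integral do rewrite gee0_abs ?lee_fin ?sqr_ge0//.
Qed.

Lemma integrable_gaussian : P.-integrable setT (EFin \o D).
Proof.
have i1 : P.-integrable setT (fun w => (1 + D w ^+ 2)%:E).
  under eq_fun do rewrite EFinD.
  apply: integrableD => //; last exact: integrable_gaussian_sqr.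
  exact: finite_measure_integrable_cst.
apply: le_integrable i1 => //; first exact/measurable_EFinP.
move=> w _; rewrite /= lee_fin [leRHS]ger0_norm ?addr_ge0 ?sqr_ge0//.
rewrite -(real_normK (num_real (D w))); have := sqr_ge0 (`|D w| - 1).
by have := normr_ge0 (D w); move: (`|D w|) => y; nra.
Qed.

(** Independence makes the joint law of [Z] and [D] a product measure; by Fubini the inner integral
    is a multiple of the Gaussian mean, which is zero. *)
Lemma integral_indep_gaussian (Z : Om -> mR) (M : R) : measurable_fun setT Z ->
  (forall w, `|Z w| <= M) ->
  (forall U V : set mR, measurable U -> measurable V ->
    P ((Z @^-1` U) `&` (D @^-1` V)) = (P (Z @^-1` U) * normal_prob 0 s V)%E) ->
  (\int[P]_w (Z w * D w)%:E = 0)%E /\ P.-integrable setT (fun w => (Z w * D w)%:E).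
Proof.
move=> mZ ZM ind.
have bZ : [bounded Z w | w in [set: Om]].
  by exists M; split; [exact: num_real|move=> x Mx t _; exact: le_trans (ZM t) (ltW Mx)].
have iZD : P.-integrable setT (fun w => (Z w * D w)%:E).
  exact: (integrableMr _ mZ bZ integrable_gaussian).
split => //.
have mZD : measurable_fun setT (fun w => (Z w, D w)) by exact: measurable_fun_pair.
have mm : measurable_fun setT (fun p : mR * mR => (p.1 * p.2)%:E).
  by apply/measurable_EFinP; exact: measurable_funM.
have := @integral_distribution _ _ _ _ R P (mfun_of mZD) (fun p => (p.1 * p.2)%:E) mm iZD.
rewrite /comp /= => <-.
pose N := normal_prob 0 s : probability _ _.
pose m1 := distribution P (mfun_of mZ).
have E A : measurable A -> (m1 \x N)%E A = distribution P (mfun_of mZD) A.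
  by apply: product_measure_unique => U V mU mV; exact: ind.
have im : (m1 \x N)%E.-integrable setT (fun p : mR * mR => (p.1 * p.2)%:E).
  apply/integrableP; split => //.
  rewrite (@eq_measure_integral _ _ _ _ (distribution P (mfun_of mZD))); last first.
    by move=> A mA _; exact: E.
  rewrite ge0_integral_distribution//; last exact: measurableT_comp.
  by have /integrableP[] := iZD.
rewrite (@eq_measure_integral _ _ _ _ (m1 \x N)%E); last by move=> A mA _; exact/esym/E.
rewrite -integral12_prod_meas1//.
rewrite -[RHS](@integral0 _ _ _ m1 setT); apply: eq_integral => z _.
rewrite /fubini_F /=; under eq_integral do rewrite EFinM.
rewrite integralZl//; last exact: integrable_normal_prob_id.
by rewrite normal_mean// mule0.
Qed.

End independent_gaussian.

Lemma mean_sqr (R : realFieldType) (n : nat) (x : 'I_n.+1 -> R) :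
  (n.+1%:R^-1 * \sum_(i < n.+1) x i) ^+ 2 <= n.+1%:R^-1 * \sum_(i < n.+1) x i ^+ 2.
Proof.
set m := _ * _; have n0 : 0 < n.+1%:R :> R by rewrite ltr0n.
have E : \sum_(i < n.+1) x i = n.+1%:R * m by rewrite /m mulrA divff ?mul1r// gt_eqF.
have H : 0 <= \sum_(i < n.+1) (x i - m) ^+ 2 by apply: sumr_ge0 => i _; exact: sqr_ge0.
rewrite mulrC ler_pdivlMr//; move: H.
have -> : \sum_(i < n.+1) (x i - m) ^+ 2 =
    \sum_(i < n.+1) (x i ^+ 2 + ((- (2 * m)) * x i + m ^+ 2)).
  by apply: eq_bigr => i _; ring.
rewrite !big_split/= -mulr_sumr E sumr_const card_ord -mulr_natl; nra.
Qed.

(** * Maximal inequality for a discrete stopped martingale *)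

Section maximal_inequality.
Context {R : realType} {d : measure_display} {Om : measurableType d}.
Variable P : probability Om R.
Local Notation mR := (measurableTypeR R).
(* [F k] is the information available before the increments [D i k], which are
   centered Gaussian of standard deviation [s] given [F k]. *)
Variables (N : nat) (F : nat -> set (set Om)) (D a : 'I_N.+1 -> nat -> Om -> mR) (s L : R).
Hypothesis s0 : 0 < s.
Hypothesis sF : forall k, sigma_algebra setT (F k).
Hypothesis Fmono : forall k, F k `<=` F k.+1.
Hypothesis Fm : forall k, F k `<=` measurable.
Hypothesis FD : forall i k U, measurable U -> F k.+1 (D i k @^-1` U).
Hypothesis Fa : forall i k U, measurable U -> F k (a i k @^-1` U).
Hypothesis aL : forall i k w, `|a i k w| <= L.
Hypothesis indep : forall i k A U, F k A -> measurable U ->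
  P (A `&` (D i k @^-1` U)) = (P A * normal_prob 0 s U)%E.

Definition martingale (m : nat) (w : Om) : R :=
  \sum_(k < m) N.+1%:R^-1 * \sum_(i < N.+1) a i k w * D i k w.

Local Notation OmF k := (g_sigma_algebraType (F k)).

Let FE k : <<s F k >> = F k. Proof. exact/sigma_algebra_id. Qed.

Let measurableF k (f : Om -> mR) : measurable_fun setT (f : OmF k -> mR) ->
  forall U, measurable U -> F k (f @^-1` U).
Proof. by move=> mf U mU; rewrite -FE -[_ @^-1` _]setTI; exact: mf. Qed.

Let Fmeasurable k (f : Om -> mR) : (forall U, measurable U -> F k (f @^-1` U)) ->
  measurable_fun setT (f : OmF k -> mR).
Proof. by move=> H _ U mU; rewrite setTI; have := H U mU; rewrite -{1}FE; exact. Qed.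

Let Fmeas k (f : Om -> mR) : measurable_fun setT (f : OmF k -> mR) -> measurable_fun setT f.
Proof. by move=> mf _ U mU; rewrite setTI; apply: (@Fm k); exact: measurableF. Qed.

Variable e : R.
Hypothesis e0 : 0 < e.

(** The martingale frozen from the first time at which its absolute value reaches [e]. *)
Fixpoint stopped (k : nat) : Om -> mR := if k is k'.+1 then
  fun w => stopped k' w + (if `|stopped k' w| < e then
    N.+1%:R^-1 * \sum_(i < N.+1) a i k' w * D i k' w else 0) else fun _ => 0.

(** Until the threshold is reached the two processes agree; afterwards the stopped one keeps a value
    of size at least [e]. Thus the maximum is read off at the final time. *)
Lemma stopped_exceeds m w :
  (exists2 k, (k <= m)%N & e <= `|martingale k w|) -> e <= `|stopped m w|.
Proof.
suff H : e <= `|stopped m w| \/ stopped m w = martingale m w /\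
    forall k, (k <= m)%N -> `|martingale k w| < e.
  move=> [k km ek]; case: H => [//|[_ /(_ k km)]]; by rewrite ltNge ek.
elim: m => [|m IH].
  have M0 : martingale 0 w = 0 by rewrite /martingale big_ord0.
  by right; split => // k; rewrite leqn0 => /eqP ->; rewrite M0 normr0.
rewrite /=; case: IH => [em|[Em IH]].
  by left; rewrite ltNge em/= addr0.
rewrite Em (IH m (leqnn m)).
have -> : martingale m w + N.+1%:R^-1 * \sum_(i < N.+1) a i m w * D i m w = martingale m.+1 w.
  by apply/esym; exact: big_ord_recr.
have [em|em] := leP e `|martingale m.+1 w|; first by left.
right; split => // k; rewrite leq_eqVlt => /predU1P[->//|]; rewrite ltnS; exact: IH.
Qed.

Lemma stopped_measurable k : measurable_fun setT (stopped k : OmF k -> mR).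
Proof.
elim: k => [|k IH]; first exact: measurable_cst.
have up (f : Om -> mR) : measurable_fun setT (f : OmF k -> mR) ->
    measurable_fun setT (f : OmF k.+1 -> mR).
  by move=> mf; apply: Fmeasurable => U mU; apply: Fmono; exact: measurableF.
have mS := up _ IH.
have mincr : measurable_fun setT ((fun w => N.+1%:R^-1 * \sum_(i < N.+1) a i k w * D i k w)
    : OmF k.+1 -> mR).
  apply: measurable_funM => //; apply: measurable_sum => i; apply: measurable_funM.
    by apply: up; apply: Fmeasurable => U; exact: Fa.
  by apply: Fmeasurable => U; exact: FD.
apply: (@measurable_funD _ (OmF k.+1)) => //.
apply: measurable_fun_ifT => //.
apply: measurable_fun_ltr => //; exact: measurableT_comp.
Qed.

(** Before stopping the process is bounded by [e], so the coefficient [Z] of each increment in the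
    cross term is bounded and known in advance, and that term has mean zero. The square of the
    average increment is bounded by the average of the squares. *)
Lemma stopped_second_moment k :
  P.-integrable setT (fun w => (stopped k w ^+ 2)%:E) /\
  (\int[P]_w (stopped k w ^+ 2)%:E <= (k%:R * (L ^+ 2 * (8 * s ^+ 2)))%:E)%E.
Proof.
elim: k => [|k [iS IH]].
  by split; under eq_fun do rewrite /= expr0n; [exact: integrable0|rewrite integral0 mul0r].
pose I w := `|stopped k w| < e.
pose Z i w := (if I w then stopped k w else 0) * a i k w.
have mZ i : measurable_fun setT (Z i : OmF k -> mR).
  apply: measurable_funM; last by apply: Fmeasurable => U; exact: Fa.
  apply: measurable_fun_ifT => //; last exact: stopped_measurable.
  apply: measurable_fun_ltr => //; apply: measurableT_comp => //.
  exact: stopped_measurable.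
have ZL i w : `|Z i w| <= e * L.
  rewrite normrM ler_pM//; rewrite /I; case: ltP => [/ltW//|_].
  by rewrite normr0 ltW.
have mD i : measurable_fun setT (D i k).
  by move=> _ U mU; rewrite setTI; apply: (@Fm k.+1); exact: FD.
have FT : F k setT by have [F0 FC _] := sF k; rewrite -(setD0 setT); exact: FC.
have lawD i U : measurable U -> P (D i k @^-1` U) = normal_prob 0 s U.
  by move=> mU; rewrite -[_ @^-1` _]setTI indep// probability_setT mul1e.
have HZ i : (\int[P]_w (Z i w * D i k w)%:E = 0)%E /\
    P.-integrable setT (fun w => (Z i w * D i k w)%:E).
  apply: (integral_indep_gaussian (mD i) s0 (lawD i) (Fmeas (mZ i)) (ZL i)).
  by move=> U V mU mV; apply: indep => //; exact: measurableF.
pose c := N.+1%:R^-1 : R.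
have c0 : 0 <= c by rewrite invr_ge0.
(* A bound for the next square: current square, cross term, and quadratic term with the coefficients
   replaced by [L]. *)
pose G w := stopped k w ^+ 2 + \sum_(i < N.+1) (2 * c) * (Z i w * D i k w)
  + \sum_(i < N.+1) (c * L ^+ 2) * D i k w ^+ 2.
have SG w : stopped k.+1 w ^+ 2 <= G w.
  rewrite /G /= -/(I w) -!mulr_sumr; case: ifPn => Iw; last first.
    rewrite addr0 -addrA lerDl addr_ge0//.
      by rewrite big1 ?mulr0// => i _; rewrite /Z (negbTE Iw) !mul0r.
    apply: mulr_ge0; first by rewrite mulr_ge0 ?sqr_ge0.
    by apply: sumr_ge0 => i _; exact: sqr_ge0.
  rewrite sqrrD lerD//; last first.
    apply: le_trans (mean_sqr _) _; rewrite -mulrA ler_wpM2l// mulr_sumr ler_sum// => i _.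
    rewrite exprMn ler_wpM2r ?sqr_ge0// -(real_normK (num_real (a i k w))).
    by rewrite lerXn2r ?nnegrE//; exact: le_trans (aL i k w).
  rewrite lerD2l -mulr_natl.
  under [X in _ <= _ * X]eq_bigr do rewrite /Z Iw -mulrA.
  by rewrite -[X in _ <= _ * X]mulr_sumr /c le_eqVlt; apply/orP; left; apply/eqP; ring.
have iD i : P.-integrable setT (fun w => (D i k w ^+ 2)%:E).
  exact: (integrable_gaussian_sqr (mD i) s0 (lawD i)).
have iG1 i : P.-integrable setT (fun w => ((2 * c) * (Z i w * D i k w))%:E).
  by under eq_fun do rewrite EFinM; apply: integrableZl => //; case: (HZ i).
have iG2 i : P.-integrable setT (fun w => ((c * L ^+ 2) * D i k w ^+ 2)%:E).
  by under eq_fun do rewrite EFinM; apply: integrableZl.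
have GE w : (G w)%:E = ((stopped k w ^+ 2)%:E + \sum_(i < N.+1) ((2 * c) * (Z i w * D i k w))%:E
  + \sum_(i < N.+1) ((c * L ^+ 2) * D i k w ^+ 2)%:E)%E by rewrite /G !EFinD !sumEFin.
have iG : P.-integrable setT (EFin \o G).
  rewrite /comp; under eq_fun do rewrite GE.
  by apply: integrableD => //; [apply: integrableD => //|]; exact: integrable_sum.
have iS1 : P.-integrable setT (fun w => (stopped k.+1 w ^+ 2)%:E).
  apply: le_integrable iG => //.
    by apply/measurable_EFinP/measurable_funX; apply: Fmeas; exact: stopped_measurable.
  move=> w _; have g0 := le_trans (sqr_ge0 _) (SG w).
  by rewrite lee_fin (ger0_norm (sqr_ge0 _)) (ger0_norm g0); exact: SG.
split => //; apply: (@le_trans _ _ (\int[P]_w (G w)%:E)%E).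
  by apply: le_integral => // w _; rewrite lee_fin.
under eq_integral do rewrite GE.
rewrite integralD//; last 2 first.
- by apply: integrableD => //; exact: integrable_sum.
- exact: integrable_sum.
rewrite integralD//; last exact: integrable_sum.
rewrite !integral_sum// [X in (_ + X + _)%E]big1 ?adde0; last first.
  move=> i _; under eq_integral do rewrite EFinM.
  by rewrite integralZl//; [case: (HZ i) => -> _; rewrite mule0|case: (HZ i)].
rewrite -natr1 mulrDl mul1r EFinD; apply: leeD => //.
apply: (@le_trans _ _ (\sum_(i < N.+1) (c * L ^+ 2 * (8 * s ^+ 2))%:E)%E).
  apply: lee_sum => i _; under eq_integral do rewrite EFinM.
  rewrite integralZl// [leRHS]EFinM; apply: lee_wpmul2l.
    by rewrite lee_fin mulr_ge0 ?sqr_ge0.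
  exact: (gaussian_second_moment (mD i) s0 (lawD i)).
rewrite sumEFin sumr_const card_ord lee_fin -[X in X <= _]mulr_natl !mulrA divff ?mul1r//.
Qed.

Lemma martingale_maximal_inequality m (A : set Om) : measurable A ->
  (forall w, A w -> exists2 k, (k <= m)%N & e <= `|martingale k w|) ->
  (P A <= (m%:R * (L ^+ 2 * (8 * s ^+ 2)) / e ^+ 2)%:E)%E.
Proof.
move=> mA HA; have [iS HS] := stopped_second_moment m.
have e20 : 0 < e ^+ 2 by rewrite exprn_gt0.
suff : ((e ^+ 2)%:E * P A <= \int[P]_w (stopped m w ^+ 2)%:E)%E.
  move=> /le_trans /(_ HS); rewrite -[P A]fineK ?fin_num_measure// -EFinM !lee_fin.
  by rewrite ler_pdivlMr// mulrC.
rewrite -integral_cst//.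
apply: (@le_trans _ _ (\int[P]_(w in A) (stopped m w ^+ 2)%:E)%E).
  apply: ge0_le_integral => //.
  - by move=> w _; rewrite lee_fin sqr_ge0.
  - by apply: measurable_funTS; exact: (measurable_int _ iS).
  - move=> w /HA/stopped_exceeds ew; rewrite lee_fin -(real_normK (num_real (stopped m w))).
    by rewrite lerXn2r ?nnegrE// ltW.
by apply: ge0_subset_integral => //; [exact: (measurable_int _ iS)|move=> w _; rewrite lee_fin sqr_ge0].
Qed.

End maximal_inequality.

(** * Expansion along time grids *)

Lemma segment_ucont (R : realType) (h : R -> R) (a b : R) : continuous h ->
  forall e : R, 0 < e -> exists2 d : R, 0 < d &
    forall s u, a <= s <= b -> `|s - u| < d -> `|h s - h u| < e.
Proof.
move=> ch e e0; pose P (d s : R) := forall u, `|s - u| < d -> `|h s - h u| < e.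
have : \forall d \near (0:R)^'+, `[a, b]%classic `<=` P d.
  have /compact_near_coveringP := @segment_compact R a b; apply.
  move=> s _; have e20 : 0 < e / 2 by rewrite divr_gt0.
  have /cvgrPdist_lt/(_ _ e20) := ch s; move=> [r /= r0 Hr].
  have r20 : 0 < r / 2 by rewrite divr_gt0.
  exists (ball s (r / 2), [set d | d < r / 2]) => /=.
    by split; [exact: nbhsx_ballx|exact: nbhs_right_lt].
  move=> [s' d] [/= ss' dr] u s'u; apply: le_lt_trans (ler_distD (h s) _ _) _.
  rewrite (splitr e); apply: ltrD; first by rewrite distrC; apply: Hr; apply: lt_trans ss' _; lra.
  apply: Hr; apply: le_lt_trans (ler_distD s' _ _) _.
  by rewrite (splitr r); apply: ltrD => //; exact: lt_trans dr.
move=> H; have [d [d0 Hd]] := @filter_ex _ _ _ _ (filterI (nbhs_right_gt (0 : R)) H).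
by exists d => // s u sab; apply: Hd; rewrite /= in_itv.
Qed.

Lemma segment_bounded (R : realType) (h : R -> R) (a b : R) : a <= b -> continuous h ->
  exists2 M : R, 0 <= M & forall s, a <= s <= b -> `|h s| <= M.
Proof.
move=> ab ch; have [|c _ Hc] := @EVT_max R (fun s => `|h s|) a b ab.
  apply: continuous_subspaceT => x.
  by apply: (@continuous_comp _ _ _ h Num.norm); [exact: ch|exact: norm_continuous].
by exists `|h c| => // s sab; apply: Hc; rewrite in_itv.
Qed.

Lemma clamp_continuous (R : realType) (T : R) : 0 <= T -> continuous (clamp T).
Proof.
move=> T0 t; apply/cvgrPdist_lt => e e0; exists e => //= s ts.
exact: le_lt_trans (clamp_dist T0 _ _) ts.
Qed.

Lemma deriv_taylor (R : realType) (phi : R -> R) (M : R) : derivable1 phi ->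
  derivable1 (rderiv phi) -> (forall s, `|rderiv (rderiv phi) s| <= M) ->
  forall u v, `|phi v - phi u - rderiv phi u * (v - u)| <= M * (v - u) ^+ 2.
Proof.
move=> d1 d2 hM u v; have [c [_ cu E]] := dq_mvt v u d1.
rewrite -dq_mul E -mulrBl normrM -(real_normK (num_real (v - u))) expr2 mulrA.
rewrite ler_wpM2r//; apply: le_trans (deriv_lipschitz d2 hM _ _) _.
by rewrite ler_wpM2l//; exact: le_trans (hM 0).
Qed.

Lemma ler_sum_ord (R : realDomainType) (f : nat -> R) (k n : nat) : (k <= n)%N ->
  (forall j, 0 <= f j) -> \sum_(j < k) f j <= \sum_(j < n) f j.
Proof.
move=> kn f0; elim: n kn => [|n IH]; first by rewrite leqn0 => /eqP ->.
rewrite leq_eqVlt => /predU1P[->//|]; rewrite ltnS => /IH/le_trans; apply.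
by rewrite big_ord_recr/= lerDl.
Qed.

Section pathwise.
Context {R : realType} (N : nat) (Y W b : 'I_N.+1 -> R -> R) (phi : R -> R) (L M T : R).
Local Notation leb := (@lebesgue_measure R).
Hypotheses (T0 : 0 < T) (d1 : derivable1 phi) (d2 : derivable1 (rderiv phi)).
Hypotheses (phiL : forall s, `|rderiv phi s| <= L) (phiM : forall s, `|rderiv (rderiv phi) s| <= M).
Hypotheses (cY : forall i, continuous (Y i)) (cb : forall i, continuous (b i)).
Hypothesis (bclamp : forall i t, b i (clamp T t) = b i t).
Hypothesis (Yclamp : forall i t, Y i (clamp T t) = Y i t).
Hypothesis YE : forall i t, 0 <= t <= T ->
  Y i t = Y i 0 + W i t + \int[leb]_(r in `[0, t]) b i r.

Local Notation c := (N.+1%:R^-1).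
Definition average_at (t : R) : R := c * \sum_(i < N.+1) phi (Y i t).
(** First-order part of the evolution of the average; the second-order term of Itô's formula is
    treated as an error and controlled by [grid_variation]. *)
Definition average_drift (t : R) : R := c * \sum_(i < N.+1) rderiv phi (Y i t) * b i t.
Definition drift_defect (t : R) : R :=
  average_at t - average_at 0 - \int[leb]_(r in `[0, t]) average_drift r.
Definition grid (m k : nat) : R := k%:R * (T / m.+1%:R).
Definition grid_martingale (m k : nat) : R :=
  \sum_(j < k) c * \sum_(i < N.+1) rderiv phi (Y i (grid m j)) * (W i (grid m j.+1) - W i (grid m j)).
Definition grid_variation (m k : nat) : R :=
  \sum_(j < k) c * \sum_(i < N.+1) (W i (grid m j.+1) - W i (grid m j)) ^+ 2.

Lemma grid_itv m k : (k <= m.+1)%N -> 0 <= grid m k <= T.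
Proof.
move=> km; apply/andP; split; first by rewrite mulr_ge0// divr_ge0// ltW.
by rewrite /grid mulrA ler_pdivrMr// mulrC ler_pM2l// ler_nat.
Qed.

Lemma gridS m k : grid m k.+1 = grid m k + T / m.+1%:R.
Proof. by rewrite /grid -natr1 mulrDl mul1r. Qed.

Lemma average_drift_continuous : continuous average_drift.
Proof.
have cS : continuous (fun t => \sum_(i < N.+1) rderiv phi (Y i t) * b i t).
  apply: continuous_sum => i t; apply: cvgM; last exact: cb.
  by apply: (@continuous_comp _ _ _ (Y i) (rderiv phi)); [exact: cY|exact: derivable_continuous].
by move=> t; apply: cvgM; [exact: cvg_cst|exact: cS].
Qed.

Lemma bounded_clamp (h : R -> R) : continuous h -> (forall t, h (clamp T t) = h t) ->
  exists2 K : R, 0 <= K & forall t, `|h t| <= K.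
Proof.
move=> ch hc; have [K K0 HK] := segment_bounded (ltW T0) ch.
by exists K => // t; rewrite -hc; apply: HK; apply: clamp_itv; exact: ltW.
Qed.

Lemma integral_increment (h : R -> R) (e K s u : R) : continuous h ->
  (forall t, `|h t| <= K) -> 0 <= s <= u -> (forall r, s < r < u -> `|h r - h s| <= e) ->
  `|\int[leb]_(r in `[0, u]) h r - \int[leb]_(r in `[0, s]) h r - h s * (u - s)| <= e * (u - s).
Proof.
move=> ch hK /andP[s0 su] he; have mh : measurable_fun setT h by exact: continuous_measurable_fun.
rewrite (Rintegral_split s0 su mh hK) [X in `|X - _|]addrAC subrr add0r.
exact: (Rintegral_itv_close su mh hK he).
Qed.

Lemma average_le (f g : 'I_N.+1 -> R) (x : R) : (forall i, `|f i| <= g i + x) ->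
  `|c * \sum_(i < N.+1) f i| <= c * \sum_(i < N.+1) g i + x.
Proof.
move=> H; have c0 : 0 < c :> R by rewrite invr_gt0.
rewrite normrM gtr0_norm//; apply: (@le_trans _ _ (c * \sum_(i < N.+1) (g i + x))).
  by rewrite ler_pM2l//; apply: le_trans (ler_norm_sum _ _ _) _; apply: ler_sum => i _; exact: H.
rewrite big_split/= sumr_const card_ord mulrDr -[x *+ _]mulr_natl mulrA mulVf ?mul1r//.
Qed.

(** On one step the Taylor remainder is at most [M * (w + I) ^+ 2 <= 2 * M * (w ^+ 2 + I ^+ 2)],
    with [w] the noise and [I] the integrated drift. The noise part is the grid variation, and [I]
    is of the order of the mesh. The threshold [m0] depends on the path through the size and the
    continuity modulus of its drift. *)
Lemma pathwise_approx (e : R) : 0 < e -> exists m0, forall m k, (m0 <= m)%N -> (k <= m.+1)%N ->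
  `|drift_defect (grid m k) - grid_martingale m k| <= 2 * M * grid_variation m k + e.
Proof.
move=> e0.
have L0 : 0 <= L by exact: le_trans (phiL 0).
have M0 : 0 <= M by exact: le_trans (phiM 0).
have [K K0 HK] : exists2 K : R, 0 <= K & forall i t, `|b i t| <= K.
  have /choice[k Hk] : forall i, exists k : R, 0 <= k /\ forall t, `|b i t| <= k.
    by move=> i; have [k ? ?] := bounded_clamp (@cb i) (bclamp i); exists k.
  exists (\sum_i k i); first by apply: sumr_ge0 => i _; case: (Hk i).
  move=> i t; apply: le_trans ((Hk i).2 t) _; rewrite (bigD1 i)//= lerDl.
  by apply: sumr_ge0 => j _; case: (Hk j).
pose et := e / T; have et0 : 0 < et by rewrite divr_gt0.
(* Error allowed on the drift over one step: it is used [L] times in the Taylor expansion and once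
   in the averaged drift, for a total of half the budget [et] per unit time. *)
pose e1 := Num.min 1 (et / (2 * (L + 1))).
have e10 : 0 < e1 by rewrite lt_min ltr01 divr_gt0// mulr_gt0// ltr_wpDl.
have e11 : e1 <= 1 by rewrite ge_min lexx.
have e1L : (L + 1) * e1 <= et / 2.
  rewrite mulrC -ler_pdivlMr ?ltr_wpDl// ge_min -mulrA -invfM lexx orbT//.
have cj := average_drift_continuous.
have jclamp t : average_drift (clamp T t) = average_drift t.
  by rewrite /average_drift; congr (_ * _); apply: eq_bigr => i _; rewrite bclamp Yclamp.
have [Kj _ HKj] := bounded_clamp cj jclamp.
have [dj dj0 Hdj] := segment_ucont 0 T cj e10.
have /choice[db Hdb] : forall i, exists db : R, 0 < db /\
    forall s u, 0 <= s <= T -> `|s - u| < db -> `|b i s - b i u| < e1.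
  by move=> i; have [x ? ?] := segment_ucont 0 T (@cb i) e10; exists x.
(* The second bound gives the other half of the budget: it makes the squared drift
   [2 * M * ((K + 1) * h) ^+ 2] at most [et / 2 * h]. *)
pose x0 := Num.min dj (et / (4 * M * (K + 1) ^+ 2 + 1)).
pose x := \big[Num.min/x0]_(i < N.+1) db i.
have q0 : 0 < 4 * M * (K + 1) ^+ 2 + 1 by rewrite ltr_wpDl// !mulr_ge0// addr_ge0.
have x00 : 0 < x0 by rewrite lt_min dj0 divr_gt0.
have xp : 0 < x.
  by rewrite /x; elim/big_ind : _ => // [u v u0 v0|i _]; [rewrite lt_min u0|case: (Hdb i)].
have xx0 : x <= x0 by rewrite /x; exact: bigmin_le_id.
have xdb i : x <= db i by rewrite /x; exact: bigmin_le_cond.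
exists (Num.truncn (T / x)) => m k mm km.
have h0 : 0 < T / m.+1%:R by rewrite divr_gt0.
set h := T / m.+1%:R in h0.
have hx : h < x.
  rewrite /h ltr_pdivrMr// mulrC -ltr_pdivrMr//; apply: lt_le_trans (truncnS_gt _) _.
  by rewrite ler_nat ltnS.
have hq : 2 * M * ((K + 1) * h) ^+ 2 <= et / 2 * h.
  have : h <= et / (4 * M * (K + 1) ^+ 2 + 1).
    by apply: le_trans (ltW hx) _; apply: le_trans xx0 _; rewrite ge_min lexx orbT.
  rewrite ler_pdivlMr// => H; have := ler_wpM2r (ltW h0) H; have := sqr_ge0 h.
  move: (h) => y; lra.
have step j : (j < m.+1)%N ->
    `|(drift_defect (grid m j.+1) - drift_defect (grid m j)) -
      c * \sum_(i < N.+1) rderiv phi (Y i (grid m j)) * (W i (grid m j.+1) - W i (grid m j))| <=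
    2 * M * (c * \sum_(i < N.+1) (W i (grid m j.+1) - W i (grid m j)) ^+ 2) + et * h.
  move=> jm; have tT := grid_itv (ltnW jm); have tT' := grid_itv jm.
  have E : grid m j.+1 - grid m j = h by rewrite gridS addrAC subrr add0r.
  have tt' : 0 <= grid m j <= grid m j.+1.
    by case/andP: tT => -> _; rewrite -subr_ge0 E ltW.
  move: E tT tT' tt'; set t := grid m j; set t' := grid m j.+1 => E tT tT' tt'.
  have near_t r : t < r < t' -> `|t - r| < x.
    by move=> /andP[r1 r2]; apply: lt_trans hx; rewrite distrC gtr0_norm ?subr_gt0// -E ltrD2r.
  pose I i := \int[leb]_(r in `[0, t']) b i r - \int[leb]_(r in `[0, t]) b i r.
  have HI i : `|I i - b i t * h| <= e1 * h.
    rewrite /I -E; apply: (@integral_increment _ _ K) => // r /near_t tr.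
    by rewrite distrC ltW//; apply: (Hdb i).2 => //; exact: lt_le_trans (xdb i).
  have HJ : `|\int[leb]_(r in `[0, t']) average_drift r - \int[leb]_(r in `[0, t]) average_drift r
      - average_drift t * h| <= e1 * h.
    rewrite -E; apply: (@integral_increment _ _ Kj) => // r /near_t tr.
    rewrite distrC ltW//; apply: Hdj => //; apply: lt_le_trans tr _.
    by apply: le_trans xx0 _; rewrite ge_min lexx.
  pose p i := rderiv phi (Y i t); pose w i := W i t' - W i t.
  pose f i := phi (Y i t') - phi (Y i t) - p i * (b i t * h) - p i * w i.
  pose X := 2 * M * ((K + 1) * h) ^+ 2 + L * (e1 * h).
  have Hf i : `|f i| <= 2 * M * w i ^+ 2 + X.
    have YW : Y i t' - Y i t = w i + I i by rewrite (YE i tT') (YE i tT) /w /I; ring.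
    have -> : f i = (phi (Y i t') - phi (Y i t) - p i * (Y i t' - Y i t)) + p i * (I i - b i t * h).
      by rewrite YW /f; ring.
    apply: le_trans (ler_normD _ _) _; rewrite /X addrA; apply: lerD; last first.
      by rewrite normrM ler_pM//; exact: phiL.
    apply: le_trans (deriv_taylor d1 d2 phiM _ _) _; rewrite YW.
    have I2 : I i ^+ 2 <= ((K + 1) * h) ^+ 2.
      rewrite -(real_normK (num_real (I i))) lerXn2r ?nnegrE//.
        by rewrite mulr_ge0 ?addr_ge0// ltW.
      rewrite -[I i](subrK (b i t * h)); apply: le_trans (ler_normD _ _) _.
      apply: le_trans (lerD (HI i) (lexx _)) _; rewrite normrM (gtr0_norm h0) -mulrDl.
      by rewrite ler_pM2r// addrC; apply: lerD; first exact: HK.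
    have S : (w i + I i) ^+ 2 <= 2 * w i ^+ 2 + 2 * ((K + 1) * h) ^+ 2.
      by have := sqr_ge0 (w i - I i); move: I2; lra.
    apply: le_trans (ler_wpM2l M0 S) _.
    by rewrite le_eqVlt; apply/orP; left; apply/eqP; ring.
  have := average_le Hf; rewrite -mulr_sumr => A.
  have -> : drift_defect t' - drift_defect t - c * \sum_(i < N.+1) p i * w i =
    c * \sum_(i < N.+1) f i - (\int[leb]_(r in `[0, t']) average_drift r -
      \int[leb]_(r in `[0, t]) average_drift r - average_drift t * h).
    rewrite /drift_defect /average_at /f !sumrB /average_drift.
    under [\sum_(i < N.+1) p i * (b i t * h)]eq_bigr do rewrite mulrA.
    by rewrite -mulr_suml; ring.
  apply: le_trans (ler_normB _ _) _; apply: le_trans (lerD A HJ) _.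
  rewrite [c * (_ * _)]mulrCA -addrA lerD2l /X.
  have := ler_wpM2r (ltW h0) e1L; move: hq; nra.
have : `|drift_defect (grid m k) - grid_martingale m k|
    <= 2 * M * grid_variation m k + k%:R * (et * h).
  elim: k km => [_|k IH km].
    rewrite /grid_martingale /grid_variation !big_ord0 mulr0 mul0r addr0 subr0.
    by rewrite /drift_defect /grid mul0r subrr set_itv1 Rintegral_set1 subrr normr0.
  have := lerD (step k km) (IH (ltnW km)) => /(le_trans (ler_normD _ _)).
  have -> : grid_martingale m k.+1 = grid_martingale m k + c * \sum_(i < N.+1)
    rderiv phi (Y i (grid m k)) * (W i (grid m k.+1) - W i (grid m k)) by exact: big_ord_recr.
  have -> : grid_variation m k.+1 = grid_variation m k + c * \sum_(i < N.+1)
    (W i (grid m k.+1) - W i (grid m k)) ^+ 2 by exact: big_ord_recr.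
  move: (drift_defect (grid m k)) (drift_defect _) (grid_martingale m k) => d0 d1' gm.
  move: (grid_variation m k) (c * _) (c * _) => gv s2 s1 H.
  rewrite (_ : d1' - (gm + s1) = d1' - d0 - s1 + (d0 - gm)); last by ring.
  apply: le_trans H _; rewrite -(natr1 k) le_eqVlt; apply/orP; left; apply/eqP; ring.
move=> /le_trans; apply; rewrite lerD2l.
apply: (@le_trans _ _ (m.+1%:R * (et * h))).
  by apply: ler_wpM2r; [rewrite mulr_ge0// ltW|rewrite ler_nat].
by rewrite mulrCA /h [m.+1%:R * _]mulrC /et !divfK ?gt_eqF// pnatr_eq0.
Qed.

(** Of the defect [4 * e], moving [t] to a grid point costs [e] and the expansion costs another [e];
    the remaining [2 * e] must be shared by the martingale and the variation. *)
Lemma pathwise_dichotomy (e t : R) : 0 < e -> 0 <= t <= T -> 4 * e < `|drift_defect t| ->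
  exists m0, forall m, (m0 <= m)%N ->
    (exists2 k, (k <= m.+1)%N & e <= `|grid_martingale m k|) \/
    e <= 2 * M * grid_variation m m.+1.
Proof.
move=> e0 /andP[t0 tT] Et.
have cA : continuous average_at.
  have cS : continuous (fun t => \sum_(i < N.+1) phi (Y i t)).
    apply: continuous_sum => i; move=> s.
    by apply: (@continuous_comp _ _ _ (Y i) phi); [exact: cY|exact: derivable_continuous].
  by move=> s; apply: cvgM; [exact: cvg_cst|exact: cS].
have cj := average_drift_continuous.
have jclamp s : average_drift (clamp T s) = average_drift s.
  by rewrite /average_drift; congr (_ * _); apply: eq_bigr => i _; rewrite bclamp Yclamp.
have [Kj Kj0 HKj] := bounded_clamp cj jclamp.
have mj : measurable_fun setT average_drift by exact: continuous_measurable_fun.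
have e20 : 0 < e / 2 by rewrite divr_gt0.
have /cvgrPdist_lt/(_ _ e20)[x /= x0 Hx] := cA t.
have [m1 Hm1] := pathwise_approx e0.
pose y := Num.min x (e / (2 * (Kj + 1))).
have y0 : 0 < y by rewrite lt_min x0 divr_gt0// mulr_gt0// ltr_wpDl.
exists (maxn m1 (Num.truncn (T / y))) => m; rewrite geq_max => /andP[mm1 my].
have h0 : 0 < T / m.+1%:R by rewrite divr_gt0.
have hy : T / m.+1%:R < y.
  rewrite ltr_pdivrMr// mulrC -ltr_pdivrMr//; apply: lt_le_trans (truncnS_gt _) _.
  by rewrite ler_nat ltnS.
pose k := Num.truncn (t / (T / m.+1%:R)).
have q0 : 0 <= t / (T / m.+1%:R) by rewrite divr_ge0// ltW.
have /andP[k1 k2] := truncn_itv q0; rewrite -/k in k1 k2.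
rewrite ler_pdivlMr// -/(grid m k) in k1.
rewrite ltr_pdivrMr// -/(grid m k.+1) gridS in k2.
have km : (k <= m.+1)%N.
  rewrite -(ler_nat R) -(ler_pM2r h0) -/(grid m k); apply: le_trans k1 (le_trans tT _).
  by rewrite mulrC divfK// pnatr_eq0.
have tk : `|t - grid m k| < y.
  by rewrite ger0_norm ?subr_ge0//; apply: le_lt_trans hy; rewrite lerBlDl ltW.
have gk0 : 0 <= grid m k by case/andP: (grid_itv km).
have H1 : `|average_at t - average_at (grid m k)| < e / 2.
  by apply: Hx; apply: lt_le_trans tk _; rewrite ge_min lexx.
have H2 : `|\int[leb]_(r in `[0, t]) average_drift r -
    \int[leb]_(r in `[0, grid m k]) average_drift r| <= e / 2.
  rewrite (Rintegral_split gk0 k1 mj HKj) addrAC subrr add0r.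
  have HK u : grid m k < u < t -> `|average_drift u - 0| <= Kj by rewrite subr0.
  have := Rintegral_itv_close k1 mj HKj HK; rewrite mul0r subr0 => /le_trans; apply.
  move: tk; rewrite ger0_norm ?subr_ge0// /y lt_min => /andP[_].
  rewrite ltr_pdivlMr ?mulr_gt0 ?ltr_wpDl// => H; have := k1; nra.
have H3 : 3 * e < `|drift_defect (grid m k)|.
  have : `|drift_defect t - drift_defect (grid m k)| <= e.
    rewrite /drift_defect (_ : _ - _ = (average_at t - average_at (grid m k)) -
      (\int[leb]_(r in `[0, t]) average_drift r - \int[leb]_(r in `[0, grid m k]) average_drift r)); last by ring.
    by apply: le_trans (ler_normB _ _) _; rewrite (splitr e); apply: lerD => //; exact: ltW.
  have := lerB_dist (drift_defect t) (drift_defect (grid m k)).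
  by move: Et; move: (`|_|) (`|_|) (`|_|) => p q r; lra.
have [em|em] := leP e `|grid_martingale m k|; first by left; exists k.
right; have := Hm1 m k mm1 km; have := lerB_dist (drift_defect (grid m k)) (grid_martingale m k).
have : 2 * M * grid_variation m k <= 2 * M * grid_variation m m.+1.
  apply: ler_wpM2l; first by rewrite mulr_ge0//; exact: le_trans (phiM 0).
  apply: (@ler_sum_ord R (fun j => c * \sum_(i < N.+1) (W i (grid m j.+1) - W i (grid m j)) ^+ 2)) => // j.
  rewrite mulr_ge0 ?invr_ge0//.
  by apply: sumr_ge0 => i _; exact: sqr_ge0.
move: H3 em; move: (`|_|) (`|_|) (`|_|) (2 * M * _) (2 * M * _) => p q r u v; lra.
Qed.

End pathwise.

Lemma within_continuous_comp (R : realType) (f h : R -> R) (A : set R) :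
  {within A, continuous f} -> continuous h -> (forall t, A (h t)) -> continuous (f \o h).
Proof.
move=> /subspace_continuousP cf ch hA t U Uf.
have /= := ch t _ (cf (h t) (hA t) U Uf); rewrite /nbhs/= => H.
by apply: (@filterS _ (nbhs t) _ _ _ _ H) => s /= Hs; exact: Hs (hA s).
Qed.

Lemma Rintegral_scale (R : realType) (f : R -> R) (c u : R) : continuous f -> 0 < c -> 0 <= u ->
  \int[@lebesgue_measure R]_(r in `[0, (u / c)]) f r =
  \int[@lebesgue_measure R]_(r in `[0, u]) (f (r / c) / c).
Proof.
rewrite le_eqVlt => cf c0 /predU1P[<-|u0]; first by rewrite mul0r !set_itv1 !Rintegral_set1.
have D (t : R) : is_derive t 1 (fun t : R => t / c) c^-1.
  have := @is_deriveM R R _ _ t 1 1 0 (is_derive_id t 1) (is_derive_cst c^-1 t 1).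
  by rewrite /GRing.scale/= mulr0 add0r mulr1; exact.
have dF : derive1 (fun t : R => t / c) = cst c^-1.
  by apply/funext => t; rewrite derive1E; apply: derive_val.
rewrite -[X in `[X, _]](mul0r c^-1) /Rintegral; congr fine.
rewrite (@integration_by_substitution_increasing R (fun t => t / c)) ?dF//.
- exact: ltW.
- by move=> x y _ _; rewrite ltr_pM2r ?invr_gt0.
- by move=> x _; exact: cvg_cst.
- exact: is_cvg_cst.
- exact: is_cvg_cst.
- have cF : continuous (fun t : R => t / c).
    by move=> t; apply: cvgM; [exact: cvg_id|exact: cvg_cst].
  split.
  + by move=> t _; apply/ex_derive.
  + by apply: cvg_at_right_filter; exact: cF.
  + by apply: cvg_at_left_filter; exact: cF.
- exact: continuous_subspaceT.
Qed.

(** * Symmetrisation of the particle drift *)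

Section dyson_paths.
Context {R : realType} (l : R) (g : R -> R[i]).
Hypotheses (jg : jordan_arclength l g) (cg : C2 g).
Local Notation x := (re_path g).
Local Notation y := (im_path g).
Let l0 := jordan_length_gt0 jg.
Let xC2 := (jordan_C2per jg cg).1.
Let yC2 := (jordan_C2per jg cg).2.
Local Notation K := (dyson_kernel x y).

Lemma chamber_distinct (N : nat) (X : 'I_N -> R) (i j : 'I_N) : chamber l X -> i != j ->
  (x (X i) == x (X j)) && (y (X i) == y (X j)) = false.
Proof.
move=> [H1 H2] ij; apply/negP => /andP[/eqP ex /eqP ey].
have := jordan_inj jg _ ex ey => /(_ _).
have lij : `|X i - X j| < l.
  by rewrite ltr_distl; apply/andP; split; [rewrite ltrBlDr|]; exact: H2.
move=> /(_ lij) E; have : (i < j)%N || (j < i)%N.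
  by rewrite -neq_ltn.
by case/orP => /H1; rewrite E ltxx.
Qed.

Lemma dyson_driftE (N : nat) (X : 'I_N -> R) i :
  dyson_drift g X i = \sum_(j < N | j != i) tan_kernel x y (X i) (X j).
Proof. by apply: eq_bigr => j _; exact: Re_tangent_kernel. Qed.

Lemma dyson_drift_continuous (N : nat) (Y : 'I_N -> R -> R) i :
  (forall j, continuous (Y j)) -> (forall t, chamber l (fun j => Y j t)) ->
  continuous (fun t => dyson_drift g (fun j => Y j t) i).
Proof.
move=> cY HY; rewrite (_ : (fun _ => _) =
  fun t => \sum_(j <- enum 'I_N) if j != i then tan_kernel x y (Y i t) (Y j t) else 0); last first.
  by apply/funext => t; rewrite dyson_driftE big_mkcond/= big_enum.
apply: continuous_sum => j; case: (boolP (j != i)) => ji; last exact: cst_continuous.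
have [_ dx ddx _] := xC2; have [_ dy ddy _] := yC2.
have cc (h : R -> R) k : continuous h -> continuous (h \o Y k).
  by move=> ch t; apply: (@continuous_comp _ _ _ (Y k) h); [exact: cY|exact: ch].
have cx := cc _ _ (derivable_continuous dx); have cy := cc _ _ (derivable_continuous dy).
have cdx := cc _ _ (derivable_continuous ddx); have cdy := cc _ _ (derivable_continuous ddy).
move=> t; apply: cvgM.
  by apply: cvgD; (apply: cvgM; [|apply: cvgB]); [exact: cdx|exact: cx|exact: cx|exact: cdy|exact: cy|exact: cy].
have := chamber_distinct (HY t) ji; rewrite eq_sym [y _ == _]eq_sym => ne.
apply: cvgV.
  apply: contraFN ne; rewrite /sqdist paddr_eq0 ?sqr_ge0// !sqrf_eq0 !subr_eq0.
  by rewrite (eq_sym (y _)).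
by apply: cvgD; (apply: cvgM; apply: cvgB); [exact: cx|exact: cx|exact: cx|exact: cx|exact: cy|exact: cy|exact: cy|exact: cy].
Qed.

(** Exchanging the two particles turns the sum of singular terms into half a sum of the symmetric
    kernel. The mean drift also contains the diagonal pairs, each contributing [phi''], which is the
    error of order [1 / n.+1]. *)
Lemma average_dyson_drift (n : nat) (X : 'I_n.+1 -> R) (phi : R -> R) (beta M : R) :
  C2per l phi -> (forall s, `|rderiv (rderiv phi) s| <= M) -> chamber l X -> 0 <= beta ->
  `|n.+1%:R^-1 * \sum_(i < n.+1) rderiv phi (X i) * (beta / 2 * dyson_drift g X i / n.+1%:R)
    - beta / 4 * mean_drift jg phi (empirical (fun i => on_curve g (X i)))| <=
  beta / 4 * M / n.+1%:R.
Proof.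
move=> Cphi HM cX b0; rewrite (mean_drift_empirical jg cg Cphi).
set N := n.+1%:R; have N0 : 0 < N by rewrite ltr0n.
pose p i := rderiv phi (X i); pose k i j := tan_kernel x y (X i) (X j).
have KE i j : j != i -> K phi (X i) (X j) = p i * k i j + p j * k j i.
  by rewrite eq_sym => ij; rewrite /dyson_kernel (chamber_distinct cX ij).
have Kd i : K phi (X i) (X i) = rderiv (rderiv phi) (X i) by rewrite /dyson_kernel !eqxx.
pose S := \sum_(i < n.+1) \sum_(j < n.+1 | j != i) p i * k i j.
have E1 : \sum_(i < n.+1) rderiv phi (X i) * (beta / 2 * dyson_drift g X i / N) = beta / 2 / N * S.
  rewrite /S mulr_sumr; apply: eq_bigr => i _; rewrite dyson_driftE -mulr_sumr -/(p i).
  by rewrite /k; ring.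
have E2 : \sum_(i < n.+1) \sum_(j < n.+1 | j != i) K phi (X i) (X j) = 2 * S.
  have -> : 2 * S = S + \sum_(i < n.+1) \sum_(j < n.+1 | j != i) p j * k j i.
    rewrite mulr2n mulrDl !mul1r; congr (_ + _); rewrite /S.
    rewrite (exchange_big_dep xpredT)//=; apply: eq_bigr => i _.
    by apply: eq_bigl => j; rewrite eq_sym.
  rewrite /S -big_split/=; apply: eq_bigr => i _; rewrite -big_split/=.
  by apply: eq_bigr => j; exact: KE.
have E3 : \sum_(i < n.+1) (N^-1 * \sum_(j < n.+1) K phi (X i) (X j)) =
    N^-1 * (2 * S + \sum_(i < n.+1) rderiv (rderiv phi) (X i)).
  rewrite -E2 -mulr_sumr -big_split/=; congr (_ * _); apply: eq_bigr => i _.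
  by rewrite (bigD1 i)//= Kd addrC.
rewrite E1 E3.
have -> : N^-1 * (beta / 2 / N * S) - beta / 4 * (N^-1 * (N^-1 *
    (2 * S + \sum_(i < n.+1) rderiv (rderiv phi) (X i)))) =
    - (beta / 4 / N * (N^-1 * \sum_(i < n.+1) rderiv (rderiv phi) (X i))) by field; exact: lt0r_neq0.
have bN : 0 <= beta / 4 / N by rewrite !divr_ge0// ltW.
rewrite normrN normrM (ger0_norm bN) [leRHS]mulrAC; apply: ler_wpM2l => //.
have := @average_le R n (fun i => rderiv (rderiv phi) (X i)) (fun _ => 0) M.
have -> : \sum_(i < n.+1) (0 : R) = 0 by rewrite big1.
by rewrite mulr0 !add0r; apply.
Qed.

End dyson_paths.

Lemma markov_ge0 (R : realType) (d : measure_display) (Om : measurableType d)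
    (P : probability Om R) (f : Om -> R) (A : set Om) (e : R) :
  measurable_fun setT f -> (forall w, 0 <= f w) -> measurable A -> 0 <= e ->
  (forall w, A w -> e <= f w) -> (e%:E * P A <= \int[P]_w (f w)%:E)%E.
Proof.
move=> mf f0 mA e0 Af; rewrite -integral_cst//.
apply: (@le_trans _ _ (\int[P]_(w in A) (f w)%:E)%E).
  by apply: ge0_le_integral => //; apply/measurable_EFinP; exact: measurable_funTS.
by apply: ge0_subset_integral => //; [exact/measurable_EFinP|move=> w _; rewrite lee_fin].
Qed.

(** * Probability of a large defect for a fixed number of particles *)

Section defect_probability.
Context {R : realType} (l : R) (g : R -> R[i]).
Hypotheses (jg : jordan_arclength l g) (cg : C2 g).
Context {d : measure_display} {Om : measurableType d} (P : probability Om R).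
Variables (n : nat) (B X : 'I_n.+1 -> R -> Om -> R) (beta : R).
Hypothesis (beta0 : 0 <= beta).
Hypothesis HD : dyson_bm P l g beta B X.
Variables (phi : R -> R) (L M T : R).
Hypotheses (Cphi : C2per l phi) (T0 : 0 < T).
Hypotheses (phiL : forall s, `|rderiv phi s| <= L) (phiM : forall s, `|rderiv (rderiv phi) s| <= M).
Local Notation N := (n.+1%:R).
Local Notation leb := (@lebesgue_measure R).

Definition slow_X (w : Om) i (t : R) : R := X i (clamp T t / N) w.
Definition slow_B (w : Om) i (t : R) : R := B i (t / N) w.
(** The division by [N] is the Jacobian of the time change; the mean-field normalisation of the
    interaction comes from it. *)
Definition slow_drift (w : Om) i (t : R) : R :=
  beta / 2 * dyson_drift g (fun j => slow_X w j t) i / N.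
Definition good_path (w : Om) : Prop :=
  (forall t, 0 <= t -> chamber l (fun i => X i t w)) /\
  (forall t, 0 <= t -> forall i, X i t w = X i 0 w + B i t w + beta / 2 *
    \int[leb]_(r in `[0, t]) dyson_drift g (fun j => X j r w) i).

Let N0 : 0 < N :> R. Proof. by rewrite ltr0n. Qed.

Lemma good_path_ae : {ae P, forall w, good_path w}.
Proof. by case: HD => _ _ _ H1 H2; apply: filterS2 H1 H2. Qed.

Lemma slow_X_continuous w i : continuous (slow_X w i).
Proof.
have [[_ [_ cX]] _ _ _ _] := HD.
apply: (within_continuous_comp (cX i w)) => [t|t].
  by apply: cvgM; [exact: (clamp_continuous (ltW T0))|exact: cvg_cst].
rewrite /= in_itv/= andbT divr_ge0//.
by have /andP[] := clamp_itv (ltW T0) t.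
Qed.

Lemma slow_X_chamber w t : good_path w -> chamber l (fun i => slow_X w i t).
Proof.
move=> [H _]; apply: H; rewrite divr_ge0//.
by have /andP[] := clamp_itv (ltW T0) t.
Qed.

Lemma clampK t : clamp T (clamp T t) = clamp T t.
Proof. exact/clamp_id/clamp_itv/ltW. Qed.

Lemma slow_X_clamp w i t : slow_X w i (clamp T t) = slow_X w i t.
Proof. by rewrite /slow_X clampK. Qed.

Lemma slow_drift_clamp w i t : slow_drift w i (clamp T t) = slow_drift w i t.
Proof.
rewrite /slow_drift (_ : (fun j => slow_X w j (clamp T t)) = fun j => slow_X w j t)//.
by apply/funext => j; rewrite slow_X_clamp.
Qed.

Lemma slow_drift_continuous w i : good_path w -> continuous (slow_drift w i).
Proof.
move=> gw t; apply: cvgM; last exact: cvg_cst.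
apply: cvgM; first exact: cvg_cst.
apply: (dyson_drift_continuous jg cg); first exact: slow_X_continuous.
by move=> s; exact: slow_X_chamber.
Qed.

Lemma slow_sde w i t : good_path w -> 0 <= t <= T ->
  slow_X w i t = slow_X w i 0 + slow_B w i t + \int[leb]_(r in `[0, t]) slow_drift w i r.
Proof.
move=> gw /andP[t0 tT].
have -> : slow_X w i t = X i (t / N) w by rewrite /slow_X clamp_id// t0.
have -> : slow_X w i 0 = X i 0 w by rewrite /slow_X clamp_id ?mul0r// lexx ltW.
rewrite gw.2 ?divr_ge0//; congr (_ + _).
pose F r := dyson_drift g (fun j => slow_X w j (r * N)) i.
have cF0 : continuous (fun t => dyson_drift g (fun j => slow_X w j t) i).
  apply: (dyson_drift_continuous jg cg); first exact: slow_X_continuous.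
  by move=> s; exact: slow_X_chamber.
have cF : continuous F.
  move=> r; apply: (@continuous_comp _ _ _ (fun r : R => r * N)
    (fun t : R => dyson_drift g (fun j => slow_X w j t) i)); last exact: cF0.
  by apply: cvgM; [exact: cvg_id|exact: cvg_cst].
have -> : \int[leb]_(r in `[0, (t / N)]) dyson_drift g (fun j => X j r w) i =
    \int[leb]_(r in `[0, (t / N)]) F r.
  apply: eq_Rintegral => r; rewrite inE/= in_itv/= => /andP[r0 rt]; congr dyson_drift.
  apply/funext => j; rewrite /slow_X clamp_id ?mulfK ?gt_eqF//.
  rewrite mulr_ge0//=; apply: le_trans tT.
  by rewrite -ler_pdivlMr.
rewrite Rintegral_scale// -RintegralZl//; last first.
  apply: (@continuous_compact_integrable R); first exact: segment_compact.
  apply: continuous_subspaceT => r; apply: cvgM; last exact: cvg_cst.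
  apply: (@continuous_comp _ _ _ (fun r : R => r / N) F); last exact: cF.
  by apply: cvgM; [exact: cvg_id|exact: cvg_cst].
by apply: eq_Rintegral => r _; rewrite /F /slow_drift divfK ?gt_eqF// mulrA.
Qed.

Local Notation tk m k := (grid T m k).
Let D m i k (w : Om) : measurableTypeR R := slow_B w i (tk m k.+1) - slow_B w i (tk m k).
Let a m i k (w : Om) : measurableTypeR R := rderiv phi (slow_X w i (tk m k)).
Let sd m : R := Num.sqrt (T / m.+1%:R / N).

Let sd0 m : 0 < sd m. Proof. by rewrite sqrtr_gt0 !divr_gt0. Qed.

Let sd2 m : sd m ^+ 2 = T / m.+1%:R / N.
Proof. by rewrite sqr_sqrtr// !divr_ge0// ltW. Qed.

Let tk0 m k : 0 <= tk m k / N.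
Proof. by rewrite divr_ge0// mulr_ge0// divr_ge0// ltW. Qed.

Let tkS m k : tk m k / N < tk m k.+1 / N.
Proof. by rewrite ltr_pM2r ?invr_gt0// gridS ltrDl divr_gt0. Qed.

Let indepD m i k A U : past P B X (tk m k / N) A -> measurable U ->
  P (A `&` (D m i k @^-1` U)) = (P A * normal_prob 0 (sd m) U)%E.
Proof.
have [[BM mX] XB _ _ _] := HD => HA mU.
have E : tk m k.+1 / N - tk m k / N = T / m.+1%:R / N.
  by rewrite -mulrBl gridS addrAC subrr add0r.
have H := past_increment_indep BM mX XB i (tk0 m k) (tkS m k) HA mU.
by rewrite E in H; exact: H.
Qed.

Let mD m i k : measurable_fun setT (D m i k).
Proof.
have [[[[mB _] _ _] _] _ _ _ _] := HD.
by apply: measurable_funB; apply: mB; exact: tk0.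
Qed.

Let ma m i k : measurable_fun setT (a m i k).
Proof.
have [[_ [mX _]] _ _ _ _] := HD; have [_ _ d2 _] := Cphi.
apply: (@measurableT_comp _ _ _ _ _ _ (rderiv phi) _ (fun w => slow_X w i (tk m k))).
  by apply: continuous_measurable_fun; exact: derivable_continuous.
by apply: mX; rewrite divr_ge0//; have /andP[] := clamp_itv (ltW T0) (tk m k).
Qed.

Let mmart m k : measurable_fun setT (martingale (D m) (a m) k).
Proof.
apply: measurable_sum => j; apply: measurable_funM => //; apply: measurable_sum => i.
by apply: measurable_funM; [exact: ma|exact: mD].
Qed.

Let mvar m k : measurable_fun setT (fun w => grid_variation (slow_B w) T m k).
Proof.
apply: measurable_sum => j; apply: measurable_funM => //; apply: measurable_sum => i.
by apply: measurable_funX; exact: mD.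
Qed.

Variable e : R.
Hypothesis e0 : 0 < e.

Let U m : set Om := [set w | exists2 k, (k <= m.+1)%N & e <= `|martingale (D m) (a m) k w|].
Let V m : set Om := [set w | e <= 2 * M * grid_variation (slow_B w) T m m.+1].

Let mU m : measurable (U m).
Proof.
rewrite (_ : U m = \big[setU/set0]_(k < m.+2) [set w | e <= `|martingale (D m) (a m) k w|]); last first.
  rewrite -(bigcup_mkord m.+2 (fun k => [set w | e <= `|martingale (D m) (a m) k w|])).
  by apply/seteqP; split => w [k km ek]; exists k.
apply: bigsetU_measurable => k _; rewrite -[[set w | _]]setTI.
by apply: measurable_fun_ler => //; apply: measurableT_comp => //; exact: mmart.
Qed.

Let mV m : measurable (V m).
Proof.
rewrite -[V m]setTI; apply: measurable_fun_ler => //; apply: measurable_funM => //; exact: mvar.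
Qed.

(** There are [m.+1] increments of variance [T / m.+1 / N]: the mesh cancels and the factor [1 / N]
    of the time change remains. *)
Let PU m : (P (U m) <= (8 * L ^+ 2 * T / (N * e ^+ 2))%:E)%E.
Proof.
have [[BM mX] XB Xad _ _] := HD.
have -> : 8 * L ^+ 2 * T / (N * e ^+ 2) = m.+1%:R * (L ^+ 2 * (8 * sd m ^+ 2)) / e ^+ 2.
  by rewrite sd2; field; rewrite !gt_eqF.
pose F k := past P B X (tk m k / N).
have sF k : sigma_algebra setT (F k) by exact: past_sigma_algebra.
have Fmono k : F k `<=` F k.+1 by apply: past_mono; exact/ltW/tkS.
have Fm k : F k `<=` measurable by move=> A [].
have FD i k (W : set (measurableTypeR R)) : measurable W -> F k.+1 (D m i k @^-1` W).
  move=> mW; have mB j : (j <= k.+1)%N ->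
      measurable_fun setT (slow_B ^~ i ^~ (tk m j) : g_sigma_algebraType (F k.+1) -> R).
    move=> jk _ Z mZ; rewrite setTI; apply: sub_sigma_algebra.
    apply: (past_B X BM) => //; rewrite ler_pM2r ?invr_gt0// ler_wpM2r ?ler_nat//.
    by rewrite divr_ge0// ltW.
  have := measurable_funB (mB k.+1 (leqnn _)) (mB k (leqnSn k)) => /(_ measurableT W mW).
  by rewrite setTI /measurable/= (sigma_algebra_id (sF k.+1)).
have Fa i k (W : set (measurableTypeR R)) : measurable W -> F k (a m i k @^-1` W).
  move=> mW; have [_ _ d2 _] := Cphi; apply: (@past_X _ _ _ P _ B X mX Xad i _ _ (rderiv phi @^-1` W)).
  - by rewrite divr_ge0//; have /andP[] := clamp_itv (ltW T0) (tk m k).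
  - rewrite ler_pM2r ?invr_gt0// /clamp ge_max ge_min lexx orbT andbT.
    by rewrite mulr_ge0// divr_ge0// ltW.
  - have mf : measurable_fun setT (rderiv phi).
      by apply: continuous_measurable_fun; exact: derivable_continuous.
    by rewrite -[_ @^-1` _]setTI; exact: mf.
have aL i k w : `|a m i k w| <= L by exact: phiL.
exact: (@martingale_maximal_inequality _ _ _ P n F (D m) (a m) (sd m) L (sd0 m) sF Fmono Fm FD Fa aL
  (fun i k A W => @indepD m i k A W) e e0 m.+1 (U m) (mU m) (fun w Uw => Uw)).
Qed.

(** Markov's inequality; the expected grid variation is bounded by the number of steps times the
    second-moment bound, again free of the mesh. *)
Let PV m : (P (V m) <= (16 * M * T / (N * e))%:E)%E.
Proof.
have M0 : 0 <= M by exact: le_trans (phiM 0).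
have var0 w : 0 <= grid_variation (slow_B w) T m m.+1.
  by apply: sumr_ge0 => j _; rewrite mulr_ge0 ?invr_ge0//; apply: sumr_ge0 => i _; exact: sqr_ge0.
have H : (\int[P]_w (2 * M * grid_variation (slow_B w) T m m.+1)%:E <= (16 * M * T / N)%:E)%E.
  have E w : (2 * M * grid_variation (slow_B w) T m m.+1)%:E =
      ((2 * M * N^-1)%:E * \sum_(j < m.+1) \sum_(i < n.+1) (D m i j w ^+ 2)%:E)%E.
    rewrite /grid_variation -mulr_sumr mulrA EFinM -sumEFin; congr (_ * _)%E.
    by apply: eq_bigr => j _; rewrite -sumEFin.
  have mD2 i j : measurable_fun setT (fun w => (D m i j w ^+ 2)%:E).
    by apply/measurable_EFinP/measurable_funX; exact: mD.
  have D20 i j w : (0 <= (D m i j w ^+ 2)%:E)%E by rewrite lee_fin sqr_ge0.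
  under eq_integral do rewrite E.
  rewrite ge0_integralZl_EFin//; last 3 first.
  - by move=> w _; apply: sume_ge0 => j _; exact: sume_ge0.
  - by apply: emeasurable_sum => j; exact: emeasurable_sum.
  - by rewrite !mulr_ge0 ?invr_ge0.
  rewrite ge0_integral_sum//; last 2 first.
  - by move=> j; exact: emeasurable_sum.
  - by move=> j w _; exact: sume_ge0.
  apply: (@le_trans _ _ ((2 * M * N^-1)%:E * \sum_(j < m.+1) \sum_(i < n.+1) (8 * sd m ^+ 2)%:E)%E).
    apply: lee_wpmul2l; first by rewrite lee_fin !mulr_ge0 ?invr_ge0.
    apply: lee_sum => j _; rewrite ge0_integral_sum//; apply: lee_sum => i _.
    apply: (gaussian_second_moment (mD m i j) (sd0 m)) => W mW.
    have [sT0 sTC _] := past_sigma_algebra P B X (tk m j / N).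
    rewrite -[D m i j @^-1` W]setTI indepD ?probability_setT ?mul1e//.
    by rewrite -(setD0 setT); exact: sTC.
  rewrite !sumEFin -EFinM lee_fin !sumr_const !card_ord sd2.
  rewrite -[X in _ * (X *+ _)]mulr_natl -[X in _ * X]mulr_natl.
  by rewrite le_eqVlt; apply/orP; left; apply/eqP; field; rewrite !gt_eqF.
have mf : measurable_fun setT (fun w => 2 * M * grid_variation (slow_B w) T m m.+1).
  by apply: measurable_funM => //; exact: mvar.
have f0 w : 0 <= 2 * M * grid_variation (slow_B w) T m m.+1 by rewrite !mulr_ge0.
have := le_trans (markov_ge0 P mf f0 (mV m) (ltW e0) (fun w Vw => Vw)) H.
rewrite -[P (V m)]fineK ?fin_num_measure// -EFinM !lee_fin [N * e]mulrC invfM mulrA.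
by move=> Hp; rewrite -mulrA [e^-1 * _]mulrC mulrA ler_pdivlMr// mulrC.
Qed.

(** A path with a large defect belongs to [U m] or [V m] for all large [m], from a rank that depends
    on the path. The exceptional set is therefore the lower limit of these events, and it inherits
    their bound, uniform in [m]. It is measurable without reference to a supremum over times. *)
Lemma defect_probability : exists A : set Om, [/\ measurable A,
  (P A <= (8 * L ^+ 2 * T / (N * e ^+ 2) + 16 * M * T / (N * e))%:E)%E &
  forall w, ~ A w -> good_path w /\ forall t, 0 <= t <= T ->
    `|drift_defect (slow_X w) (slow_drift w) phi t| <= 4 * e].
Proof.
set C := _%:E; have [_ d1 d2 _] := Cphi.
(* [G] increases with [m0] and is contained in [U m0] or [V m0]; its union has measure the limit of
   the measures. *)
pose G m0 := \bigcap_(m in [set m | (m0 <= m)%N]) (U m `|` V m).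
have mG m0 : measurable (G m0).
  by apply: bigcap_measurable => [|m _]; [exists m0 => /=|exact: measurableU].
have PG m0 : (P (G m0) <= C)%E.
  apply: (@le_trans _ _ (P (U m0 `|` V m0))).
    by apply: le_measure; rewrite ?inE//; [exact: measurableU|move=> w; apply => /=].
  apply: le_trans (measureU2 _ (mU m0) (mV m0)) _.
  by rewrite /C EFinD; apply: leeD; [exact: PU|exact: PV].
have [Z [mZ Z0 HZ]] := good_path_ae.
have mUG : measurable (\bigcup_m0 G m0) by exact: bigcupT_measurable.
exists (Z `|` \bigcup_m0 G m0); split; first exact: measurableU.
  apply: le_trans (measureU2 _ mZ mUG) _; rewrite -[leRHS]add0e; apply: leeD.
    by rewrite le_eqVlt; apply/orP; left; apply/eqP; exact: Z0.
  have ndG : nondecreasing_seq G.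
    move=> i j ij; apply/subsetPset => w Gw m /= jm; apply: Gw => /=; exact: leq_trans jm.
  have E : limn (fun k => P (G k)) = P (\bigcup_m0 G m0).
    by apply: cvg_lim => //; exact: nondecreasing_cvg_mu.
  apply: (@le_trans _ _ (limn (fun k => P (G k)))); first by rewrite E; exact: lexx.
  apply: lime_le; last exact: nearW.
  by apply: ereal_nondecreasing_is_cvgn => i j ij; apply: le_measure; rewrite ?inE//; exact/subsetPset/ndG.
move=> w; rewrite not_orE => -[nZ nG].
have gw : good_path w by apply: contrapT => bw; apply: nZ; exact: HZ.
split => // t tT; rewrite leNgt; apply/negP => Et; apply: nG.
have [m0 Hm0] := pathwise_dichotomy T0 d1 d2 phiL phiM (@slow_X_continuous w)
  (fun i => @slow_drift_continuous w i gw) (slow_drift_clamp w) (slow_X_clamp w)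
  (fun i t => slow_sde i gw) e0 tT Et.
exists m0; first by [].
move=> m mm; have [[k km ek]|ev] := Hm0 m mm; last by right.
by left; exists k.
Qed.

End defect_probability.

Section continuous_integrals.
Context {R : realType}.
Local Notation leb := (@lebesgue_measure R).

Lemma Rintegral_dist (f1 f2 : R -> R) (a b e : R) : a <= b ->
  {within `[a, b], continuous f1} -> {within `[a, b], continuous f2} ->
  (forall u, a <= u <= b -> `|f1 u - f2 u| <= e) ->
  `|\int[leb]_(u in `[a, b]) f1 u - \int[leb]_(u in `[a, b]) f2 u| <= e * (b - a).
Proof.
move=> ab c1 c2 H; have cpt := @segment_compact R a b.
have i1 := continuous_compact_integrable cpt c1.
have i2 := continuous_compact_integrable cpt c2.
have mi : measurable `[a, b]%classic by exact: measurable_itv.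
have i12 : leb.-integrable `[a, b] (EFin \o (fun u => f1 u - f2 u)).
  by apply: (continuous_compact_integrable cpt) => u; exact: cvgB (c1 u) (c2 u).
rewrite -RintegralB//; apply: le_trans (le_normr_Rintegral _ _) _ => //.
have len : fine (leb `[a, b]%classic) = b - a.
  rewrite /= lebesgue_measure_itv /= lte_fin; case: ltP => [//|ba].
  by rewrite (@le_anti _ _ a b) ?ab ?ba// subrr.
rewrite -len -Rintegral_cst//; apply: le_Rintegral => //.
- exact: integrable_norm.
- by apply: (continuous_compact_integrable cpt); apply: continuous_subspaceT; exact: cst_continuous.
Qed.

Lemma Rintegral_norm_le (f : R -> R) (a b e : R) : a <= b ->
  {within `[a, b], continuous f} -> (forall u, a <= u <= b -> `|f u| <= e) ->
  `|\int[leb]_(u in `[a, b]) f u| <= e * (b - a).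
Proof.
move=> ab c1 H; have := @Rintegral_dist f (fun _ => 0) a b e ab c1.
rewrite Rintegral_cst// mul0r subr0; apply.
  by apply: continuous_subspaceT; exact: cst_continuous.
by move=> u uab; rewrite subr0; exact: H.
Qed.

Lemma Rintegral_segment_split (f : R -> R) (a b c : R) : a <= b -> b <= c ->
  {within `[a, c], continuous f} ->
  \int[leb]_(u in `[a, c]) f u =
  \int[leb]_(u in `[a, b]) f u + \int[leb]_(u in `[b, c]) f u.
Proof.
move=> ab bc cf; have i1 := continuous_compact_integrable (@segment_compact R a c) cf.
rewrite -(@Rintegral_itv_obnd_cbnd _ b); last first.
  apply: integrableS i1 => // u; rewrite /= !in_itv/= => /andP[bu ->].
  by rewrite (le_trans ab (ltW bu)).
apply/eqP; rewrite addrC -subr_eq; apply/eqP.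
by apply: Rintegral_itvB; rewrite ?bnd_simp.
Qed.

End continuous_integrals.

(** * Defect of the empirical measure in the limiting equation *)

Section ito_defect.
Context {R : realType} (l : R) (g : R -> R[i]).
Hypotheses (jg : jordan_arclength l g) (cg : C2 g).
Local Notation leb := (@lebesgue_measure R).
Local Notation "m << f >>" := (pairing m (curve_fun jg f)) (at level 10, f at level 99).
Let l0 := jordan_length_gt0 jg.

Definition ito_defect (beta : R) (phi : R -> R) (p : R -> prob R (curve g)) (t : R) : R :=
  (p t) << phi >> - (p 0) << phi >> - \int[leb]_(r in `[0, t]) (beta / 4 * mean_drift jg phi (p r)).

Context {d : measure_display} {Om : measurableType d} (P : probability Om R).
Variables (n : nat) (B X : 'I_n.+1 -> R -> Om -> R) (beta : R).
Hypothesis (beta0 : 0 <= beta).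
Hypothesis HD : dyson_bm P l g beta B X.
Local Notation N := (n.+1%:R).

Lemma pairing_empirical_path phi w t : C2per l phi ->
  (empirical_path g X w t) << phi >> = N^-1 * \sum_(i < n.+1) phi (X i (t / N) w).
Proof.
move=> Cphi; have [p _ _ _] := Cphi.
rewrite pairing_empirical; last exact: C2per_bounded_cont.
by congr (_ * _); apply: eq_bigr => i _; rewrite curve_fun_on.
Qed.

Lemma empirical_path_clamp_continuous T phi w : 0 < T -> C2per l phi ->
  continuous (fun t => (empirical_path g X w (clamp T t)) << phi >>).
Proof.
move=> T0 Cphi; rewrite (_ : (fun _ => _) =
    (fun t => N^-1 * \sum_(i < n.+1) phi (slow_X X T w i t))); last first.
  by apply/funext => t; rewrite pairing_empirical_path.
have cS : continuous (fun t => \sum_(i < n.+1) phi (slow_X X T w i t)).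
  apply: continuous_sum => i t; apply: (@continuous_comp _ _ _ (slow_X X T w i) phi).
    exact: (slow_X_continuous HD T0).
  exact: (C2per_continuous Cphi).
by move=> t; apply: cvgM; [exact: cvg_cst|exact: cS].
Qed.

Lemma empirical_path_measurable phi t : 0 <= t -> C2per l phi ->
  measurable_fun setT (fun w => (empirical_path g X w t) << phi >>).
Proof.
move=> t0 Cphi; rewrite (_ : (fun _ => _) =
    (fun w => N^-1 * \sum_(i < n.+1) phi (X i (t / N) w))); last first.
  by apply/funext => w; rewrite pairing_empirical_path.
have [[_ [mX _]] _ _ _ _] := HD.
apply: measurable_funM => //; apply: measurable_sum => i.
apply: (@measurableT_comp _ _ _ _ _ _ phi _ (X i (t / N))).
  by apply: continuous_measurable_fun; exact: (C2per_continuous Cphi).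
by apply: mX; rewrite divr_ge0.
Qed.

Lemma empirical_path_mean_drift_continuous T phi w : 0 < T -> C2per l phi ->
  continuous (fun t => mean_drift jg phi (empirical_path g X w (clamp T t))).
Proof.
move=> T0 Cphi; have l0' := jordan_length_gt0 jg.
have [xC2 yC2] := jordan_C2per jg cg.
have cK := @dyson_kernel_continuous _ l _ _ l0' xC2 yC2 (jordan_unit_speed jg) (jordan_inj jg) phi Cphi.
rewrite (_ : (fun _ => _) = fun t => N^-1 * \sum_(i < n.+1) (N^-1 * \sum_(j < n.+1)
    dyson_kernel (re_path g) (im_path g) phi (slow_X X T w i t) (slow_X X T w j t))); last first.
  by apply/funext => t; rewrite (mean_drift_empirical jg cg Cphi).
have cX i := @slow_X_continuous _ _ _ _ _ P n B X beta HD T T0 w i.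
have c2 i : continuous (fun t => \sum_(j < n.+1)
    dyson_kernel (re_path g) (im_path g) phi (slow_X X T w i t) (slow_X X T w j t)).
  by apply: continuous_sum => j t; apply: continuous_comp2; [exact: cK|exact: cX|exact: cX].
have c1 : continuous (fun t => \sum_(i < n.+1) (N^-1 * \sum_(j < n.+1)
    dyson_kernel (re_path g) (im_path g) phi (slow_X X T w i t) (slow_X X T w j t))).
  by apply: continuous_sum => i t; apply: cvgM; [exact: cvg_cst|exact: c2].
by move=> t; apply: cvgM; [exact: cvg_cst|exact: c1].
Qed.

(** The two defects differ only by their drifts, that is by the diagonal pairs integrated over
    time. *)
Lemma ito_defect_close T phi M w t : C2per l phi -> 0 < T ->
  (forall s, `|rderiv (rderiv phi) s| <= M) -> good_path l g B X beta w -> 0 <= t <= T ->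
  `|ito_defect beta phi (empirical_path g X w) t
    - drift_defect (slow_X X T w) (slow_drift g X beta T w) phi t| <= beta / 4 * M / N * T.
Proof.
move=> Cphi T0 HM gw /andP[t0 tT].
have at_ u : 0 <= u <= T ->
    average_at (slow_X X T w) phi u = (empirical_path g X w u) << phi >>.
  by move=> uT; rewrite pairing_empirical_path// /average_at /slow_X clamp_id.
have T00 : 0 <= (0 : R) <= T by rewrite lexx ltW.
have t0T : 0 <= t <= T by rewrite t0.
rewrite /drift_defect /ito_defect (at_ _ t0T) (at_ _ T00).
have sub3 (p q r s : R) : p - q - r - (p - q - s) = s - r by ring.
rewrite sub3.
have cd : continuous (average_drift (slow_X X T w) (slow_drift g X beta T w) phi).
  have [_ d1 d2 _] := Cphi; apply: average_drift_continuous => // i.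
    exact: (slow_X_continuous HD T0).
  exact: (slow_drift_continuous jg cg HD T0 gw).
have cm := @empirical_path_mean_drift_continuous T phi w T0 Cphi.
have -> : \int[leb]_(r in `[0, t]) (beta / 4 * mean_drift jg phi (empirical_path g X w r)) =
    \int[leb]_(r in `[0, t]) (beta / 4 * mean_drift jg phi (empirical_path g X w (clamp T r))).
  apply: eq_Rintegral => r; rewrite inE/= in_itv/= => /andP[r0 rt].
  by rewrite clamp_id// r0 (le_trans rt).
apply: le_trans (Rintegral_dist t0 _ _ _) _.
- exact: continuous_subspaceT.
- apply: continuous_subspaceT => u; apply: cvgM; [exact: cvg_cst|exact: cm].
- move=> u /andP[u0 ut]; rewrite /average_drift /slow_drift.
  apply: (average_dyson_drift jg cg Cphi HM _ beta0).
  exact: (slow_X_chamber T0 _ gw).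
rewrite subr0 ler_wpM2l// !mulr_ge0 ?invr_ge0//; exact: le_trans (HM 0).
Qed.

End ito_defect.

Section dyson_sequence.
Context {R : realType} (l : R) (g : R -> R[i]) (beta : R).
Hypotheses (jg : jordan_arclength l g) (cg : C2 g) (beta0 : 0 <= beta).
Local Notation leb := (@lebesgue_measure R).
Local Notation "m << f >>" := (pairing m (curve_fun jg f)) (at level 10, f at level 99).
Let l0 := jordan_length_gt0 jg.
Variables (d : nat -> measure_display) (Om : forall n, measurableType (d n))
    (P : forall n, probability (Om n) R)
    (B X : forall n, 'I_n.+1 -> R -> Om n -> R).
Hypothesis HD : forall n, dyson_bm (P n) l g beta (@B n) (@X n).
Local Notation path n w := (empirical_path g (@X n) w).

Lemma C2per_second_bound (phi : R -> R) : C2per l phi ->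
  exists2 M : R, 0 <= M & forall s, `|rderiv (rderiv phi) s| <= M.
Proof.
move=> [p _ _ c2]; exact: (periodic_bounded l0 (deriv_periodic (deriv_periodic p)) c2).
Qed.

Lemma inv_succ_small (C e : R) : 0 < e -> exists n0, forall n, (n0 <= n)%N -> C / n.+1%:R <= e.
Proof.
move=> e0; exists (Num.truncn (C / e)) => n nn; rewrite ler_pdivrMr// mulrC -ler_pdivrMr//.
by apply: le_trans (ltW (truncnS_gt _)) _; rewrite ler_nat ltnS.
Qed.

Lemma ito_defect_small (phi : R -> R) (T e eps : R) : C2per l phi -> 0 < T -> 0 < e -> 0 < eps ->
  exists n0, forall n, (n0 <= n)%N -> exists A : set (Om n), [/\ measurable A, (P n A <= eps%:E)%E &
    forall w, ~ A w -> forall t, 0 <= t <= T -> `|ito_defect jg beta phi (path n w) t| <= e].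
Proof.
(* The defect of the particle system may reach four times [e / 5]; the fifth share is for the
   diagonal pairs. *)
move=> Cphi T0 e0 eps0; have e50 : 0 < e / 5 by rewrite divr_gt0.
have [M M0 HM] := C2per_second_bound Cphi.
have HL := periodic_deriv_bound l0 Cphi HM.
have [n1 H1] := inv_succ_small (beta / 4 * M * T) e50.
have [n2 H2] := inv_succ_small (8 * (l * M) ^+ 2 * T / (e / 5) ^+ 2 + 16 * M * T / (e / 5)) eps0.
exists (maxn n1 n2) => n; rewrite geq_max => /andP[nn1 nn2].
have [A [mA PA HA]] := defect_probability jg cg (HD n) Cphi T0 HL HM e50.
exists A; split => //.
  apply: le_trans PA _; rewrite lee_fin; apply: le_trans (H2 n nn2).
  by rewrite le_eqVlt; apply/orP; left; apply/eqP; rewrite mulrDl; field; rewrite !gt_eqF.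
move=> w /HA[gw Hw] t tT.
have up (p q : R) : `|p - q| <= e / 5 -> `|q| <= 4 * (e / 5) -> `|p| <= e.
  by move=> h1 h2; have := lerB_dist p q; lra.
apply: up (Hw t tT); apply: le_trans (ito_defect_close jg cg beta0 (HD n) Cphi T0 HM gw tT) _.
by rewrite mulrAC; exact: H1.
Qed.

Lemma mean_drift_bound (phi : R -> R) : C2per l phi ->
  exists2 C : R, 0 < C & forall m, `|beta / 4 * mean_drift jg phi m| <= C.
Proof.
move=> Cphi; have [xC2 yC2] := jordan_C2per jg cg.
have [C C0 HC] := @dyson_kernel_bound _ l _ _ l0 xC2 yC2 (jordan_unit_speed jg) (jordan_inj jg).
have [M M0 HM] := C2per_second_bound Cphi.
exists (beta / 4 * (C * M) + 1) => [|m]; first by rewrite ltr_wpDl// !mulr_ge0.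
apply: (@le_trans _ _ (beta / 4 * (C * M))); last by rewrite lerDl.
rewrite normrM ger0_norm ?divr_ge0// ler_wpM2l ?divr_ge0//.
by apply: (mean_drift_norm jg cg Cphi) => s u; exact: HC.
Qed.

End dyson_sequence.

(** * Tightness *)

Section modulus_events.
Context {R : realType} {d : measure_display} {Om : measurableType d}.
Variables (P : probability Om R) (T : R) (f : R -> Om -> R).
Hypothesis T0 : 0 < T.
Hypothesis mf : forall t, 0 <= t <= T -> measurable_fun setT (f t).
Hypothesis cf : forall w, continuous (fun t => f (clamp T t) w).

(** Rational times make this a countable union of events. They are clamped because [T] may be
    irrational, so that the endpoint is still approached within [[0, T]]. *)
Definition bad_modulus (dl e : R) : set Om := \bigcup_(q : rat) \bigcup_(r : rat)
  [set w | `|clamp T (ratr q) - clamp T (ratr r)| < dl /\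
           e < `|f (clamp T (ratr q)) w - f (clamp T (ratr r)) w|].

Lemma bad_modulus_measurable dl e : measurable (bad_modulus dl e).
Proof.
have T0' := ltW T0.
apply: bigcupT_measurable_rat => q; apply: bigcupT_measurable_rat => r.
have [h|h] := pselect (`|clamp T (ratr q) - clamp T (ratr r)| < dl); last first.
  by rewrite (_ : [set w | _] = set0)//; apply/seteqP; split => // w [].
rewrite (_ : [set w | _] = [set w | e < `|f (clamp T (ratr q)) w - f (clamp T (ratr r)) w|]); last first.
  by apply/seteqP; split => w; [case|split].
rewrite -[X in measurable X]setTI; apply: measurable_fun_ltr => //; apply: measurableT_comp => //.
by apply: measurable_funB; apply: mf; exact: clamp_itv.
Qed.

Lemma bad_modulusS dl dl' e : dl <= dl' -> bad_modulus dl e `<=` bad_modulus dl' e.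
Proof.
move=> ld w [q _ [r _ [h1 h2]]]; exists q => //; exists r => //; split => //.
exact: lt_le_trans ld.
Qed.

Lemma rat_near (s e : R) : 0 < e -> exists q : rat, `|s - ratr q| < e.
Proof.
move=> e0; have : s - e < s + e by rewrite ltrD2l gtrN.
by move=> /rat_in_itvoo[q]; rewrite in_itv/= => qs; exists q; rewrite ltr_distlC.
Qed.

Lemma good_modulus dl e w : ~ bad_modulus dl e w -> forall s t, 0 <= s <= T -> 0 <= t <= T ->
  `|s - t| < dl -> `|f s w - f t w| <= e.
Proof.
move=> Hw s t sT tT st; rewrite leNgt; apply/negP => est; apply: Hw.
have T0' := ltW T0.
pose z := (`|f s w - f t w| - e) / 2; have z0 : 0 < z by rewrite divr_gt0// subr_gt0.
pose y := (dl - `|s - t|) / 2; have y0 : 0 < y by rewrite divr_gt0// subr_gt0.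
have near_pt u : 0 <= u <= T -> exists q : rat, `|u - clamp T (ratr q)| < y /\
    `|f u w - f (clamp T (ratr q)) w| < z.
  move=> uT; have /cvgrPdist_lt/(_ _ z0)[x /= x0 Hx] := @cf w u.
  have xy0 : 0 < Num.min x y by rewrite lt_min x0.
  have [q Hq] := rat_near u xy0.
  exists q; move: Hq; rewrite lt_min => /andP[qx qy]; split.
    by rewrite -{1}(clamp_id uT); exact: le_lt_trans (clamp_dist T0' _ _) qy.
  by have := Hx (ratr q) qx; rewrite clamp_id.
have [q [q1 q2]] := near_pt s sT; have [r [r1 r2]] := near_pt t tT.
exists q => //; exists r => //; split.
  rewrite distrC in q1; apply: le_lt_trans (ler_distD s _ _) _.
  apply: le_lt_trans (lerD (lexx _) (ler_distD t _ _)) _.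
  by move: q1 r1; rewrite /y; lra.
have := ler_distD (f (clamp T (ratr q)) w) (f s w) (f t w).
have := ler_distD (f (clamp T (ratr r)) w) (f (clamp T (ratr q)) w) (f t w).
rewrite distrC in r2; move: q2 r2; rewrite /z; lra.
Qed.

(** For one process with continuous paths the bad events decrease to the empty set as the scale
    tends to zero, by uniform continuity of each path. *)
Lemma bad_modulus_small e eps : 0 < e -> 0 < eps ->
  exists2 dl : R, 0 < dl & (P (bad_modulus dl e) <= eps%:E)%E.
Proof.
move=> e0 eps0; have T0' := ltW T0.
pose F k := bad_modulus (k.+1%:R^-1) e.
have F0 : \bigcap_k F k = set0.
  apply/seteqP; split => // w Hw.
  have [x x0 Hx] := segment_ucont 0 T (@cf w) e0.
  have [k Hk] : exists k : nat, k.+1%:R^-1 < x.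
    exists (Num.truncn (x^-1)); rewrite -[ltRHS]invrK ltf_pV2 ?posrE ?invr_gt0//.
    exact: truncnS_gt.
  have [q _ [r _ [h1 h2]]] := Hw k I.
  have := Hx (clamp T (ratr q)) (clamp T (ratr r)) (clamp_itv T0' _) (lt_trans h1 Hk).
  rewrite (clamp_id (clamp_itv T0' (ratr q))) (clamp_id (clamp_itv T0' (ratr r))).
  by rewrite ltNge (ltW h2).
have mF k : measurable (F k) by exact: bad_modulus_measurable.
have cF : P (F k) @[k --> \oo] --> 0%E.
  rewrite -(measure0 P) -F0; apply: nonincreasing_cvg_mu => //.
  - by rewrite -ge0_fin_numE// fin_num_measure.
  - by rewrite F0.
  - move=> i j ij; apply/subsetPset; apply: bad_modulusS.
    by rewrite lef_pV2 ?posrE// ler_nat.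
have [k Hk] : exists k, (P (F k) <= eps%:E)%E.
  have /fine_cvgP[_ /cvgrPdist_le/(_ _ eps0)[k _ Hk]] := cF.
  exists k; have := Hk k (leqnn k); rewrite sub0r normrN /= => H.
  by rewrite -[P (F k)]fineK ?fin_num_measure// lee_fin; exact: le_trans (ler_norm _) H.
by exists k.+1%:R^-1.
Qed.

End modulus_events.

Section tightness.
Context {R : realType} (l : R) (g : R -> R[i]) (beta : R).
Hypotheses (jg : jordan_arclength l g) (cg : C2 g) (beta0 : 0 <= beta).
Local Notation leb := (@lebesgue_measure R).
Local Notation "m << f >>" := (pairing m (curve_fun jg f)) (at level 10, f at level 99).
Let l0 := jordan_length_gt0 jg.
Variables (d : nat -> measure_display) (Om : forall n, measurableType (d n))
    (P : forall n, probability (Om n) R)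
    (B X : forall n, 'I_n.+1 -> R -> Om n -> R).
Hypothesis HD : forall n, dyson_bm (P n) l g beta (@B n) (@X n).
Local Notation path n w := (empirical_path g (@X n) w).

Lemma within_clamp (f : R -> R) (T : R) : continuous (fun t => f (clamp T t)) ->
  {within `[0, T], continuous f}.
Proof.
move=> cf; apply: (@subspace_eq_continuous _ _ _ (fun t => f (clamp T t))).
  by move=> t; rewrite inE/= in_itv/= => /clamp_id ->.
exact: continuous_subspaceT.
Qed.

Lemma Rintegral_lipschitz (f : R -> R) (T C s t : R) : {within `[0, T], continuous f} ->
  (forall u, `|f u| <= C) -> 0 <= s -> s <= t -> t <= T ->
  `|\int[leb]_(r in `[0, t]) f r - \int[leb]_(r in `[0, s]) f r| <= C * (t - s).
Proof.
move=> cf fC s0 st tT; have t0 := le_trans s0 st.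
have sub a b : 0 <= a -> b <= T -> {within `[a, b], continuous f}.
  move=> a0 bT; apply: continuous_subspaceW cf => u; rewrite /= !in_itv/= => /andP[au ub].
  by rewrite (le_trans a0 au) (le_trans ub bT).
rewrite (Rintegral_segment_split s0 st); last exact: sub.
rewrite addrAC subrr add0r.
by apply: Rintegral_norm_le => //; exact: sub.
Qed.

(** A pairing varies between two times by the integrated drift, which is Lipschitz in time, and by
    the defects at the two times. *)
Lemma pairing_dist_defect (phi : R -> R) (T C s t : R) (p : R -> prob R (curve g)) :
  {within `[0, T], continuous (fun r => beta / 4 * mean_drift jg phi (p r))} ->
  (forall m, `|beta / 4 * mean_drift jg phi m| <= C) -> 0 <= s <= T -> 0 <= t <= T ->
  `|(p s) << phi >> - (p t) << phi >>| <=
    `|ito_defect jg beta phi p s| + `|ito_defect jg beta phi p t| + C * `|s - t|.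
Proof.
move=> cp HC; wlog st : s t / s <= t.
  move=> H; have [/H//|/ltW/H H' sT tT] := leP s t.
  by rewrite distrC [`|_| + _]addrC (distrC s); exact: H'.
move=> /andP[s0 sT] /andP[t0 tT].
have L := Rintegral_lipschitz cp (fun u => HC (p u)) s0 st tT.
rewrite (distrC s) (@ger0_norm _ (t - s)) ?subr_ge0//.
have -> : (p s) << phi >> - (p t) << phi >> = ito_defect jg beta phi p s - ito_defect jg beta phi p t
    - (\int[leb]_(r in `[0, t]) (beta / 4 * mean_drift jg phi (p r))
       - \int[leb]_(r in `[0, s]) (beta / 4 * mean_drift jg phi (p r))).
  by rewrite /ito_defect; ring.
by apply: le_trans (ler_normB _ _) _; apply: lerD => //; exact: ler_normB.
Qed.

(** For large [n] the defect is small and the bounded drift gives the modulus. Each of the finitely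
    many remaining [n] has its own scale from path continuity, and the minimum of all these scales
    works. *)
Lemma modulus_uniform (phi : R -> R) (T e eps : R) : C2per l phi -> 0 < T -> 0 < e -> 0 < eps ->
  exists2 dl : R, 0 < dl & forall n,
    (P n (bad_modulus T (fun t w => (path n w t) << phi >>) dl e) <= eps%:E)%E.
Proof.
move=> Cphi T0 e0 eps0; have e30 : 0 < e / 3 by rewrite divr_gt0.
have [C C0 HC] := mean_drift_bound jg cg beta0 Cphi.
have [n0 Hn0] := ito_defect_small jg cg beta0 HD Cphi T0 e30 eps0.
have mf n (t : R) : 0 <= t <= T -> measurable_fun setT (fun w : Om n => (path n w t) << phi >>).
  by move=> /andP[t0 _]; exact: (empirical_path_measurable jg cg (HD n) t0 Cphi).
have cf n w := @empirical_path_clamp_continuous _ _ _ jg cg _ _ _ n _ _ _ (HD n) T phi w T0 Cphi.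
have ex n : exists x : R, 0 < x /\
    (P n (bad_modulus T (fun t w => (path n w t) << phi >>) x e) <= eps%:E)%E.
  by have [x] := bad_modulus_small (P n) T0 (mf n) (cf n) e0 eps0; exists x.
have [dl Hdl] := choice ex.
pose dl0 := e / (3 * C); have dl00 : 0 < dl0 by rewrite divr_gt0// mulr_gt0.
exists (\big[Num.min/dl0]_(n < n0) dl n) => [|n].
  by elim/big_ind : _ => // [u v u0 v0|i _]; [rewrite lt_min u0|case: (Hdl i)].
have [nn0|nn0] := ltnP n n0.
  have [_] := Hdl n; apply: le_trans; apply: le_measure; rewrite ?inE.
  - exact: (bad_modulus_measurable T0 (mf n)).
  - exact: (bad_modulus_measurable T0 (mf n)).
  - by apply: bad_modulusS; exact: (@bigmin_le_cond _ _ _ dl0 (Ordinal nn0) xpredT (fun i : 'I_n0 => dl i)).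
have [A [mA PA small]] := Hn0 n nn0; apply: le_trans PA; apply: le_measure; rewrite ?inE//.
  exact: (bad_modulus_measurable T0 (mf n)).
move=> w [q _ [r _ [qr eqr]]]; apply: contrapT => /small{}small.
have T0' := ltW T0.
have cd : {within `[0, T], continuous (fun r => beta / 4 * mean_drift jg phi (path n w r))}.
  apply: within_clamp => t; apply: cvgM; first exact: cvg_cst.
  exact: (@empirical_path_mean_drift_continuous _ _ _ jg cg _ _ _ n _ _ _ (HD n) T phi w T0 Cphi).
have := pairing_dist_defect cd HC (clamp_itv T0' (ratr q)) (clamp_itv T0' (ratr r)).
have qr' : `|clamp T (ratr q) - clamp T (ratr r)| < dl0.
  apply: lt_le_trans qr _; exact: bigmin_le_id.
have : C * `|clamp T (ratr q) - clamp T (ratr r)| < e / 3.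
  have := qr'; rewrite /dl0 ltr_pdivlMr ?mulr_gt0// => Hq.
  by rewrite ltr_pdivlMr//; apply: le_lt_trans Hq; rewrite le_eqVlt; apply/orP; left; apply/eqP; ring.
have := small _ (clamp_itv T0' (ratr q)); have := small _ (clamp_itv T0' (ratr r)).
move: eqr; lra.
Qed.

(** The moduli for all pairs of a dense function and a tolerance are imposed together, the pair of
    code [i] being allowed a failure probability [eps / 2 ^ i.+1]. The quantile condition holds for
    every empirical measure. *)
Lemma dyson_tight : tight P (fun n => empirical_path g (@X n)).
Proof.
move=> T T0 eps eps0.
have [D [DC2 Ddense]] := C2per_separable l0.
have Dd h : (forall s, h (s + l) = h s) -> continuous h -> forall e : R, 0 < e ->
    exists k, forall s, `|h s - D k s| <= e.
  move=> ph ch e e0; have e20 : 0 < e / 2 by rewrite divr_gt0.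
  have [phi Cphi H1] := C2per_dense l0 ph ch e20.
  have [k [H2 _]] := Ddense phi _ Cphi e20.
  exists k => s; rewrite (splitr e); apply: le_trans (ler_distD (phi s) _ _) _; exact: lerD.
have ex (kj : nat * nat) : exists x : R, 0 < x /\ forall n,
    (P n (bad_modulus T (fun t w => (path n w t) << D kj.1 >>) x kj.2.+1%:R^-1) <=
      (eps / (2 ^ (pickle kj).+1)%:R)%:E)%E.
  have e0 : 0 < eps / (2 ^ (pickle kj).+1)%:R by rewrite divr_gt0// ltr0n expn_gt0.
  have p0 : 0 < kj.2.+1%:R^-1 :> R by rewrite invr_gt0.
  by have [x x0 Hx] := modulus_uniform (DC2 kj.1) T0 p0 e0; exists x.
have [dl Hdl] := choice ex.
pose delta k j := dl (k, j).
have delta0 k j : 0 < delta k j by case: (Hdl (k, j)).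
exists (path_moduli jg D delta); split.
- exact: (path_moduli_continuous cg T0 DC2 Dd delta0).
- exact: (path_moduli_compact cg T0 DC2 Dd delta0).
- exact: (path_moduli_closed cg DC2).
- move=> n.
  pose Bad i := if @pickle_inv (nat * nat)%type i is Some kj then
    bad_modulus T (fun t w => (path n w t) << D kj.1 >>) (dl kj) kj.2.+1%:R^-1 else set0.
  have mf k (t : R) : 0 <= t <= T -> measurable_fun setT (fun w : Om n => (path n w t) << D k >>).
    by move=> /andP[t0 _]; exact: (empirical_path_measurable jg cg (HD n) t0 (DC2 k)).
  have cf k w := @empirical_path_clamp_continuous _ _ _ jg cg _ _ _ n _ _ _ (HD n) T (D k) w T0 (DC2 k).
  have mBad i : measurable (Bad i).
    rewrite /Bad; case: (pickle_inv i) => // kj; apply: bad_modulus_measurable => //; exact: mf.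
  have mU : measurable (\bigcup_i Bad i) by exact: bigcupT_measurable.
  have PU : (P n (\bigcup_i Bad i) <= eps%:E)%E.
    apply: le_trans (measure_sigma_subadditive _ _ _ _) _ => //.
    apply: le_trans (epsilon_trick0 xpredT (ltW eps0)); apply: lee_nneseries => // i _.
    rewrite /Bad; case E : (pickle_inv i) => [kj|]; last first.
      by rewrite measure0 lee_fin divr_ge0// ltW.
    have := (Hdl kj).2 n.
    by have := @pickle_invK (nat * nat)%type i; rewrite E /= => ->.
  (* The event is exactly the complement of the union of bad events, hence measurable: by path
     continuity, rational times decide the modulus. *)
  have -> : [set w | path_moduli jg D delta (path n w : paths (curve g) T)] = ~` \bigcup_i Bad i.
    apply/seteqP; split => w.
      move=> [_ Hw] [i _]; rewrite /Bad; case: (pickle_inv i) => // -[k j] [q _ [r _ [qr]]].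
      have := Hw k j _ _ (clamp_itv (ltW T0) (ratr q)) (clamp_itv (ltW T0) (ratr r)) qr.
      by rewrite leNgt => /negP.
    move=> Hw; split; first by move=> t _; exact: quantile_empirical.
    move=> k j s t sT tT st.
    have := @good_modulus _ _ _ T (fun t w => (path n w t) << D k >>) T0 (cf k) (dl (k, j))
      j.+1%:R^-1 w _ s t sT tT st.
    apply => Hb; apply: Hw.
    by exists (pickle (k, j)) => //; rewrite /Bad pickleK_inv.
  by rewrite probability_setC// EFinB leeB.
Qed.

End tightness.

(** * The limit equation *)

(** The integral of a nonnegative function is a supremum over the simple functions below it, so
    monotonicity holds for arbitrary integrands. It is applied to the capped defect of the empirical
    paths, whose measurability is not established. *)
Lemma ge0_integral_mono (d : measure_display) (T : measurableType d) (R : realType)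
    (m : {measure set T -> \bar R}) (f1 f2 : T -> \bar R) :
  (forall x, (0 <= f1 x)%E) -> (forall x, (f1 x <= f2 x)%E) ->
  (\int[m]_x f1 x <= \int[m]_x f2 x)%E.
Proof.
move=> f10 f12; rewrite !ge0_integralTE//; last by move=> x; exact: le_trans (f12 x).
apply: le_ereal_sup => _ [h /= hf <-]; exists h => // x; exact: le_trans (f12 x).
Qed.

Lemma inv_succ_lt (R : realType) (x : R) : 0 < x -> exists k : nat, k.+1%:R^-1 < x.
Proof.
move=> x0; exists (Num.truncn (x^-1)).
by rewrite -[ltRHS]invrK ltf_pV2 ?posrE ?invr_gt0//; exact: truncnS_gt.
Qed.

Section limit_equation.
Context {R : realType} (l : R) (g : R -> R[i]) (beta : R).
Hypotheses (jg : jordan_arclength l g) (cg : C2 g) (beta0 : 0 <= beta).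
Local Notation leb := (@lebesgue_measure R).
Local Notation "m << f >>" := (pairing m (curve_fun jg f)) (at level 10, f at level 99).
Let l0 := jordan_length_gt0 jg.
Variable mu0 : prob R (curve g).

(** The deterministic initial measure [mu0] takes the place of [p 0], so that the vanishing of the
    defect also contains the initial condition. *)
Definition limit_defect (phi : R -> R) (p : R -> prob R (curve g)) (t : R) : R :=
  (p t) << phi >> - mu0 << phi >> -
  \int[leb]_(r in `[0, t]) (beta / 4 * mean_drift jg phi (p r)).

Lemma path_drift_continuous (phi : R -> R) (T t : R) (p : paths (curve g) T) :
  C2per l phi -> continuous_paths p -> t <= T ->
  {within `[0, t], continuous (fun r => beta / 4 * mean_drift jg phi (p r))}.
Proof.
move=> Cphi cp tT.
have cd : {within `[0, T], continuous (fun r => mean_drift jg phi (p r))}.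
  move=> s; apply: (@continuous_comp (subspace `[0, T]) _ _ (p : R -> prob R (curve g))
    (mean_drift jg phi)); first exact: cp.
  exact: (@mean_drift_continuous _ _ _ jg cg _ Cphi).
have {}cd : {within `[0, T], continuous (fun r => beta / 4 * mean_drift jg phi (p r))}.
  by move=> s; apply: cvgM; [exact: cvg_cst|exact: cd].
apply: continuous_subspaceW cd => u; rewrite /= !in_itv/= => /andP[-> ut].
exact: le_trans tT.
Qed.

(** Uniform closeness of two paths gives closeness of the drifts at all times up to [t], by uniform
    continuity of the drift, hence closeness of the time integrals. *)
Lemma limit_defect_continuous (phi : R -> R) (T t : R) : C2per l phi -> 0 <= t <= T ->
  {within @continuous_paths R (curve g) T, continuous (fun p => limit_defect phi p t)}.
Proof.
move=> Cphi /andP[t0 tT]; apply/subspace_continuousP => p cp.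
have FF : Filter (within (@continuous_paths R (curve g) T) (nbhs p)).
  by apply: within_filter; exact: nbhs_filter.
apply/(@cvgrPdist_le _ _ _ _ FF) => e e0; have e20 : 0 < e / 2 by rewrite divr_gt0.
pose c := beta / 4 * t + 1; have c0 : 0 < c by rewrite ltr_wpDl// mulr_ge0// divr_ge0.
pose e1 := e / 2 / c; have e10 : 0 < e1 by rewrite divr_gt0.
have N1 := paths_nbhs p (C2per_bounded_cont jg cg Cphi) e20.
have N2 : nbhs p [set q : paths (curve g) T |
    forall s, `[0, T]%classic s -> `|mean_drift jg phi (p s) - mean_drift jg phi (q s)| < e1].
  apply/uniform_nbhs.
  by exists [set mm | `|mean_drift jg phi mm.1 - mean_drift jg phi mm.2| < e1]; split => //;
    exact: (mean_drift_entourage jg cg Cphi).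
apply: (@filterS2 _ (nbhs p) (nbhs_filter p) _ _ _ _ N1 N2) => q /= H1 H2 cq.
have tT' : `[0, T]%classic t by rewrite /= in_itv/= t0.
have D : `|\int[leb]_(r in `[0, t]) (beta / 4 * mean_drift jg phi (p r)) -
    \int[leb]_(r in `[0, t]) (beta / 4 * mean_drift jg phi (q r))| <= e / 2.
  apply: le_trans (Rintegral_dist (e := beta / 4 * e1) t0 _ _ _) _.
  - exact: path_drift_continuous.
  - exact: path_drift_continuous.
  - move=> r /andP[r0 rt]; rewrite -mulrBr normrM ger0_norm ?divr_ge0// ler_wpM2l ?divr_ge0//.
    by apply/ltW/H2; rewrite /= in_itv/= r0 (le_trans rt).
  - rewrite subr0 mulrAC /e1 mulrA ler_pdivrMr// mulrC; apply: ler_wpM2l; first exact: ltW.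
    by rewrite /c lerDl.
rewrite /from_subspace.
have -> : limit_defect phi p t - limit_defect phi q t = ((p t) << phi >> - (q t) << phi >>) -
    (\int[leb]_(r in `[0, t]) (beta / 4 * mean_drift jg phi (p r)) -
     \int[leb]_(r in `[0, t]) (beta / 4 * mean_drift jg phi (q r))).
  by rewrite /limit_defect; ring.
apply: le_trans (ler_normB _ _) _; rewrite (splitr e); apply: lerD => //.
exact/ltW/H1.
Qed.

(** The cap at [1] makes the functional bounded, as convergence in law requires, without changing
    its zeros. *)
Definition capped_defect (phi : R -> R) (t : R) (p : R -> prob R (curve g)) : R :=
  Num.min 1 `|limit_defect phi p t|.

Lemma capped_defect_continuous (phi : R -> R) (T t : R) : C2per l phi -> 0 <= t <= T ->
  {within @continuous_paths R (curve g) T, continuous (capped_defect phi t : paths (curve g) T -> R)}.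
Proof.
move=> Cphi tT p; apply: (@continuous_comp (subspace (@continuous_paths R (curve g) T)) R R
  (fun p => limit_defect phi p t) (fun x => Num.min 1 `|x|)).
  exact: (limit_defect_continuous Cphi tT).
have cn : {for limit_defect phi p t, continuous (fun x : R^o => `|x| : R^o)} by exact: norm_continuous.
have c1 : {for limit_defect phi p t, continuous (fun _ : R^o => 1 : R^o)} by exact: cvg_cst.
exact: (continuous_min c1 cn).
Qed.

Lemma capped_defect_itv (phi : R -> R) (t : R) p : 0 <= capped_defect phi t p <= 1.
Proof. by rewrite /capped_defect le_min ler01 normr_ge0 ge_min lexx. Qed.

Lemma capped_defect0 (phi : R -> R) (t : R) p :
  (forall k : nat, capped_defect phi t p <= k.+1%:R^-1) -> limit_defect phi p t = 0.
Proof.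
move=> H; apply: contrapT => /eqP ne.
have m0 : 0 < capped_defect phi t p by rewrite lt_min ltr01 normr_gt0.
have [k Hk] := inv_succ_lt m0.
by have := H k; rewrite leNgt Hk.
Qed.

Variables (d : nat -> measure_display) (Om : forall n, measurableType (d n))
    (P : forall n, probability (Om n) R)
    (B X : forall n, 'I_n.+1 -> R -> Om n -> R).
Hypothesis HD : forall n, dyson_bm (P n) l g beta (@B n) (@X n).
Local Notation path n w := (empirical_path g (@X n) w).
Hypothesis init : cvg_in_prob P (fun n w => path n w 0) mu0.

Lemma cvg_probability_ge (u : nat -> \bar R) (e : R) : u @ \oo --> 1%E -> 0 < e ->
  exists n0, forall n, (n0 <= n)%N -> ((1 - e)%:E <= u n)%E.
Proof.
move=> cu e0; have /fine_cvgP[[n1 _ H1] /cvgrPdist_le/(_ _ e0)[n2 _ H2]] := cu.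
exists (maxn n1 n2) => n; rewrite geq_max => /andP[nn1 nn2].
have /fineK <- := H1 n nn1; rewrite lee_fin.
have := H2 n nn2; rewrite /= ler_norml => /andP[_]; lra.
Qed.

(** Outside an event of probability at most [e / 4 + e / 4], the defect is at most [e / 4] for the
    evolution plus [e / 4] for the initial measure; on that event the cap is used. *)
Lemma capped_defect_small (phi : R -> R) (t e : R) : C2per l phi -> 0 <= t -> 0 < e ->
  exists n0, forall n, (n0 <= n)%N ->
    (\int[P n]_w (capped_defect phi t (path n w))%:E <= e%:E)%E.
Proof.
move=> Cphi t0 e0; have e40 : 0 < e / 4 by rewrite divr_gt0.
have T0 : 0 < t + 1 by rewrite ltr_wpDl.
have bc := C2per_bounded_cont jg cg Cphi.
have [n1 Hn1] := ito_defect_small jg cg beta0 HD Cphi T0 e40 e40.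
pose U := [set m : prob R (curve g) | `|m << phi >> - mu0 << phi >>| < e / 4].
have oU : open U.
  apply: (@open_comp _ _ (fun m => m << phi >>) [set x | `|x - mu0 << phi >>| < e / 4]).
    by move=> m _; exact: pairing_continuous.
  rewrite (_ : mkset _ = ball (mu0 << phi >>) (e / 4)); first exact: ball_open.
  by apply/seteqP; split => x; rewrite /ball/= distrC.
have U0 : U mu0 by rewrite /U/= subrr normr0.
have [n2 Hn2] := cvg_probability_ge (init oU U0) e40.
exists (maxn n1 n2) => n; rewrite geq_max => /andP[nn1 nn2].
have [A [mA PA HA]] := Hn1 n nn1; have PU := Hn2 n nn2.
pose C := [set w | U (path n w 0)].
have mC : measurable C.
  rewrite -[C]setTI; apply: measurable_fun_ltr => //; apply: measurableT_comp => //.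
  by apply: measurable_funB => //; exact: (empirical_path_measurable jg cg (HD n) (lexx 0) Cphi).
have PC : (P n (~` C) <= (e / 4)%:E)%E.
  rewrite probability_setC//; move: PU; rewrite -/C -[P n C]fineK ?fin_num_measure//.
  by rewrite -EFinB !lee_fin; lra.
have mAC : measurable (A `|` ~` C) by apply: measurableU => //; exact: measurableC.
apply: (@le_trans _ _ (\int[P n]_w ((2 * (e / 4))%:E + (\1_(A `|` ~` C) w)%:E))%E).
  apply: ge0_integral_mono => w; first by rewrite lee_fin; case/andP: (capped_defect_itv phi t (path n w)).
  rewrite -EFinD lee_fin indicE.
  have [wA|wA] := boolP (w \in A `|` ~` C).
    have /andP[_ h] := capped_defect_itv phi t (path n w).
    by apply: le_trans h _; rewrite lerDr mulr_ge0// ltW.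
  rewrite addr0; apply: (@le_trans _ _ `|limit_defect phi (path n w) t|).
    by rewrite /capped_defect ge_min lexx orbT.
  move: wA; rewrite notin_setE /setU/= not_orE => -[nA /contrapT Cw].
  have tT : 0 <= t <= t + 1 by rewrite t0 lerDl ler01.
  have I := HA w nA t tT.
  have -> : limit_defect phi (path n w) t = ito_defect jg beta phi (path n w) t +
      ((path n w 0) << phi >> - mu0 << phi >>) by rewrite /limit_defect /ito_defect; ring.
  apply: le_trans (ler_normD _ _) _; rewrite mulrDl mul1r; apply: lerD => //; exact: ltW.
rewrite ge0_integralD//; last 2 first.
- by move=> w _; rewrite lee_fin mulr_ge0// ltW.
- by apply/measurable_EFinP; exact: measurable_indic.
have -> : (\int[P n]_(_ in setT) (2 * (e / 4))%:E = (2 * (e / 4))%:E)%E.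
  by rewrite integral_cst// [X in (_ * X)%E](_ : _ = 1%E) ?mule1//; exact: probability_setT.
rewrite integral_indic// setIT.
apply: (@le_trans _ _ ((2 * (e / 4))%:E + ((e / 4)%:E + (e / 4)%:E))%E); last first.
  by rewrite -!EFinD lee_fin; lra.
rewrite leeD2l//; apply: le_trans (measureU2 _ mA (measurableC mC)) _.
exact: leeD.
Qed.

Variables (d' : measure_display) (Om' : measurableType d') (P' : probability Om' R)
  (mu : Om' -> R -> prob R (curve g)).
Hypothesis Hmu : subsequential_limit P (fun n => empirical_path g (@X n)) P' mu.

(** Convergence in law identifies the integral with a limit of integrals along the subsequence, and
    these tend to zero. *)
Lemma integral_capped_defect (phi : R -> R) (t : R) : C2per l phi -> 0 <= t ->
  (\int[P']_w (capped_defect phi t (mu w))%:E = 0)%E.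
Proof.
move=> Cphi t0; have T0 : 0 < t + 1 by rewrite ltr_wpDl.
have tT : 0 <= t <= t + 1 by rewrite t0 lerDl ler01.
have [_ [k [hk Hk]]] := Hmu.
have kn n : (n <= k n)%N.
  by elim: n => // n IH; apply: leq_ltn_trans IH (hk _ _ _).
have b1 : exists M : R, forall p : paths (curve g) (t + 1), continuous_paths p ->
    `|capped_defect phi t p| <= M.
  by exists 1 => p _; have /andP[h1 h2] := capped_defect_itv phi t p; rewrite ger0_norm.
have cv := Hk (t + 1) T0 _ (capped_defect_continuous Cphi tT) b1.
apply/le_anti/andP; split; last first.
  by apply: integral_ge0 => w _; rewrite lee_fin; case/andP: (capped_defect_itv phi t (mu w)).
apply/lee_addgt0Pr => e e0; rewrite add0e.
have [n0 Hn0] := capped_defect_small Cphi t0 e0.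
rewrite -(cvg_lim _ cv)//; apply: lime_le; first by apply/cvg_ex; eexists; exact: cv.
by exists n0 => // n /= nn; apply: Hn0; exact: leq_trans (kn n).
Qed.

Lemma limit_defect_ae (phi : R -> R) (t : R) : C2per l phi -> 0 <= t ->
  {ae P', forall w, limit_defect phi (mu w) t = 0}.
Proof.
move=> Cphi t0; have T0 : 0 < t + 1 by rewrite ltr_wpDl.
have tT : 0 <= t <= t + 1 by rewrite t0 lerDl ler01.
have [Rp _] := Hmu; have [cmu mmu] := Rp _ T0.
have zero k : {ae P', forall w, capped_defect phi t (mu w) <= k.+1%:R^-1}.
  pose A := [set w | k.+1%:R^-1 < capped_defect phi t (mu w)].
  (* The functional is continuous only on continuous paths; since all values of [mu] are such paths,
     the event is the preimage of an open set of the whole path space. *)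
  have mA : measurable A.
    have op := (continuousP _).1 (capped_defect_continuous Cphi tT) _ (@open_gt R k.+1%:R^-1).
    have /open_subspaceP[V oV VA] := op.
    rewrite (_ : A = [set w | V (mu w : paths (curve g) (t + 1))]); first exact: mmu.
    apply/seteqP; split => w; have Dw := cmu w.
      by move=> Aw; have : (V `&` @continuous_paths R (curve g) (t + 1)) (mu w);
        [rewrite VA; split|case].
    by move=> Vw; have : (V `&` @continuous_paths R (curve g) (t + 1)) (mu w);
      [split|rewrite VA; case].
  have k0 : 0 < k.+1%:R^-1 :> R by rewrite invr_gt0.
  have PA : P' A = 0%E.
    have E : ((k.+1%:R^-1)%:E * P' A = \int[P']_w (k.+1%:R^-1 * \1_A w)%:E)%E.
      under eq_integral do rewrite EFinM.
      rewrite ge0_integralZl_EFin//; first by rewrite integral_indic// setIT.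
      - by apply/measurable_EFinP; exact: measurable_indic.
    have : ((k.+1%:R^-1)%:E * P' A <= 0)%E.
      rewrite E -(integral_capped_defect Cphi t0); apply: ge0_integral_mono => w.
        by rewrite lee_fin mulr_ge0// ltW.
      rewrite lee_fin indicE; have [wA|wA] := boolP (w \in A).
        by rewrite mulr1; exact/ltW/set_mem.
      by rewrite mulr0; case/andP: (capped_defect_itv phi t (mu w)).
    rewrite pmule_rle0 ?lte_fin// => h.
    by apply/le_anti; rewrite h measure_ge0.
  exists A; split => // w /= Hw; rewrite /A/= ltNge; exact/negP.
have := ae_foralln zero; apply: filterS => w Hw; exact: capped_defect0.
Qed.

(** Rational times suffice: the pairing is continuous along the path and the drift is bounded. The
    rational is taken to the right of [t], which keeps it nonnegative. *)
Lemma limit_defect_time_continuous (phi : R -> R) (T : R) p : C2per l phi ->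
  @continuous_paths R (curve g) T p -> forall t, 0 <= t < T -> forall e : R, 0 < e ->
  exists q : rat, 0 <= (ratr q : R) /\
    `|limit_defect phi p t - limit_defect phi p (ratr q)| <= e.
Proof.
move=> Cphi cp t /andP[t0 tT] e e0; have e20 : 0 < e / 2 by rewrite divr_gt0.
have [C C0 HC] := mean_drift_bound jg cg beta0 Cphi.
have /subspace_continuousP ct := continuous_paths_pairing (C2per_bounded_cont jg cg Cphi) cp.
have tT' : `[0, T]%classic t by rewrite /= in_itv/= t0 ltW.
have FF : Filter (within `[0, T] (nbhs t)) by apply: within_filter; exact: nbhs_filter.
have /(@cvgrPdist_lt _ _ _ _ FF)/(_ _ e20)[x /= x0 Hx] := ct t tT'.
pose y := Num.min (T - t) (Num.min x (e / 2 / C)).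
have y0 : 0 < y by rewrite !lt_min subr_gt0 tT x0 divr_gt0.
have : t < t + y by rewrite ltrDl.
move=> /rat_in_itvoo[q]; rewrite in_itv/= => /andP[tq qy].
have q0 : 0 <= (ratr q : R) by exact: le_trans (ltW tq).
have tqy : ratr q - t < y by rewrite ltrBlDl.
have [qT qx qC] : [/\ ratr q <= T, ratr q - t < x & ratr q - t < e / 2 / C].
  by move: tqy; rewrite !lt_min ltrD2r => /and3P[h1 h2 h3]; split => //; exact: ltW.
exists q; split => //.
have H1 : `|(p t) << phi >> - (p (ratr q)) << phi >>| < e / 2.
  apply: (Hx (ratr q)); last by rewrite /= in_itv/= q0.
  by rewrite /= distrC gtr0_norm ?subr_gt0.
have cd := path_drift_continuous Cphi cp (lexx T).
have H2 := Rintegral_lipschitz cd (fun u => HC (p u)) t0 (ltW tq) qT.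
have -> : limit_defect phi p t - limit_defect phi p (ratr q) =
    ((p t) << phi >> - (p (ratr q)) << phi >>) +
    (\int[leb]_(r in `[0, ratr q]) (beta / 4 * mean_drift jg phi (p r)) -
     \int[leb]_(r in `[0, t]) (beta / 4 * mean_drift jg phi (p r))).
  by rewrite /limit_defect; ring.
apply: le_trans (ler_normD _ _) _; rewrite (splitr e); apply: lerD; first exact: ltW.
apply: le_trans H2 _; move: qC; rewrite ltr_pdivlMr// mulrC => /ltW; exact.
Qed.

(** The [2] stands for the pairings at time [t] and at the start, and [C * t] for the integrated
    drift, which is Lipschitz in the second derivative of the test function. *)
Lemma limit_defect_dist : exists2 C : R, 0 <= C & forall (phi psi : R -> R) (e T t : R)
    (p : paths (curve g) T), C2per l phi -> C2per l psi ->
  (forall s, `|phi s - psi s| <= e) ->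
  (forall s, `|rderiv (rderiv phi) s - rderiv (rderiv psi) s| <= e) ->
  continuous_paths p -> 0 <= t <= T ->
  `|limit_defect phi p t - limit_defect psi p t| <= (2 + C * t) * e.
Proof.
have [C C0 HC] := mean_drift_C2_dist jg cg.
exists (beta / 4 * C) => [|phi psi e T t p h1 h2 close close2 cp /andP[t0 tT]].
  by rewrite mulr_ge0// divr_ge0.
have D (m : prob R (curve g)) : `|m << phi >> - m << psi >>| <= e.
  by apply: pairing_dist; [exact: C2per_bounded_cont|exact: C2per_bounded_cont|move=> z; exact: close].
have I : `|\int[leb]_(r in `[0, t]) (beta / 4 * mean_drift jg phi (p r)) -
    \int[leb]_(r in `[0, t]) (beta / 4 * mean_drift jg psi (p r))| <= beta / 4 * (C * e) * (t - 0).
  apply: Rintegral_dist t0 _ _ _.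
  - exact: path_drift_continuous cp tT.
  - exact: path_drift_continuous cp tT.
  - move=> r _; rewrite -mulrBr normrM ger0_norm ?divr_ge0// ler_wpM2l ?divr_ge0//; exact: HC.
have alg (a b c a' b' c' : R) :
    a - b - c - (a' - b' - c') = (a - a') - (b - b') - (c - c') by ring.
rewrite /limit_defect alg.
apply: le_trans (ler_normB _ _) _; apply: le_trans (lerD (ler_normB _ _) I) _.
apply: le_trans (lerD (lerD (D _) (D _)) (lexx _)) _.
by rewrite subr0 le_eqVlt; apply/orP; left; apply/eqP; ring.
Qed.

(** A single null set has to serve all test functions and all times. It is the union over a
    countable dense family and the rational times; continuity in time and in the test function does
    the rest. *)
Lemma limit_equation_ae : {ae P', forall w, forall phi, C2per l phi ->
  forall t, 0 <= t -> limit_defect phi (mu w) t = 0}.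
Proof.
have [D [DC2 Ddense]] := C2per_separable l0.
have ae1 k : {ae P', forall w, forall i, if @pickle_inv rat i is Some q then
    0 <= (ratr q : R) -> limit_defect (D k) (mu w) (ratr q) = 0 else True}.
  apply: ae_foralln => i; case: (pickle_inv i) => [q|]; last exact: aeW.
  have [q0|q0] := pselect (0 <= (ratr q : R)); last by apply: aeW => w /q0.
  by apply: filterS (limit_defect_ae (DC2 k) q0) => w.
have := ae_foralln ae1; apply: filterS => w Hw.
have Rp := Hmu.1; have cmu T T0 := (Rp T T0).1 w.
have zD k t : 0 <= t -> limit_defect (D k) (mu w) t = 0.
  move=> t0; have T0 : 0 < t + 1 by rewrite ltr_wpDl.
  have tT : 0 <= t < t + 1 by rewrite t0 ltrDl ltr01.
  apply/eqP; rewrite -normr_le0; apply/ler_addgt0Pr => e e0; rewrite add0r.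
  have [q [q0 Hq]] := limit_defect_time_continuous (DC2 k) (cmu _ T0) tT e0.
  have := Hw k (pickle q); rewrite pickleK_inv => /(_ q0) E.
  by rewrite E subr0 in Hq.
move=> phi Cphi t t0; have T0 : 0 < t + 1 by rewrite ltr_wpDl.
have tT : 0 <= t <= t + 1 by rewrite t0 lerDl ler01.
have [C C0 HC] := limit_defect_dist.
apply/eqP; rewrite -normr_le0; apply/ler_addgt0Pr => e e0; rewrite add0r.
have c0 : 0 < 2 + C * t by rewrite ltr_pwDl// mulr_ge0.
have e10 : 0 < e / (2 + C * t) by rewrite divr_gt0.
have [k [H1 H2]] := Ddense phi _ Cphi e10.
have := HC _ _ _ _ _ _ Cphi (DC2 k) H1 H2 (cmu _ T0) tT.
by rewrite zD// subr0 mulrC divfK// gt_eqF.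
Qed.

End limit_equation.

Theorem theorem1p16 (R : realType) (l : R) (gamma : R -> R[i])
    (tau : R[i] -> R[i]) (beta : R)
    (d : nat -> measure_display) (Om : forall n, measurableType (d n))
    (P : forall n, probability (Om n) R)
    (B X : forall n, 'I_n.+1 -> R -> Om n -> R)
    (mu0 : prob R (curve gamma)) :
  jordan_arclength l gamma -> C2 gamma ->
  (forall s, tau (gamma s) = cderive gamma s) ->
  1 <= beta ->
  (forall n, dyson_bm (P n) l gamma beta (B n) (X n)) ->
  cvg_in_prob P (fun n w => empirical_path gamma (X n) w 0) mu0 ->
  tight P (fun n => empirical_path gamma (X n)) /\
  (forall (d' : measure_display) (Om' : measurableType d')
      (P' : probability Om' R)
      (mu : Om' -> R -> prob R (curve gamma)),
    subsequential_limit P (fun n => empirical_path gamma (X n)) P' mu ->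
    {ae P', forall w, forall f : R[i] -> R, smooth_near (range gamma) f ->
      forall t, 0 <= t ->
        pairing (mu w t) (fun z => f (curve_val z)) =
        pairing mu0 (fun z => f (curve_val z)) +
        \int[lebesgue_measure]_(r in `[0, t])
          (beta / 4 * limit_drift tau f (mu w r))}).
Proof.
move=> jg cg tauE beta1 HD init; have beta0 : 0 <= beta by exact: le_trans ler01 beta1.
split; first exact: (dyson_tight jg cg beta0 HD).
move=> d' Om' P' mu Hmu.
apply: filterS (limit_equation_ae jg cg beta0 HD init Hmu) => w Hw f sf t t0.
have Cf := smooth_C2per jg cg sf.
(* On the curve a test function is determined by its composition with [gamma], so the equation for
   periodic functions applies. *)
have E (m : prob R (curve gamma)) : pairing m (fun z => f (curve_val z)) =
    pairing m (curve_fun jg (f \o gamma)).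
  congr pairing; rewrite -[LHS](curve_fun_onE jg); congr curve_fun.
have -> : \int[lebesgue_measure]_(r in `[0, t]) (beta / 4 * limit_drift tau f (mu w r)) =
    \int[lebesgue_measure]_(r in `[0, t]) (beta / 4 * mean_drift jg (f \o gamma) (mu w r)).
  by apply: eq_Rintegral => r _; rewrite (limit_driftE jg cg _ tauE sf).
have cancel (a b c : R) : a - b - c = 0 -> a = b + c by lra.
by rewrite !E; apply: cancel; exact: (Hw _ Cf t t0).
Qed.
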